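(* Let $\{f_i\}_{i=1}^\infty$ be a sequence of uniformly bounded measurable functions $f_i\in L^\infty(A_i)$ on compact abelian groups $A_i$, converging to $f\in L^2(A)$ (on a compact abelian group $A$) in the metric $d'$. Then $\mu_{f_i}$ converges to $\mu_f$ in the weak topology of measures.
   Context: All compact abelian groups are second countable with normalized Haar measure. For measurable $f$ on $A$, $\mu_f$ is the distribution on $\mathbb{C}$ of $f(x)$ with $x$ Haar-random in $A$. Metric $\hat d$: for a group $G$, $l^2(G)$ is the set of $f:G\to\mathbb{C}$ with $\sum_g|f(g)|^2<\infty$; ${\rm supp}_\epsilon(f)=\{g:|f(g)|>\epsilon\}$. A partial isomorphism of weight $n$ between groups $G_1,G_2$ is a bijection $\phi:S_1\to S_2$ ($S_j\subseteq G_j$) such that for all $g_1,\dots,g_n\in S_1$, $\alpha_i\in\{-1,0,1\}$: $g_1^{\alpha_1}\cdots g_n^{\alpha_n}=1$ iff $\phi(g_1)^{\alpha_1}\cdots\phi(g_n)^{\alpha_n}=1$. An $\epsilon$-isomorphism between $f_1\in l^2(G_1)$, $f_2\in l^2(G_2)$ is a partial isomorphism $\phi:S_1\to S_2$ of weight $\lceil1/\epsilon\rceil$ with ${\rm supp}_\epsilon(f_j)\subseteq S_j$ and $|f_1(g)-f_2(\phi(g))|\le\epsilon$ for $g\in S_1$; $\hat d(f_1,f_2)$ is the infimum of such $\epsilon$. For $f_j\in L^2(A_j)$, $d(f_1,f_2)=\hat d(\hat f_1,\hat f_2)$ with $\hat f_j$ the Fourier transform on the dual group, and $d'(f_1,f_2)=d(f_1,f_2)+\big|\|f_1\|_2-\|f_2\|_2\big|$.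 Convergence in $d'$ (''tight convergence'') means convergence in $d$ together with convergence of $L^2$ norms to that of the limit. *)

(* Defs.v *)
From HB Require Import structures.
From mathcomp Require Import all_boot all_order all_algebra.
From mathcomp Require Import all_classical all_reals all_analysis.
From mathcomp Require Import complex.
Set Implicit Arguments.
Unset Strict Implicit.
Unset Printing Implicit Defensive.
Import Order.TTheory GRing.Theory Num.Theory.
Import numFieldNormedType.Exports.
Local Open Scope classical_set_scope.
Local Open Scope ring_scope.

(* [R[i]] itself has no topology in the library; its regular module [R[i]^o]
   carries the one induced by the modulus. *)
Notation cplx R := (R[i]^o)%type.

(* The norm of [R[i]] takes values in [R[i]]; this is the real-valued one. *)
Definition cmod {R : realType} (z : cplx R) : R := complex.Re `|z|.

Notation borel T := (g_sigma_algebraType (@open T)).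

HB.mixin Record isCompactAbelianGroup A of TopologicalZmodule A := {
  group_compact : compact [set: A];
  group_hausdorff : hausdorff_space A;
  group_second_countable : @second_countable A
}.

#[short(type="compactAbelianGroupType")]
HB.structure Definition CompactAbelianGroup :=
  {A of TopologicalZmodule A & isCompactAbelianGroup A}.

(* [g_sigma_algebraType] requires a pointed type. *)
HB.instance Definition _ (A : compactAbelianGroupType) :=
  isPointed.Build (CompactAbelianGroup.sort A) 0.

(* Normalization is part of [probability]. *)
Definition is_haar {R : realType} (A : compactAbelianGroupType)
    (mu : probability (borel A) R) : Prop :=
  forall (a : A) (E : set (borel A)), measurable E ->
    mu [set a + (x : A) | x in E] = mu E.

Section DualGroup.
Variables (R : realType) (A : compactAbelianGroupType).

Record dual := Dual {
  char_fun :> A -> cplx R;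
  char_continuous : continuous char_fun;
  char_add : forall x y, char_fun (x + y) = char_fun x * char_fun y;
  char_mod : forall x, `|char_fun x| = 1
}.

Lemma dualP (u v : dual) : (forall x, u x = v x) -> u = v.
Proof.
case: u v => [u uc ua um] [v vc va vm] /= /funext uv.
by move: uc ua um; rewrite uv => uc ua um; congr Dual; exact: Prop_irrelevance.
Qed.

HB.instance Definition _ := gen_eqMixin dual.
HB.instance Definition _ := gen_choiceMixin dual.

Lemma dual_one_continuous : continuous (fun _ : A => 1 : cplx R).
Proof. by move=> x; exact: cvg_cst. Qed.

Definition dual_one : dual.
Proof.
apply: (@Dual (fun=> 1)); first exact: dual_one_continuous.
- by move=> x y; rewrite mulr1.
- by move=> x; rewrite normr1.
Defined.

Definition dual_mul (u v : dual) : dual.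
Proof.
apply: (@Dual (fun x => u x * v x)).
- by move=> x; apply: cvgM; exact: char_continuous.
- by move=> x y; rewrite !char_add mulrACA.
- by move=> x; rewrite normrM !char_mod mulr1.
Defined.

Lemma char0 (u : dual) : u 0 = 1.
Proof.
have u0 : u 0 != 0 by rewrite -normr_eq0 char_mod oner_neq0.
by apply: (mulfI u0); rewrite -char_add addr0 mulr1.
Qed.

Definition dual_inv (u : dual) : dual.
Proof.
apply: (@Dual (fun x => u (- x))).
- move=> x; apply: (@continuous_comp _ _ _ -%R u).
    exact: opp_continuous.
  exact: char_continuous.
- by move=> x y; rewrite opprD char_add.
- by move=> x; rewrite char_mod.
Defined.

Lemma dual_mulA : associative dual_mul.
Proof. by move=> u v w; apply: dualP => x /=; rewrite mulrA. Qed.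

Lemma dual_mul1 : left_id dual_one dual_mul.
Proof. by move=> u; apply: dualP => x /=; rewrite mul1r. Qed.

Lemma dual_mulr1 : right_id dual_one dual_mul.
Proof. by move=> u; apply: dualP => x /=; rewrite mulr1. Qed.

Lemma dual_mulV : left_inverse dual_one dual_inv dual_mul.
Proof. by move=> u; apply: dualP => x /=; rewrite -char_add addNr char0. Qed.

Lemma dual_mulrV : right_inverse dual_one dual_inv dual_mul.
Proof. by move=> u; apply: dualP => x /=; rewrite -char_add subrr char0. Qed.

HB.instance Definition _ := isGroup.Build dual
  dual_mulA dual_mul1 dual_mulr1 dual_mulV dual_mulrV.

End DualGroup.

Definition zpowg {G : groupType} (g : G) (a : int) : G :=
  match a with Posz n => (g ^+ n)%g | Negz n => (g ^- n.+1)%g end.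

(* [phi] is a total function, but only its restriction to [S1] matters. *)
Definition partial_iso {G1 G2 : groupType} (n : nat) (S1 : set G1)
    (S2 : set G2) (phi : G1 -> G2) : Prop :=
  set_bij S1 S2 phi /\
  forall (g : 'I_n -> G1) (a : 'I_n -> int),
    (forall k, S1 (g k)) -> (forall k, a k \in [:: -1; 0; 1]) ->
    (\prod_(k < n) zpowg (g k) (a k) = 1)%g <->
    (\prod_(k < n) zpowg (phi (g k)) (a k) = 1)%g.

Section HatDistance.
Variable R : realType.

Definition supp_eps {G : groupType} (e : R) (f : G -> cplx R) : set G :=
  [set g | e < cmod (f g)].

Definition eps_iso {G1 G2 : groupType} (e : R) (f1 : G1 -> cplx R)
    (f2 : G2 -> cplx R) : Prop :=
  exists (S1 : set G1) (S2 : set G2) (phi : G1 -> G2),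
    [/\ partial_iso `|Num.ceil (1 / e)|%N S1 S2 phi,
        supp_eps e f1 `<=` S1,
        supp_eps e f2 `<=` S2 &
        forall g, S1 g -> cmod (f1 g - f2 (phi g)) <= e].

(* Meaningful on l^2 functions: for bounded [f1], [f2] the set is nonempty
   (take [S1] and [S2] empty and [e] large), so that [inf] is its infimum. *)
Definition hat_dist {G1 G2 : groupType} (f1 : G1 -> cplx R)
    (f2 : G2 -> cplx R) : R :=
  inf [set e : R | 0 < e /\ eps_iso e f1 f2].

End HatDistance.

Definition cintegral {R : realType} d (T : measurableType d)
    (mu : {measure set T -> \bar R}) (h : T -> cplx R) : cplx R :=
  Complex (\int[mu]_x complex.Re (h x)) (\int[mu]_x complex.Im (h x)).

Notation cmfun A R := {mfun borel A >-> borel (cplx R)}.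

Section FunctionDistance.
Variable R : realType.

Definition fourier {A : compactAbelianGroupType} (mu : probability (borel A) R)
    (f : cmfun A R) : dual R A -> cplx R :=
  fun chi => cintegral mu (fun x => f x * (chi x)^*).

Definition cLnorm {A : compactAbelianGroupType} (mu : probability (borel A) R)
    (p : \bar R) (f : cmfun A R) : \bar R :=
  Lnorm mu p (fun x => (cmod (f x))%:E).

Definition dist_d {A1 A2 : compactAbelianGroupType}
    (mu1 : probability (borel A1) R) (mu2 : probability (borel A2) R)
    (f1 : cmfun A1 R) (f2 : cmfun A2 R) : R :=
  hat_dist (fourier mu1 f1) (fourier mu2 f2).

Definition dist_d' {A1 A2 : compactAbelianGroupType}
    (mu1 : probability (borel A1) R) (mu2 : probability (borel A2) R)
    (f1 : cmfun A1 R) (f2 : cmfun A2 R) : R :=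
  dist_d mu1 mu2 f1 f2 +
  `|fine (cLnorm mu1 2%:E f1) - fine (cLnorm mu2 2%:E f2)|.

Definition weak_cvg {T : ptopologicalType} (nu_ : nat -> probability (borel T) R)
    (nu : probability (borel T) R) : Prop :=
  forall h : T -> R, continuous h -> (exists M : R, forall z, `|h z| <= M) ->
    (\int[nu_ n]_z h z) @[n --> \oo] --> \int[nu]_z h z.

End FunctionDistance.

(* Main.v *)
(* By Parseval, f is within a small L^2 distance of its truncation
   p = sum_j z_j chi_j to finitely many characters with nonzero coefficients.
   For large i an e_i-isomorphism matches each chi_j with a character psi_(i,j)
   of A_i, and z_(i,j) := \hat f_i(psi_(i,j)) -> z_j.  Since ||f_i||_2 -> ||f||_2,
   the Pythagorean identity shows that p_i := sum_j z_(i,j) psi_(i,j) is eventually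
   just as close to f_i.  The weights of the isomorphisms tend to infinity, so that
   every relation between the chi_j is eventually equivalent to the corresponding
   relation between the psi_(i,j); as the integral of a character is 1 or 0
   according to whether it is trivial, all mixed moments of p_i converge to those
   of p.  As p_i and p are uniformly bounded, Bernstein polynomials (as the mean
   of a binomial random walk) turn this into weak convergence.  Finally a bounded
   continuous h satisfies
     |h z - h w| <= a + C |z - w|^2 + (2 H / K^2) |z|^2,
   which bounds the effect on the integral of h of replacing f_i by p_i.

   Parseval rests on the existence of characters not orthogonal to a given
   continuous even function k with k 0 <> 0.  Power iteration for convolution by k
   gives a continuous idempotent P of finite rank P 0 in the convolution algebra;
   decreasing P 0 as far as possible, P becomes proportional to a solution of
   d'Alembert's equation c(x + y) + c(x - y) = 2 c(x) c(y), which is the real part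
   of a character.  If the indicator function of E violated Parseval, then
   k := (autocorrelation of E) - sum_chi |\hat 1_E(chi)|^2 Re chi would have
   k 0 <> 0 and yet be orthogonal to all characters. *)
Require Import Defs.
From HB Require Import structures.
From mathcomp Require Import all_boot all_order all_algebra.
From mathcomp Require Import all_classical all_reals all_analysis.
From mathcomp Require Import measurable_realfun complex.
From mathcomp Require Import ring lra zify.
Import Order.TTheory GRing.Theory Num.Theory.
Import numFieldNormedType.Exports.
Local Open Scope classical_set_scope.
Local Open Scope ring_scope.
Set Implicit Arguments.
Unset Strict Implicit.
Unset Printing Implicit Defensive.

Section ProbabilityIntegral.
Context d (T : measurableType d) (R : realType) (P : probability T R).
Implicit Types f g : T -> R.

Definition expect f : R := \int[P]_x f x.
Definition rint f : Prop := P.-integrable setT (EFin \o f).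
Definition sqint f : Prop :=
  measurable_fun setT f /\ rint (fun x => f x ^+ 2).
Definition bmeas f : Prop :=
  measurable_fun setT f /\ exists M : R, forall x, `|f x| <= M.

Lemma rintD f g : rint f -> rint g -> rint (fun x => f x + g x).
Proof. exact: integrableD. Qed.

Lemma rintB f g : rint f -> rint g -> rint (fun x => f x - g x).
Proof. exact: integrableB. Qed.

Lemma rintZ a f : rint f -> rint (fun x => a * f x).
Proof. exact: integrableZl. Qed.

Lemma bmeas_rint f : bmeas f -> rint f.
Proof.
move=> [mf [M fM]]; apply: measurable_bounded_integrable => //.
  exact: le_lt_trans (probability_le1 P measurableT) (ltry 1).
by exists M; split; rewrite ?num_real // => x Mx y _; apply: le_trans (fM y) (ltW Mx).
Qed.

Lemma bmeas_cst a : bmeas (fun=> a).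
Proof. by split => //; exists `|a|. Qed.

Lemma bmeasD f g : bmeas f -> bmeas g -> bmeas (fun x => f x + g x).
Proof.
move=> [mf [M fM]] [mg [N gN]]; split; first exact: measurable_funD.
by exists (M + N) => x; rewrite (le_trans (ler_normD _ _))// lerD.
Qed.

Lemma bmeasM f g : bmeas f -> bmeas g -> bmeas (fun x => f x * g x).
Proof.
move=> [mf [M fM]] [mg [N gN]]; split; first exact: measurable_funM.
by exists (M * N) => x; rewrite normrM ler_pM.
Qed.

Lemma bmeasZ a f : bmeas f -> bmeas (fun x => a * f x).
Proof. by apply: bmeasM; exact: bmeas_cst. Qed.

Lemma bmeasN f : bmeas f -> bmeas (fun x => - f x).
Proof.
move=> [mf [M fM]]; split; first exact: measurableT_comp.
by exists M => x; rewrite normrN.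
Qed.

Lemma bmeasB f g : bmeas f -> bmeas g -> bmeas (fun x => f x - g x).
Proof. by move=> bf bg; apply: bmeasD => //; exact: bmeasN. Qed.

Lemma bmeas_norm f : bmeas f -> bmeas (fun x => `|f x|).
Proof.
move=> [mf [M fM]]; split; first exact: measurableT_comp.
by exists M => x; rewrite normr_id.
Qed.

Lemma bmeas_sum (I : Type) (r : seq I) (Q : pred I) (F : I -> T -> R) :
  (forall i, Q i -> bmeas (F i)) -> bmeas (fun x => \sum_(i <- r | Q i) F i x).
Proof.
move=> bF; elim: r => [|i r ih].
  by under eq_fun do rewrite big_nil; exact: bmeas_cst.
under eq_fun do rewrite big_cons.
by have [Qi|//] := boolP (Q i); apply: bmeasD => //; exact: bF.
Qed.

Lemma bmeas_indic (A : set T) : measurable A -> bmeas (\1_A).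
Proof.
move=> mA; split; first exact: measurable_indic.
by exists 1 => x; rewrite indicE; case: (_ \in _); rewrite ?normr1 ?normr0.
Qed.

Lemma bmeas_sqint f : bmeas f -> sqint f.
Proof.
move=> bf; split; first exact: bf.1.
by apply: bmeas_rint; under eq_fun do rewrite expr2; exact: bmeasM.
Qed.

Lemma le_rint f g : measurable_fun setT f -> (forall x, `|f x| <= g x) ->
  rint g -> rint f.
Proof.
move=> mf fg; apply: le_integrable => //; first exact/measurable_EFinP.
by move=> x _ /=; rewrite lee_fin (le_trans (fg x))// ler_norm.
Qed.

Lemma sqint_rintM f g : sqint f -> sqint g -> rint (fun x => f x * g x).
Proof.
move=> [mf f2] [mg g2].
apply: (@le_rint _ (fun x => f x ^+ 2 + g x ^+ 2)).
- exact: measurable_funM.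
- move=> x; rewrite ler_norml; apply/andP; split; nra.
- exact: rintD.
Qed.

Lemma sqintZ a f : sqint f -> sqint (fun x => a * f x).
Proof.
move=> [mf f2]; split; first exact: measurable_funM.
by under eq_fun do rewrite exprMn; exact: rintZ.
Qed.

Lemma sqintD f g : sqint f -> sqint g -> sqint (fun x => f x + g x).
Proof.
move=> sf sg; split; first exact: measurable_funD sf.1 sg.1.
under eq_fun do rewrite sqrrD; apply: rintD; last exact: sg.2.
apply: rintD; first exact: sf.2.
by under eq_fun do rewrite -mulr_natl; apply: rintZ; exact: sqint_rintM.
Qed.

Lemma sqintB f g : sqint f -> sqint g -> sqint (fun x => f x - g x).
Proof.
move=> sf sg; under eq_fun do rewrite -[- g _]mulN1r.
by apply: sqintD => //; exact: sqintZ.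
Qed.

Lemma expectD f g : rint f -> rint g ->
  expect (fun x => f x + g x) = expect f + expect g.
Proof. exact: RintegralD. Qed.

Lemma expectB f g : rint f -> rint g ->
  expect (fun x => f x - g x) = expect f - expect g.
Proof. exact: RintegralB. Qed.

Lemma expectZ a f : rint f -> expect (fun x => a * f x) = a * expect f.
Proof. exact: RintegralZl. Qed.

Lemma expect_cst a : expect (fun=> a) = a.
Proof.
rewrite /expect Rintegral_cst//.
have /(congr1 fine) /= P1 := probability_setT P.
by rewrite -[RHS]mulr1; congr (_ * _).
Qed.

Lemma eq_expect f g : f =1 g -> expect f = expect g.
Proof. by move=> fg; apply: eq_Rintegral => x _; exact: fg. Qed.

Lemma expect_ge0 f : (forall x, 0 <= f x) -> 0 <= expect f.
Proof. by move=> f0; exact: Rintegral_ge0. Qed.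

Lemma le_expect f g : rint f -> rint g -> (forall x, f x <= g x) ->
  expect f <= expect g.
Proof. by move=> rf rg fg; exact: le_Rintegral. Qed.

Lemma le_norm_expect f : rint f -> `|expect f| <= expect (fun x => `|f x|).
Proof. by move=> rf; exact: le_normr_Rintegral. Qed.

Lemma expect_indic (A : set T) : measurable A -> expect \1_A = fine (P A).
Proof. by move=> mA; rewrite /expect /Rintegral integral_indic// setIT. Qed.

Lemma rint_sum (I : Type) (r : seq I) (Q : pred I) (F : I -> T -> R) :
  (forall i, Q i -> rint (F i)) -> rint (fun x => \sum_(i <- r | Q i) F i x).
Proof.
move=> rF; elim: r => [|i r ih].
  by under eq_fun do rewrite big_nil; apply: bmeas_rint; exact: bmeas_cst.
under eq_fun do rewrite big_cons.
by have [Qi|//] := boolP (Q i); apply: rintD => //; exact: rF.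
Qed.

Lemma expect_sum (I : Type) (r : seq I) (Q : pred I) (F : I -> T -> R) :
  (forall i, Q i -> rint (F i)) ->
  expect (fun x => \sum_(i <- r | Q i) F i x) = \sum_(i <- r | Q i) expect (F i).
Proof.
move=> rF; elim: r => [|i r ih].
  by rewrite big_nil; under eq_fun do rewrite big_nil; exact: expect_cst.
rewrite big_cons; under eq_fun do rewrite big_cons.
case: ifPn => // Qi; rewrite expectD ?ih//; [exact: rF|exact: rint_sum].
Qed.

Lemma cauchy_schwarz f g : sqint f -> sqint g ->
  (expect (fun x => f x * g x)) ^+ 2 <=
  expect (fun x => f x ^+ 2) * expect (fun x => g x ^+ 2).
Proof.
move=> sf sg.
set a := expect (fun x => f x ^+ 2); set b := expect (fun x => g x ^+ 2).
set c := expect _.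
have q s t : 0 <= s ^+ 2 * a + 2 * s * t * c + t ^+ 2 * b.
  have -> : s ^+ 2 * a + 2 * s * t * c + t ^+ 2 * b =
      expect (fun x => (s * f x + t * g x) ^+ 2).
    rewrite /a /b /c -!expectZ//.
    + rewrite -!expectD; first by apply: eq_expect => x; ring.
      * by apply: rintD; apply: rintZ; [exact: sf.2|exact: sqint_rintM].
      * by apply: rintZ; exact: sg.2.
      * by apply: rintZ; exact: sf.2.
      * by apply: rintZ; exact: sqint_rintM.
    + exact: sg.2.
    + exact: sqint_rintM.
    + exact: sf.2.
  by apply: expect_ge0 => x; exact: sqr_ge0.
have a0 : 0 <= a by apply: expect_ge0 => x; exact: sqr_ge0.
have b0 : 0 <= b by apply: expect_ge0 => x; exact: sqr_ge0.
have [a00|] := eqVneq a 0; last first.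
  move=> an0; have {an0}agt : 0 < a by rewrite lt_neqAle eq_sym an0.
  have := q (- c) a; nra.
rewrite a00 mul0r; have [->|c0] := eqVneq c 0; first by rewrite expr0n.
have := q (- (b + 1) / c) 1.
by rewrite a00 [X in 0 <= X](_ : _ = - b - 2) => [|]; [lra|field].
Qed.

End ProbabilityIntegral.

Section FubiniExpect.
Context d (T : measurableType d) d' (T' : measurableType d') (R : realType)
  (P : probability T R) (P' : probability T' R).

Lemma expect_fubini (F : T -> T' -> R) :
  measurable_fun setT (fun z : T * T' => F z.1 z.2) ->
  (exists M : R, forall x y, `|F x y| <= M) ->
  expect P (fun x => expect P' (F x)) = expect P' (fun y => expect P (F ^~ y)).
Proof.
move=> mF [M FM].
have intF : (P \x P')%E.-integrable setT (EFin \o (fun z => F z.1 z.2)).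
  apply: (@bmeas_rint _ _ _ ((P \x P')%E)).
  by split=> //; exists M => z; exact: FM.
have := Fubini intF => /= H.
have m1 x : rint P' (F x).
  apply: bmeas_rint; split; last by exists M.
  exact: (measurableT_comp mF (pair1_measurable x)).
have m2 y : rint P (F ^~ y).
  apply: bmeas_rint; split; last by exists M => x; exact: FM.
  exact: (measurableT_comp mF (pair2_measurable y)).
rewrite /expect /Rintegral; congr fine.
transitivity (\int[P]_x \int[P']_y (F x y)%:E)%E.
  apply: eq_integral => x _; rewrite fineK//.
  exact: integrable_fin_num (m1 x).
rewrite H; apply: eq_integral => y _; rewrite fineK//.
exact: integrable_fin_num (m2 y).
Qed.

Lemma measurable_expect (F : T -> T' -> R) :
  measurable_fun setT (fun z : T * T' => F z.1 z.2) ->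
  (exists M : R, forall x y, `|F x y| <= M) ->
  measurable_fun setT (fun x => expect P' (F x)).
Proof.
move=> mF [M FM].
have intF : (P \x P')%E.-integrable setT (EFin \o (fun z => F z.1 z.2)).
  apply: (@bmeas_rint _ _ _ ((P \x P')%E)).
  by split=> //; exists M => z; exact: FM.
apply: measurableT_comp => //.
exact: (measurable_int _ (integrable_fubini_F intF)).
Qed.

End FubiniExpect.

Section BorelSigma.
Context {R : realType}.

Lemma borel_open (T : ptopologicalType) (U : set T) : open U ->
  measurable (U : set (borel T)).
Proof. by move=> oU; exact: sub_sigma_algebra. Qed.

Lemma continuous_borel (T U : ptopologicalType) (f : T -> U) : continuous f ->
  measurable_fun setT (f : borel T -> borel U).
Proof.
move=> /continuousP cf; apply: (@measurability _ _ (borel T) (borel U) setT f (@open U)) => //.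
move=> _ [V oV <-]; rewrite setTI.
by apply: borel_open; exact: cf.
Qed.

Lemma continuous_borel_real (T : ptopologicalType) (f : T -> R) : continuous f ->
  measurable_fun setT (f : borel T -> R).
Proof.
move=> /continuousP cf; apply: (measurability _ (RGenOpens.measurableE R)) => //.
move=> _ [_ [a [b ->] <-]]; rewrite setTI.
by apply: borel_open; apply: cf; exact: interval_open.
Qed.

End BorelSigma.

(** * Convolution with respect to the Haar measure *)

Section Haar.
Variables (R : realType) (A : compactAbelianGroupType).
Variables (mu : probability (borel A) R) (mu_haar : is_haar mu).

Lemma countable_basis : exists V : nat -> set A, (forall n, open (V n)) /\
  forall x U, nbhs x U -> exists n, V n x /\ V n `<=` U.
Proof.
have [B /countable_injP[c cinj] [Bo Bb]] := @group_second_countable A.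
exists (fun n => \bigcup_(U in [set U | B U /\ c U = n]) U); split.
  by move=> n; apply: bigcup_open => U [/Bo].
move=> x U /Bb[W [BW Wx] WU]; exists (c W); split; first by exists W.
move=> y [W' [BW' cW'] W'y]; apply: WU.
by rewrite -(cinj W' W)// inE.
Qed.

Lemma continuous_shift (a : A) : continuous (fun x : A => x + a).
Proof.
move=> x; apply: (@continuous_comp _ _ _ (fun x => (x, a)) (fun z : A * A => z.1 + z.2)).
  by apply: cvg_pair => /=; [exact: cvg_id|exact: cvg_cst].
exact: add_continuous.
Qed.

Lemma measurable_shift (a : A) :
  measurable_fun setT ((fun x : A => x + a) : borel A -> borel A).
Proof. by apply: continuous_borel; exact: continuous_shift. Qed.

Lemma measurable_opp :
  measurable_fun setT ((fun x : A => - x) : borel A -> borel A).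
Proof. by apply: continuous_borel; exact: opp_continuous. Qed.

Lemma measurable_add :
  measurable_fun setT ((fun z : A * A => z.1 + z.2) : borel A * borel A -> borel A).
Proof.
apply: (@measurability _ _ (borel A * borel A)%type (borel A) setT _ (@open A)) => //.
move=> _ [V oV <-]; rewrite setTI.
have [B [Bo Bb]] := countable_basis.
rewrite [X in measurable X](_ : _ = \bigcup_(n : nat * nat)
    [set z : A * A | [/\ B n.1 z.1, B n.2 z.2 &
     forall x y, B n.1 x -> B n.2 y -> V (x + y)]]); last first.
  apply/seteqP; split => [[x y] /= Vxy|[x y] [n _ /= [nx ny]]]; last exact.
  have : \forall z \near (x, y), V (z.1 + z.2).
    by apply: (@add_continuous A (x, y)); exact: open_nbhs_nbhs.
  case => -[U W] /= [Ux Wy] UWV.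
  have [m [mx mU]] := Bb x _ Ux; have [n [ny nW]] := Bb y _ Wy.
  exists (m, n) => //=; split => // x' y' mx' ny'.
  by apply: (UWV (x', y')); split => /=; [exact: mU|exact: nW].
apply: countable_bigcupT_measurable => // -[m n] /=.
have [mnV|mnV] := pselect (forall x y, B m x -> B n y -> V (x + y)).
  rewrite [X in measurable X](_ : _ = (B m : set (borel A)) `*` (B n : set (borel A))).
    by apply: measurableX; exact: borel_open.
  by apply/seteqP; split => -[x y] /= [].
rewrite [X in measurable X](_ : _ = set0)//.
by apply/seteqP; split => -[x y] //= [].
Qed.

Lemma measurable_sub :
  measurable_fun setT ((fun z : A * A => z.1 - z.2) : borel A * borel A -> borel A).
Proof.
have mp : measurable_fun setT
    ((fun z => (z.1, - z.2 : A)) : borel A * borel A -> borel A * borel A).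
  apply/measurable_fun_pairP; split => /=; first exact: measurable_fst.
  exact: (measurableT_comp measurable_opp measurable_snd).
exact: (measurableT_comp measurable_add mp).
Qed.

Lemma expect_shift (f : A -> R) (a : A) : bmeas (f : borel A -> R) ->
  expect mu (fun x => f (x + a)) = expect mu f.
Proof.
move=> bf; rewrite /expect /Rintegral; congr fine.
have mf := bf.1; have ms := measurable_shift a.
set s : borel A -> borel A := fun x : A => (x + a)%R in ms *.
have shiftE (E : set (borel A)) : measurable E -> mu (s @^-1` E) = mu E.
  move=> mE; rewrite -(mu_haar (- a) mE); congr (mu _).
  apply/seteqP; split => [x /= Ex|_ [x Ex <-] /=].
    by exists (x + a) => //; rewrite addrCA addNr addr0.
  by rewrite /s addrAC addNr add0r.
have bfs : bmeas (f \o s).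
  split; first exact: (measurableT_comp mf ms).
  by have [M fM] := bf.2; exists M => x; exact: fM.
transitivity (\int[pushforward mu s]_y (f y)%:E)%E.
  rewrite integral_pushforward//.
  - exact/measurable_EFinP.
  - exact: bmeas_rint.
by apply: eq_measure_integral => E mE _; exact: shiftE.
Qed.

Local Notation "''E' f" := (expect mu f) (at level 10, f at level 8).

Lemma bmeas_continuous (f : A -> R) : continuous f -> bmeas (f : borel A -> R).
Proof.
move=> cf; split; first exact: continuous_borel_real.
have /compact_bounded[M [_ Mf]] : compact (f @` [set: A]).
  by apply: continuous_compact; [exact/continuous_subspaceT|exact: group_compact].
by exists (M + 1) => x; apply: Mf; [rewrite ltrDl|exists x].
Qed.

Lemma bmeas_shift (f : A -> R) a : bmeas (f : borel A -> R) ->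
  bmeas ((fun x => f (x + a)) : borel A -> R).
Proof.
move=> [mf [M fM]]; split; last by exists M.
exact: (measurableT_comp mf (measurable_shift a)).
Qed.

Lemma bmeas_opp (f : A -> R) : bmeas (f : borel A -> R) ->
  bmeas ((fun x => f (- x)) : borel A -> R).
Proof.
move=> [mf [M fM]]; split; last by exists M.
exact: (measurableT_comp mf measurable_opp).
Qed.

Lemma bmeas_reflect (f : A -> R) a : bmeas (f : borel A -> R) ->
  bmeas ((fun x => f (a - x)) : borel A -> R).
Proof.
move=> bf; under eq_fun do rewrite addrC.
by apply: (bmeas_opp (f := fun x => f (x + a))); exact: bmeas_shift.
Qed.

Lemma measurable_fun_sub (f : A -> R) : measurable_fun setT (f : borel A -> R) ->
  measurable_fun setT ((fun z => f (z.1 - z.2)) : borel A * borel A -> R).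
Proof. by move=> mf; exact: (measurableT_comp mf measurable_sub). Qed.

Lemma expect_opp (f : A -> R) : bmeas (f : borel A -> R) ->
  'E (fun x => f (- x)) = 'E f.
Proof.
move=> bf.
have := @expect_fubini _ _ _ _ _ mu mu (fun x y => f ((x : A) - (y : A))).
have -> : (fun x : borel A => 'E (fun y : borel A => f ((x : A) - (y : A)))) =
    fun=> 'E (fun x => f (- x)).
  apply/funext => x; rewrite -(expect_shift (- x) (bmeas_opp bf)).
  by apply: eq_expect => y /=; rewrite opprD opprK addrC.
have -> : (fun y : borel A => 'E (fun x : borel A => f ((x : A) - (y : A)))) =
    fun=> 'E f.
  by apply/funext => y; rewrite -(expect_shift (- (y : A)) bf).
rewrite !expect_cst; apply; first exact: measurable_fun_sub bf.1.
by have [M fM] := bf.2; exists M.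
Qed.

Lemma expect_reflect (f : A -> R) a : bmeas (f : borel A -> R) ->
  'E (fun x => f (a - x)) = 'E f.
Proof.
move=> bf; rewrite -(expect_shift a bf) -(expect_opp (bmeas_shift a bf)).
by apply: eq_expect => x /=; rewrite addrC.
Qed.

Definition conv (f g : A -> R) (x : A) : R := 'E (fun y => f (x - y) * g y).

Lemma convE f g x : conv f g x = 'E (fun y => f (x - y) * g y).
Proof. by []. Qed.

Lemma bmeas_conv_integrand (f g : A -> R) x : bmeas (f : borel A -> R) ->
  bmeas (g : borel A -> R) -> bmeas ((fun y => f (x - y) * g y) : borel A -> R).
Proof. by move=> bf bg; apply: bmeasM => //; exact: bmeas_reflect. Qed.

Lemma bmeas_conv (f g : A -> R) : bmeas (f : borel A -> R) ->
  bmeas (g : borel A -> R) -> bmeas (conv f g : borel A -> R).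
Proof.
move=> bf bg; have [M fM] := bf.2; have [N gN] := bg.2; split.
  apply: (@measurable_expect _ _ _ _ _ mu mu (fun x y : borel A => f ((x : A) - (y : A)) * g y)).
    apply: measurable_funM; first exact: measurable_fun_sub bf.1.
    exact: (measurableT_comp bg.1 measurable_snd).
  by exists (M * N) => x y; rewrite normrM ler_pM.
exists (M * N) => x; rewrite /conv.
have b := bmeas_conv_integrand x bf bg.
apply: le_trans (le_norm_expect _) _; first exact: bmeas_rint.
rewrite -[leRHS](expect_cst mu); apply: le_expect.
- by apply: bmeas_rint; exact: bmeas_norm.
- by apply: bmeas_rint; exact: bmeas_cst.
- by move=> y; rewrite normrM ler_pM.
Qed.

Lemma convC (f g : A -> R) x : bmeas (f : borel A -> R) ->
  bmeas (g : borel A -> R) -> conv f g x = conv g f x.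
Proof.
move=> bf bg; rewrite /conv -(expect_reflect x (bmeas_conv_integrand x bf bg)).
by apply: eq_expect => y; rewrite mulrC subKr.
Qed.

Lemma convA (f g h : A -> R) x : bmeas (f : borel A -> R) ->
  bmeas (g : borel A -> R) -> bmeas (h : borel A -> R) ->
  conv (conv f g) h x = conv f (conv g h) x.
Proof.
move=> bf bg bh.
have [M fM] := bf.2; have [N gN] := bg.2; have [K hK] := bh.2.
transitivity ('E (fun y => 'E (fun z => f (x - y - z) * g z * h y))).
  apply: eq_expect => y; rewrite /conv mulrC -expectZ.
    by apply: eq_expect => z; rewrite mulrC.
  by apply: bmeas_rint; exact: bmeas_conv_integrand.
transitivity ('E (fun y => 'E (fun z => f (x - y) * g (y - z) * h z))); last first.
  apply: eq_expect => y; rewrite /conv -expectZ.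
    by apply: eq_expect => z; rewrite mulrA.
  by apply: bmeas_rint; exact: bmeas_conv_integrand.
rewrite [RHS](@expect_fubini _ _ _ _ _ mu mu
  (fun y z : borel A => f (x - (y : A)) * g ((y : A) - (z : A)) * h z)).
- apply: eq_expect => z.
  rewrite -[RHS](expect_shift z).
    by apply: eq_expect => y; rewrite opprD addrA addrAC addrK.
  apply: bmeasM; last exact: bmeas_cst.
  by apply: bmeasM; [exact: bmeas_reflect|exact: bmeas_shift].
- apply: measurable_funM; last exact: (measurableT_comp bh.1 measurable_snd).
  apply: measurable_funM; last exact: measurable_fun_sub bg.1.
  exact: (measurableT_comp (bmeas_reflect x bf).1 measurable_fst).
- by exists (M * N * K) => y z; rewrite !normrM !ler_pM// mulr_ge0.
Qed.

Lemma convDl (f g h : A -> R) x : bmeas (f : borel A -> R) ->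
  bmeas (g : borel A -> R) -> bmeas (h : borel A -> R) ->
  conv (fun y => f y + g y) h x = conv f h x + conv g h x.
Proof.
move=> bf bg bh; rewrite /conv -expectD.
- by apply: eq_expect => y; rewrite mulrDl.
- by apply: bmeas_rint; exact: bmeas_conv_integrand.
- by apply: bmeas_rint; exact: bmeas_conv_integrand.
Qed.

Lemma convZl a (f h : A -> R) x : bmeas (f : borel A -> R) ->
  bmeas (h : borel A -> R) -> conv (fun y => a * f y) h x = a * conv f h x.
Proof.
move=> bf bh; rewrite /conv -expectZ.
- by apply: eq_expect => y; rewrite mulrA.
- by apply: bmeas_rint; exact: bmeas_conv_integrand.
Qed.

Lemma conv_even (f g : A -> R) : bmeas (f : borel A -> R) ->
  bmeas (g : borel A -> R) -> (forall x, f (- x) = f x) -> (forall x, g (- x) = g x) ->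
  forall x, conv f g (- x) = conv f g x.
Proof.
move=> bf bg ef eg x; rewrite /conv -(expect_opp (bmeas_conv_integrand (- x) bf bg)).
by apply: eq_expect => y; rewrite eg opprK addrC -[x - y]opprB ef.
Qed.

Lemma conv0 (f g : A -> R) : (forall x, f (- x) = f x) ->
  conv f g 0 = 'E (fun y => f y * g y).
Proof. by move=> ef; apply: eq_expect => y; rewrite sub0r ef. Qed.

Lemma conv_le (f g : A -> R) x : bmeas (f : borel A -> R) ->
  bmeas (g : borel A -> R) ->
  conv f g x ^+ 2 <= 'E (fun y => f y ^+ 2) * 'E (fun y => g y ^+ 2).
Proof.
move=> bf bg.
have bf2 : bmeas ((fun y => f y ^+ 2) : borel A -> R).
  by under eq_fun do rewrite expr2; exact: bmeasM.
rewrite -(expect_reflect x bf2).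
by apply: cauchy_schwarz; apply: bmeas_sqint => //; exact: bmeas_reflect.
Qed.

Lemma continuous_conv (f g : A -> R) : continuous f -> bmeas (g : borel A -> R) ->
  continuous (conv f g).
Proof.
move=> cf bg x; have [M gM] := bg.2; have bf := bmeas_continuous cf.
apply/cvgrPdist_le => e e0.
have M1 : 0 < `|M| + 1 by rewrite ltr_wpDl.
have d0 : 0 < e / (`|M| + 1) by exact: divr_gt0.
have : \forall x' \near x, [set: A] `<=` (fun y => `|f (x - y) - f (x' - y)| <= e / (`|M| + 1)).
  have /compact_near_coveringP := @group_compact A; apply => y _.
  have c1 : {for (y, x), continuous (fun z : A * A => f (x - z.1) - f (z.2 - z.1))}.
    apply: cvgB.
      apply: (@continuous_comp _ _ _ (fun z : A * A => x - z.1) f); last exact: cf.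
      apply: (@continuous_comp _ _ _ (fun z : A * A => (x, z.1)) (fun z => z.1 - z.2)).
        by apply: cvg_pair; [exact: cvg_cst|exact: cvg_fst].
      exact: sub_continuous.
    apply: (@continuous_comp _ _ _ (fun z : A * A => z.2 - z.1) f); last exact: cf.
    apply: (@continuous_comp _ _ _ (fun z : A * A => (z.2, z.1)) (fun z => z.1 - z.2)).
      by apply: cvg_pair; [exact: cvg_snd|exact: cvg_fst].
    exact: sub_continuous.
  move/cvgrPdist_le : c1 => /(_ _ d0) /=.
  by apply: filterS => -[y' x'] /=; rewrite subrr sub0r normrN.
apply: filterS => x' fx'.
have b1 := bmeas_conv_integrand x bf bg; have b2 := bmeas_conv_integrand x' bf bg.
rewrite /conv -expectB; [|exact: bmeas_rint|exact: bmeas_rint].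
apply: le_trans (le_norm_expect _) _; first by apply: bmeas_rint; exact: bmeasB.
rewrite -[leRHS](expect_cst mu); apply: le_expect.
- by apply: bmeas_rint; apply: bmeas_norm; exact: bmeasB.
- by apply: bmeas_rint; exact: bmeas_cst.
- move=> y; rewrite -mulrBl normrM -(divfK (lt0r_neq0 M1) e) ler_pM//; first exact: fx'.
  by rewrite (le_trans (gM y))// (le_trans (ler_norm M))// lerDl.
Qed.

End Haar.

Section UniformConvergence.
Context {R : realType}.

Definition ucvg (T : Type) (u : nat -> T -> R) (l : T -> R) : Prop :=
  forall e : R, 0 < e -> \forall n \near \oo, forall x, `|u n x - l x| <= e.

Lemma ucvg_cvg (T : Type) (u : nat -> T -> R) l x : ucvg u l -> u n x @[n --> \oo] --> l x.
Proof.
move=> ul; apply/cvgrPdist_le => e e0.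
by apply: filterS (ul e e0) => n /(_ x); rewrite distrC.
Qed.

Lemma ucvg_cauchy (T : Type) (u : nat -> T -> R) :
  (forall e : R, 0 < e -> exists N, forall n m x, (N <= n)%N -> (N <= m)%N ->
    `|u n x - u m x| <= e) -> exists l, ucvg u l.
Proof.
move=> uC.
have cu x : cvgn (u ^~ x).
  apply/cauchy_cvgP/cauchy_exP => e e0.
  have [N NP] := uC (e / 2) (divr_gt0 e0 (ltr0Sn _ 1)).
  exists (u N x), N => // n /= nN; apply: le_lt_trans (NP N n x (leqnn N) nN) _.
  by rewrite ltr_pdivrMr// ltr_pMr// ltr1n.
exists (fun x => limn (u ^~ x)) => e e0.
have [N NP] := uC e e0; exists N => // n /= nN x.
have h : (fun m => `|u n x - u m x|) @ \oo --> `|u n x - limn (u ^~ x)|.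
  by apply: cvg_norm; apply: cvgB; [exact: cvg_cst|exact: cu].
rewrite -(cvg_lim (@Rhausdorff R) h); apply: limr_le.
  by apply/cvg_ex; exists `|u n x - limn (u ^~ x)|.
by exists N => // m /= mN; exact: NP.
Qed.

Lemma ucvg_continuous (T : topologicalType) (u : nat -> T -> R) l : ucvg u l ->
  (forall n, continuous (u n)) -> continuous l.
Proof.
move=> ul cu x; apply/cvgrPdist_le => e e0.
have e3 : 0 < e / 3 by exact: divr_gt0.
have [N _ NP] := ul _ e3.
have /cvgrPdist_le/(_ _ e3) := cu N x.
apply: filterS => y /= uxy.
have := NP N (leqnn N) x; have := NP N (leqnn N) y; move: uxy.
rewrite !ler_norml => /andP[? ?] /andP[? ?] /andP[? ?]; apply/andP; split; lra.
Qed.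

End UniformConvergence.

Section LogConvex.
Context {R : realType} (c : nat -> R).
Hypotheses (c_gt0 : forall n, 0 < c n)
  (c_log : forall n, c n.+1 ^+ 2 <= c n * c n.+2)
  (c_sub : forall n m, c (n + m).+1 <= c n * c m).

(* [l] is the limit of the increasing ratios [c n.+1 / c n]; the lower bound
   comes from [c n * (c n.+1 / c n) ^+ m.+1 <= c (n + m).+1 <= c n * c m]. *)
Lemma logconvex_rate : exists l : R,
  [/\ 0 < l, forall n, c n.+1 <= l * c n & forall m, l ^+ m.+1 <= c m].
Proof.
pose r n := c n.+1 / c n.
have r0 n : 0 < r n by exact: divr_gt0.
have cS n : c n.+1 = r n * c n by rewrite /r divfK// gt_eqF.
have rS n : r n <= r n.+1.
  rewrite /r ler_pdivrMr// mulrAC ler_pdivlMr//.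
  by rewrite [leRHS]mulrC; exact: c_log.
have rmono n m : r n <= r (n + m)%N.
  by elim: m => [|m ih]; [rewrite addn0|rewrite addnS (le_trans ih)].
have cge n m : r n ^+ m * c n <= c (n + m)%N.
  elim: m => [|m ih]; first by rewrite addn0 mul1r.
  rewrite addnS cS exprS -mulrA; apply: ler_pM => //; first exact: ltW.
  by rewrite mulr_ge0// ?exprn_ge0// ltW.
have rle n m : r n ^+ m.+1 <= c m.
  rewrite -(ler_pM2r (c_gt0 n)) (le_trans (cge n m.+1))// addnS mulrC.
  exact: c_sub.
have ub : ubound (range r) (c 0%N) by move=> _ [n _ <-]; have := rle n 0%N; rewrite expr1.
have rl n : r n <= sup (range r).
  by apply: ub_le_sup; [exists (c 0%N)|exists n].
exists (sup (range r)); split.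
- exact: lt_le_trans (r0 0%N) (rl 0%N).
- by move=> n; rewrite cS ler_pM2r.
- move=> m; pose t := c m `^ (m.+1%:R^-1).
  have t0 : 0 <= t by exact: powR_ge0.
  have tE : t ^+ m.+1 = c m.
    by rewrite -powR_mulrn// -powRrM mulVf ?pnatr_eq0// powRr1// ltW.
  rewrite -tE lerXn2r// ?nnegrE//.
    exact: le_trans (ltW (r0 0%N)) (rl 0%N).
  apply: ge_sup; first by exists (r 0%N); exists 0%N.
  move=> _ [n _ <-].
  by rewrite -(@ler_pXn2r _ m.+1)// ?nnegrE// ?tE//; exact: ltW.
Qed.

End LogConvex.

Section ComplexTopology.
Context {R : realType}.
Implicit Types z w : cplx R.

Lemma normcE z : `|z| = (cmod z)%:C%C.
Proof. by case: z => a b; rewrite /cmod normc_def. Qed.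

Lemma cmodE z : cmod z = Num.sqrt (complex.Re z ^+ 2 + complex.Im z ^+ 2).
Proof. by case: z => a b; rewrite /cmod normc_def. Qed.

Lemma sqr_cmod z : cmod z ^+ 2 = complex.Re z ^+ 2 + complex.Im z ^+ 2.
Proof. by rewrite cmodE sqr_sqrtr// addr_ge0// sqr_ge0. Qed.

Lemma cmod_ge0 z : 0 <= cmod z.
Proof. by rewrite cmodE sqrtr_ge0. Qed.

Lemma le_Re_cmod z : `|complex.Re z| <= cmod z.
Proof.
rewrite -(ler_pXn2r (ltn0Sn 1))// ?nnegrE ?cmod_ge0//.
by rewrite sqr_cmod real_normK ?num_real// lerDl sqr_ge0.
Qed.

Lemma le_Im_cmod z : `|complex.Im z| <= cmod z.
Proof.
rewrite -(ler_pXn2r (ltn0Sn 1))// ?nnegrE ?cmod_ge0//.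
by rewrite sqr_cmod real_normK ?num_real// lerDr sqr_ge0.
Qed.

Lemma cmod_le z : cmod z <= `|complex.Re z| + `|complex.Im z|.
Proof.
rewrite -(ler_pXn2r (ltn0Sn 1))// ?nnegrE ?cmod_ge0 ?addr_ge0//.
rewrite sqr_cmod sqrrD !real_normK ?num_real// addrAC lerDl.
by rewrite mulrn_wge0// mulr_ge0.
Qed.

Lemma continuous_Re : continuous (fun z : cplx R => complex.Re z).
Proof.
move=> z; apply: (iffRL (@cvgrPdist_lt R R _ (nbhs z) (nbhs_filter z) _ _)) => e e0.
have := iffLR (@cvgrPdist_lt _ (cplx R) _ (nbhs z) (nbhs_filter z) id z) (@cvg_id _ _) e%:C%C.
rewrite ltcR => /(_ e0); apply: filterS => w; rewrite normcE ltcR; apply: le_lt_trans.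
rewrite [complex.Re z - complex.Re w](_ : _ = complex.Re (z - w)) ?le_Re_cmod//.
by case: z w => [? ?] [? ?].
Qed.

Lemma continuous_Im : continuous (fun z : cplx R => complex.Im z).
Proof.
move=> z; apply: (iffRL (@cvgrPdist_lt R R _ (nbhs z) (nbhs_filter z) _ _)) => e e0.
have := iffLR (@cvgrPdist_lt _ (cplx R) _ (nbhs z) (nbhs_filter z) id z) (@cvg_id _ _) e%:C%C.
rewrite ltcR => /(_ e0); apply: filterS => w; rewrite normcE ltcR; apply: le_lt_trans.
rewrite [complex.Im z - complex.Im w](_ : _ = complex.Im (z - w)) ?le_Im_cmod//.
by case: z w => [? ?] [? ?].
Qed.

Lemma cvg_Complex (T : Type) (F : set_system T) (FF : Filter F) (f g : T -> R) a b :
  f x @[x --> F] --> a -> g x @[x --> F] --> b ->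
  (Complex (f x) (g x) : cplx R) @[x --> F] --> (Complex a b : cplx R).
Proof.
move=> /cvgrPdist_lt fa /cvgrPdist_lt gb; apply/cvgrPdist_lt => -[e e'].
rewrite ltcE /= => /andP[/eqP -> e0].
have e2 : 0 < e / 2 by exact: divr_gt0.
have := fa _ e2; have := gb _ e2; apply: filterS2 => x gx fx.
rewrite normcE ltcR; apply: le_lt_trans (cmod_le _) _ => /=.
by rewrite [ltRHS]splitr ltrD.
Qed.

Lemma continuous_Complex (T : topologicalType) (f g : T -> R) :
  continuous f -> continuous g -> continuous (fun x => Complex (f x) (g x) : cplx R).
Proof. by move=> cf cg x; apply: cvg_Complex; [exact: cf|exact: cg]. Qed.

End ComplexTopology.

Section DAlembert.
Variables (R : realType) (A : compactAbelianGroupType) (c : A -> R).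
Hypotheses (cc : continuous c) (c0 : c 0 = 1)
  (cD : forall x y, c (x + y) + c (x - y) = 2 * (c x * c y))
  (c1 : forall x, c x ^+ 2 <= 1).

Lemma dalembert_char : exists chi : dual R A, forall x, complex.Re (chi x) = c x.
Proof.
have cev x : c (- x) = c x by have := cD 0 x; rewrite c0 add0r sub0r; lra.
have mk (s : A -> R) : continuous s ->
    (forall x y, s x * s y = c x * c y - c (x + y)) ->
    (forall x y, s (x + y) = s x * c y + c x * s y) ->
    exists chi : dual R A, forall x, complex.Re (chi x) = c x.
  move=> cs ss sD.
  have e2 x : c x ^+ 2 + s x ^+ 2 = 1.
    have := ss x x; have := cD x x; rewrite subrr c0; have := cD x x.
    rewrite subrr c0 !expr2; lra.
  unshelve eexists (@Dual R A (fun x => Complex (c x) (s x)) _ _ _) => //.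
  - exact: continuous_Complex.
  - move=> x y; apply/eqP; rewrite eq_complex /=; apply/andP; split; apply/eqP.
      by rewrite ss; lra.
    by rewrite sD addrC.
  - by move=> x; rewrite normcE cmodE /= e2 sqrtr1.
have [triv|/existsNP[a ca]] := pselect (forall x, c x ^+ 2 = 1).
  have cM x y : c (x + y) = c x * c y.
    have := cD x y; have := triv x; have := triv y; have := triv (x + y); have := triv (x - y).
    rewrite !expr2 => t1 t2 t3 t4 t5.
    have h1 : (c (x + y) - c (x - y)) * (c (x + y) - c (x - y)) = 0.
      have : (2 * (c x * c y)) ^+ 2 = 4 * (c x * c x * (c y * c y)) by ring.
      rewrite -t5 t3 t4 => h; have : (c (x + y) - c (x - y)) * (c (x + y) - c (x - y)) =
        2 * (c (x + y) * c (x + y)) + 2 * (c (x - y) * c (x - y)) - (c (x + y) + c (x - y)) ^+ 2 by ring.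
      by rewrite h t1 t2 => ->; ring.
    by move/eqP: h1; rewrite mulf_eq0 orbb => /eqP; lra.
  apply: (mk (fun=> 0)); first by move=> x; exact: cvg_cst.
  - by move=> x y; rewrite cM mulr0 subrr.
  - by move=> x y; rewrite mul0r mulr0 addr0.
pose g := Num.sqrt (1 - c a ^+ 2).
have g2 : g ^+ 2 = 1 - c a ^+ 2 by rewrite sqr_sqrtr// subr_ge0.
have gn0 : g != 0.
  by apply/eqP => g0; apply: ca; move: g2; rewrite g0 expr0n /=; lra.
have c2a : c (a + a) = 2 * c a ^+ 2 - 1.
  by have := cD a a; rewrite subrr c0 expr2; lra.
apply: (mk (fun x => (c (x - a) - c (x + a)) / (2 * g))).
- have csh b : continuous (fun x => c (x + b)).
    by move=> x; apply: (@continuous_comp _ _ _ (fun x => x + b) c); [exact: continuous_shift|exact: cc].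
  by move=> x; apply: cvgMl; apply: cvgB; exact: csh.
- move=> x y.
  have E1 := cD (x - a) (y - a); have E2 := cD (x - a) (y + a).
  have E3 := cD (x + a) (y - a); have E4 := cD (x + a) (y + a).
  have E5 := cD (x + y) (a + a); have E6 := cD (x - y) (a + a); have E7 := cD x y.
  have h1 : x - a + (y - a) = x + y - (a + a) by rewrite opprD !addrA; congr (_ - _); rewrite addrAC.
  have h2 : x - a - (y - a) = x - y by rewrite opprB addrA subrK.
  have h3 : x - a + (y + a) = x + y by rewrite addrCA subrK addrC.
  have h4 : x - a - (y + a) = x - y - (a + a) by rewrite !opprD !addrA; congr (_ - _); rewrite addrAC.
  have h5 : x + a + (y - a) = x + y by rewrite addrA addrAC addrK.
  have h6 : x + a - (y - a) = x - y + (a + a) by rewrite opprB addrA addrAC -addrA addrAC !addrA addrAC.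
  have h7 : x + a + (y + a) = x + y + (a + a) by rewrite addrACA.
  have h8 : x + a - (y + a) = x - y by rewrite opprD addrACA subrr addr0.
  rewrite h1 h2 in E1; rewrite h3 h4 in E2; rewrite h5 h6 in E3; rewrite h7 h8 in E4.
  rewrite c2a in E5 E6.
  apply: (mulfI (_ : 8 * g ^+ 2 != 0)); first by rewrite mulf_neq0 ?pnatr_eq0// expf_neq0.
  have -> : 8 * g ^+ 2 * ((c (x - a) - c (x + a)) / (2 * g) * ((c (y - a) - c (y + a)) / (2 * g))) =
    2 * ((c (x - a) - c (x + a)) * (c (y - a) - c (y + a))) by field.
  rewrite g2; nra.
- move=> x y.
  have E1 := cD (x - a) y; have E2 := cD (x + a) y.
  have E3 := cD x (y - a); have E4 := cD x (y + a).
  have h1 : x - a + y = x + y - a by rewrite addrAC.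
  have h2 : x + a + y = x + y + a by rewrite addrAC.
  have h3 : x + (y - a) = x + y - a by rewrite addrA.
  have h4 : x - (y - a) = x + a - y by rewrite opprB addrA.
  have h5 : x + (y + a) = x + y + a by rewrite addrA.
  have h6 : x - (y + a) = x - a - y by rewrite opprD addrA addrAC.
  rewrite h1 in E1; rewrite h2 in E2; rewrite h3 h4 in E3; rewrite h5 h6 in E4.
  apply: (mulfI (_ : 2 * (2 * g) != 0)); first by rewrite !mulf_neq0 ?pnatr_eq0.
  have -> : 2 * (2 * g) * ((c (x - a) - c (x + a)) / (2 * g) * c y + c x * ((c (y - a) - c (y + a)) / (2 * g))) =
     2 * ((c (x - a) - c (x + a)) * c y + c x * (c (y - a) - c (y + a))) by field.
  have -> : 2 * (2 * g) * ((c (x + y - a) - c (x + y + a)) / (2 * g)) = 2 * (c (x + y - a) - c (x + y + a)) by field.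
  nra.
Qed.

End DAlembert.

(** * Existence of characters *)

Opaque expect conv.

Section PeterWeyl.
Variables (R : realType) (A : compactAbelianGroupType).
Variables (mu : probability (borel A) R) (mu_haar : is_haar mu).
Implicit Types f g k P Q S : A -> R.

Local Notation "''E' f" := (expect mu f) (at level 10, f at level 8).
Local Notation cv := (conv mu).
Local Notation bm f := (bmeas (f : borel A -> R)).

Definition ceven f := continuous f /\ forall x, f (- x) = f x.

Lemma ceven_bmeas f : ceven f -> bm f.
Proof. by case=> cf _; exact: bmeas_continuous. Qed.

Lemma ceven_conv f g : ceven f -> ceven g -> ceven (cv f g).
Proof.
move=> cf cg; have bf := ceven_bmeas cf; have bg := ceven_bmeas cg; split.
  exact: continuous_conv cf.1 bg.
exact: conv_even bf bg cf.2 cg.2.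
Qed.

Lemma ceven_lin a b f g : ceven f -> ceven g -> ceven (fun x => a * f x + b * g x).
Proof.
move=> [cf ef] [cg eg]; split; last by move=> x; rewrite ef eg.
by move=> x; apply: cvgD; apply: cvgMr; [exact: cf|exact: cg].
Qed.

Lemma conv_lin a b f g h x : bm f -> bm g -> bm h ->
  cv (fun y => a * f y + b * g y) h x = a * cv f h x + b * cv g h x.
Proof.
by move=> bf bg bh; rewrite convDl ?convZl//; exact: bmeasZ.
Qed.

Lemma conv_cvg (h : A -> R) (u : nat -> A -> R) l x : bm h -> bm l ->
  (forall n, bm (u n)) -> ucvg u l -> cv h (u n) x @[n --> \oo] --> cv h l x.
Proof.
move=> bh bl bu ul; have [M hM] := bh.2; apply/cvgrPdist_le => e e0.
have M1 : 0 < `|M| + 1 by rewrite ltr_wpDl.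
have := ul _ (divr_gt0 e0 M1); apply: filterS => n une.
have b1 := bmeas_conv_integrand x bh bl; have b2 := bmeas_conv_integrand x bh (bu n).
rewrite !convE -expectB; [|exact: bmeas_rint|exact: bmeas_rint].
apply: le_trans (le_norm_expect _) _; first by apply: bmeas_rint; exact: bmeasB.
rewrite -[leRHS](expect_cst mu); apply: le_expect.
- by apply: bmeas_rint; apply: bmeas_norm; exact: bmeasB.
- by apply: bmeas_rint; exact: bmeas_cst.
- move=> y; rewrite -mulrBr normrM -(divfK (lt0r_neq0 M1) e) mulrC ler_pM//.
    by rewrite distrC une.
  by rewrite (le_trans (hM _))// (le_trans (ler_norm M))// lerDl.
Qed.

Lemma sqnorm_gt0 f : continuous f -> f 0 != 0 -> 0 < 'E (fun x => f x ^+ 2).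
Proof.
move=> cf f0.
have bf2 : bm (fun x => f x ^+ 2).
  by under eq_fun do rewrite expr2; apply: bmeasM; exact: bmeas_continuous.
have d0 : 0 < f 0 ^+ 2 / 2 by rewrite divr_gt0// lt_neqAle sqr_ge0 eq_sym sqrf_eq0 f0.
pose V a := [set x : A | f 0 ^+ 2 / 2 < f (x - a) ^+ 2].
have oV a : open (V a).
  have c1 : continuous (fun x => f (x - a)).
    move=> x; apply: (@continuous_comp _ _ _ (fun x => x - a) f); last exact: cf.
    exact: continuous_shift.
  have cV : continuous (fun x => f (x - a) ^+ 2).
    by move=> x; apply: (@continuousM _ _ (fun x => f (x - a)) (fun x => f (x - a))); exact: c1.
  by move/continuousP : cV => /(_ _ (@open_gt _ (f 0 ^+ 2 / 2))).
have := @group_compact A; rewrite compact_cover => /(_ _ setT V (fun a _ => oV a)).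
case=> [x _|D _ DV].
  by exists x => //; rewrite /V /= subrr ltr_pdivrMr// ltr_pMr ?ltr1n// lt_neqAle sqr_ge0 eq_sym sqrf_eq0 f0.
have bsum : bm (fun x => \sum_(a <- finmap.enum_fset D) f (x - a) ^+ 2).
  by apply: bmeas_sum => a _; exact: (bmeas_shift (- a) bf2).
have : f 0 ^+ 2 / 2 <= 'E (fun x => \sum_(a <- finmap.enum_fset D) f (x - a) ^+ 2).
  rewrite -[leLHS](expect_cst mu); apply: le_expect.
  - by apply: bmeas_rint; exact: bmeas_cst.
  - exact: bmeas_rint.
  - move=> x; have [a /= aD Vx] := DV x Logic.I.
    rewrite (big_rem a aD)/= (le_trans (ltW Vx))// lerDl sumr_ge0// => b _.
    exact: sqr_ge0.
rewrite expect_sum; last by move=> a _; apply: bmeas_rint; exact: (bmeas_shift (- a) bf2).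
under eq_bigr do rewrite (expect_shift mu_haar _ bf2).
rewrite big_const_seq iter_addr_0 => h.
rewrite lt_neqAle expect_ge0 ?andbT; last by move=> x; exact: sqr_ge0.
by apply/eqP => E0; move: h; rewrite -E0 mul0rn; lra.
Qed.

Fixpoint conv_pow k n : A -> R := if n is m.+1 then cv k (conv_pow k m) else k.

Lemma ceven_pow k n : ceven k -> ceven (conv_pow k n).
Proof. by move=> ck; elim: n => //= n ih; exact: ceven_conv. Qed.

Lemma conv_powD k n m : ceven k ->
  cv (conv_pow k n) (conv_pow k m) = conv_pow k (n + m).+1.
Proof.
move=> ck; have bk := ceven_bmeas ck.
have bp j : bm (conv_pow k j) by exact/ceven_bmeas/ceven_pow.
elim: n => [//|n ih]; apply/funext => x /=.
by rewrite (convA mu_haar x bk (bp n) (bp m)) ih.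
Qed.

Lemma conv_eq0 f g : bm f -> bm g ->
  'E (fun y => g y ^+ 2) = 0 -> forall x, cv f g x = 0.
Proof.
move=> bf bg g0 x; have := conv_le mu_haar x bf bg; rewrite g0 mulr0 => h.
by apply/eqP; rewrite -sqrf_eq0 eq_le h sqr_ge0.
Qed.

(* Power iteration: [cv k k] divided by its spectral radius [l] converges,
   along its convolution powers, to the spectral projection [P] of the top
   eigenvalue. *)
Lemma top_projection k : ceven k -> 0 < 'E (fun x => k x ^+ 2) ->
  exists (l : R) P, [/\ 0 < l, ceven P, cv P P = P, 1 <= P 0 &
    cv (cv k k) P = (fun x => l * P x) /\
    forall S, ceven S -> cv S k = k -> cv S P = P].
Proof.
move=> ck k0; have bk := ceven_bmeas ck.
pose p := conv_pow k; have cp n : ceven (p n) by exact: ceven_pow.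
have bp n : bm (p n) by exact: ceven_bmeas.
pose c n := 'E (fun x => p n x ^+ 2).
have cE n : c n = p (n + n).+1 0.
  rewrite /p -conv_powD// conv0; last exact: (cp n).2.
  by apply: eq_expect => x; rewrite expr2.
have pE n m : 'E (fun x => p n x * p m x) = p (n + m).+1 0.
  by rewrite /p -conv_powD// conv0//; exact: (cp n).2.
have c_log n : c n.+1 ^+ 2 <= c n * c n.+2.
  rewrite {1}cE (_ : (n.+1 + n.+1).+1 = (n + n.+2).+1); last by rewrite !addnS !addSn.
  by rewrite -pE; apply: cauchy_schwarz; exact: bmeas_sqint.
have c_ge0 n : 0 <= c n by apply: expect_ge0 => x; exact: sqr_ge0.
have c_gt0 n : 0 < c n.
  elim: n => // n ih.
  case: n => [|n] in ih *.
    by apply: sqnorm_gt0; [exact: (cp 1%N).1|rewrite -(cE 0%N) gt_eqF].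
  rewrite lt_neqAle c_ge0 andbT eq_sym; apply/eqP => c0.
  by have := c_log n; rewrite c0 mulr0 leNgt exprn_gt0.
have c_sub n m : c (n + m).+1 <= c n * c m.
  rewrite -[leRHS](expect_cst mu); apply: le_expect.
  - by have [] := bmeas_sqint mu (bp (n + m).+1).
  - by apply: bmeas_rint; exact: bmeas_cst.
  - by move=> x; rewrite /p -conv_powD//; exact: conv_le.
have [l [l0 lS lc]] := logconvex_rate c_gt0 c_log c_sub.
have ln0 n : l ^+ n != 0 by rewrite expf_neq0// gt_eqF.
pose a n := c n / l ^+ n.+1.
have a1 n : 1 <= a n by rewrite /a ler_pdivlMr ?exprn_gt0// mul1r.
have aS n : a n.+1 <= a n.
  rewrite /a [l ^+ n.+2]exprS invfM mulrA ler_pM2r ?invr_gt0 ?exprn_gt0//.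
  by rewrite ler_pdivrMr// mulrC.
have amono n m : (n <= m)%N -> a m <= a n.
  move=> /subnKC <-; elim: (m - n)%N => [|j ih]; first by rewrite addn0.
  by rewrite addnS (le_trans (aS _)).
pose u n x := (l ^+ n.+1)^-1 * p (n + n).+1 x.
have cu n : ceven (u n).
  have := ceven_lin (l ^+ n.+1)^-1 0 (cp (n + n).+1) (cp 0%N).
  by under eq_fun do rewrite mul0r addr0.
have bu n : bm (u n) by exact: ceven_bmeas.
have uE n m : cv (u n) (u m) = u (n + m).+1.
  apply/funext => x; rewrite {1}/u (convZl mu _ x (bp _) (bu m)).
  rewrite (convC mu_haar x (bp _) (bu m)) (convZl mu _ x (bp _) (bp _)).
  rewrite mulrA -invfM -exprD {1 2}/p (conv_powD _ _ ck) /u /p.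
  have -> : ((m + m).+1 + (n + n).+1 = (n + m).+1 + (n + m).+1)%N by lia.
  by rewrite addnS addSn.
have aE n : u n 0 = a n by rewrite /u /a cE mulrC.
have uu n m : 'E (fun x => (u n x - u m x) ^+ 2) =
    a (n + n).+1 - 2 * a (n + m).+1 + a (m + m).+1.
  have r i j : rint mu (fun x => u i x * u j x) by apply: bmeas_rint; exact: bmeasM.
  have e i j : 'E (fun x => u i x * u j x) = a (i + j).+1.
    by rewrite -aE -uE conv0//; exact: (cu i).2.
  rewrite -!e -expectZ// -expectB//; last exact: rintZ.
  rewrite -expectD//; last by apply: rintB => //; exact: rintZ.
  by apply: eq_expect => x; ring.
have KE n x : cv (p 1%N) (u n) x = l * u n.+1 x.
  rewrite convC// convZl// convC// /p conv_powD// /u -/p.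
  rewrite add1n addSn addnS [in RHS]exprS invfM !mulrA mulfV ?gt_eqF// mul1r.
  by [].
set K2 := 'E (fun x => p 1%N x ^+ 2).
have K20 : 0 <= K2 by apply: expect_ge0 => x; exact: sqr_ge0.
have uS n m x : (l * (u n.+1 x - u m.+1 x)) ^+ 2 <=
    K2 * (a (n + n).+1 - 2 * a (n + m).+1 + a (m + m).+1).
  rewrite -uu mulrBr -(KE n x) -(KE m x) -mulN1r.
  have -> : cv (p 1%N) (u n) x + -1 * cv (p 1%N) (u m) x =
            cv (p 1%N) (fun y => u n y - u m y) x.
    rewrite !(convC mu_haar x (bp 1%N))//; last exact: bmeasB.
    have := conv_lin 1 (-1) x (bu n) (bu m) (bp 1%N); rewrite mul1r => <-.
    have -> // : (fun y => 1 * u n y + -1 * u m y) = (fun y => u n y - u m y).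
    by apply/funext => y; rewrite mul1r mulN1r.
  by apply: conv_le => //; exact: bmeasB.
have [P uP] : exists P, ucvg u P.
  apply: ucvg_cauchy => e e0.
  pose d := (l * e) ^+ 2 / (2 * (K2 + 1)).
  have K21 : 0 < 2 * (K2 + 1) by rewrite mulr_gt0// ltr_wpDl.
  have d0 : 0 < d by rewrite divr_gt0// exprn_gt0// mulr_gt0.
  have hi : has_inf (range a).
    by split; [exists (a 0%N), 0%N|exists 1 => _ [n _ <-]].
  have [_ [N _ <-] aN] := inf_adherent d0 hi.
  have ai n : inf (range a) <= a n.
    by apply: ge_inf; [exact: hi.2|exists n].
  exists N.+1 => -[//|n] [//|m] x; rewrite !ltnS => Nn Nm.
  rewrite -(@ler_pM2l _ l)// -[X in X * _]gtr0_norm// -normrM.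
  rewrite -(@ler_pXn2r _ 2)// ?nnegrE ?mulr_ge0// ?(ltW l0) ?(ltW e0)//.
  rewrite real_normK ?num_real// (le_trans (uS n m x))//.
  have -> : (l * e) ^+ 2 = (2 * (K2 + 1)) * d by rewrite /d [RHS]mulrC divfK// gt_eqF.
  have h1 := ai (n + m).+1.
  have h2 : a (n + n).+1 <= a N by apply: amono; rewrite -addnS (leq_trans Nn)// leq_addr.
  have h3 : a (m + m).+1 <= a N by apply: amono; rewrite -addnS (leq_trans Nm)// leq_addr.
  set w := _ - _ + _.
  have w2 : w <= 2 * d by rewrite /w; lra.
  have : K2 * w <= K2 * (2 * d) by rewrite ler_wpM2l.
  nra.
have cP : ceven P.
  split; first by apply: (ucvg_continuous uP) => n; exact: (cu n).1.
  move=> x; have := ucvg_cvg (x := - x) uP.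
  under eq_fun do rewrite (cu _).2.
  by move=> /(cvg_unique (@Rhausdorff R))/(_ (ucvg_cvg uP)).
have bP := ceven_bmeas cP.
have uPs j x : u (n + j)%N x @[n --> \oo] --> P x.
  by have := ucvg_cvg (x := x) uP; rewrite -(cvg_shiftn j).
have PI S v y x : bm S -> (forall n, cv S (u n) x = v n) ->
    v n @[n --> \oo] --> y -> cv S P x = y.
  move=> bS Sv; apply: (cvg_unique (@Rhausdorff R)).
  by have := conv_cvg (x := x) bS bP bu uP; under eq_fun do rewrite Sv.
exists l, P; split => //.
- have uPP n : cv (u n) P = P.
    apply/funext => x; apply: (PI (u n) _ _ _ (bu n) _ (uPs n.+1 x)) => m.
    by rewrite uE addnS addnC.
  apply/funext => x; apply: (PI P (fun=> P x)) => //; last exact: cvg_cst.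
  by move=> n; rewrite convC// uPP.
- have h : a n @[n --> \oo] --> P 0.
    by have := ucvg_cvg (x := 0) uP; under eq_fun do rewrite aE.
  rewrite -(cvg_lim (@Rhausdorff R) h); apply: limr_ge; first by apply/cvg_ex; exists (P 0).
  exact: nearW.
- split.
    apply/funext => x; apply: (PI (p 1%N) (fun n => l * u n.+1 x)) => //.
    by apply: cvgMr; have := uPs 1%N x; under eq_fun do rewrite addn1.
  move=> S cS Sk; have bS := ceven_bmeas cS.
  have Sp n : cv S (p n) = p n.
    case: n => [//|n]; apply/funext => x /=.
    by rewrite -convA// Sk.
  apply/funext => x; apply: (PI S (fun n => u n x)) => //; last exact: ucvg_cvg.
  by move=> n; rewrite convC// convZl// convC// Sp.
Qed.

Lemma idempotent_ge1 Q : ceven Q -> cv Q Q = Q -> Q 0 < 1 -> forall x, Q x = 0.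
Proof.
move=> cQ QQ Q1 x; have bQ := ceven_bmeas cQ.
have Q0 : Q 0 = 'E (fun x => Q x ^+ 2).
  rewrite -{1}QQ conv0; last exact: cQ.2.
  by apply: eq_expect => y; rewrite expr2.
have q0 : 0 <= Q 0 by rewrite Q0; apply: expect_ge0 => y; exact: sqr_ge0.
have le y : Q y ^+ 2 <= Q 0 ^+ 2 by rewrite -{1}QQ [in leRHS]expr2 {1 2}Q0; exact: conv_le.
have : Q 0 <= Q 0 ^+ 2.
  rewrite {1}Q0 -[leRHS](expect_cst mu); apply: le_expect => //.
  - by have [] := bmeas_sqint mu bQ.
  - by apply: bmeas_rint; exact: bmeas_cst.
move=> qq; have {qq Q1}Q00 : Q 0 = 0 by nra.
by apply/eqP; rewrite -sqrf_eq0 eq_le sqr_ge0 andbT (le_trans (le x))// Q00 expr0n.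
Qed.

Lemma conv_shiftr f g a x : bm f -> bm g ->
  cv f (fun y => g (y + a)) x = cv f g (x + a).
Proof.
move=> bf bg; rewrite -[RHS](expect_shift mu_haar a); last exact: bmeas_conv_integrand.
by apply: eq_expect => y; rewrite opprD addrACA subrr addr0.
Qed.

(* Descent on [P 0], the dimension of the range of [P]: if every even element [w]
   of the algebra [P * _] has [w * w] proportional to [P], then so do the
   symmetrized translates of [P], and [P / P 0] solves d'Alembert's equation;
   otherwise [top_projection] yields a proper idempotent of this algebra. *)
Lemma idempotent_dalembert n P : ceven P -> cv P P = P -> 1 <= P 0 -> P 0 < n%:R ->
  exists c : A -> R, [/\ continuous c, c 0 = 1,
    forall x y, c (x + y) + c (x - y) = 2 * (c x * c y),
    forall x, c x ^+ 2 <= 1 & cv P c = c].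
Proof.
elim: n P => [|n ih] P cP PP P1 Pn; first by have := le_lt_trans P1 Pn; rewrite ltr10.
have bP := ceven_bmeas cP.
have [[Q [cQ QQ Q1 PQ QP]]|noQ] := pselect (exists Q, [/\ ceven Q, cv Q Q = Q,
    1 <= Q 0, cv P Q = Q & Q <> P]).
  have bQ := ceven_bmeas cQ.
  have cD := ceven_lin 1 (-1) cP cQ; set D := fun x => _ in cD.
  have bD := ceven_bmeas cD.
  have QPE : cv Q P = Q by apply/funext => x; rewrite convC// PQ.
  have DD : cv D D = D.
    apply/funext => x; rewrite {1}/D conv_lin// !(convC mu_haar x _ bD)// /D !conv_lin//.
    by rewrite PP QPE PQ QQ; lra.
  have Q0 : Q 0 < n%:R.
    rewrite ltNge; apply/negP => nQ; apply: QP; apply/funext => x.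
    suff : D x = 0 by rewrite /D; lra.
    by apply: idempotent_ge1 => //; rewrite /D; move: Pn; rewrite -addn1 natrD; lra.
  have [c [cc c0 cD' c1 Qc]] := ih Q cQ QQ Q1 Q0.
  exists c; split => //; apply/funext => x.
  rewrite -Qc -convA//; first by rewrite PQ.
  exact: bmeas_continuous.
have sq w : ceven w -> cv P w = w -> exists l, cv w w = fun x => l * P x.
  move=> cw Pw; have bw := ceven_bmeas cw.
  have [w0|] := eqVneq ('E (fun x => w x ^+ 2)) 0.
    by exists 0; apply/funext => x; rewrite mul0r conv_eq0.
  rewrite neq_lt ltNge expect_ge0/=; last by move=> x; exact: sqr_ge0.
  move=> w0; have [l [Q [l0 cQ QQ Q1 [wQ PQ]]]] := top_projection cw w0.
  have {}PQ := PQ P cP Pw.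
  have QP : Q = P by apply: contrapT => QP; apply: noQ; exists Q.
  exists l; rewrite QP in wQ; rewrite -wQ; apply/funext => x.
  have wP : cv w P = w by apply/funext => y; rewrite convC// Pw.
  by rewrite convA// wP.
pose s a x := (P (x + a) + P (x - a)) / 2.
have cs a : ceven (s a).
  have csh b : continuous (fun x => P (x + b)).
    move=> x; apply: (@continuous_comp _ _ _ (fun x => x + b) P); last exact: cP.1.
    exact: continuous_shift.
  split; first by move=> x; apply: cvgMl; apply: cvgD; exact: csh.
  move=> x; rewrite /s (_ : - x + a = - (x - a)); last by rewrite opprB addrC.
  by rewrite -opprD !cP.2 addrC.
have bs a : bm (s a) by exact/ceven_bmeas.
have Ps a : cv P (s a) = s a.
  have bsh b := bmeas_shift b bP.
  have sE : s a = fun x => 2^-1 * P (x + a) + 2^-1 * P (x - a).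
    by apply/funext => x; rewrite /s; lra.
  apply/funext => x; rewrite convC// [in LHS]sE conv_lin//.
  by rewrite !(convC mu_haar x _ bP)// !conv_shiftr// PP sE.
have sP a x : s a x * P 0 = P a * P x.
  have [l1 ss] := sq _ (cs a) (Ps a).
  have cw := ceven_lin 1 1 (cs a) cP; set w := fun x => _ in cw.
  have bw := ceven_bmeas cw.
  have sPE : cv (s a) P = s a by apply/funext => y; rewrite convC// Ps.
  have Pw : cv P w = w.
    by apply/funext => y; rewrite convC// /w conv_lin// sPE PP.
  have [l2 ww] := sq _ cw Pw.
  have h y : 2 * s a y = (l2 - l1 - 1) * P y.
    have := congr1 (fun F => F y) ww; rewrite {1}/w conv_lin// Pw (convC mu_haar _ _ bw)//.
    by rewrite {1}/w conv_lin// ss Ps /w /=; lra.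
  have := h x; have := h 0.
  have -> : s a 0 = P a by rewrite /s add0r sub0r cP.2; lra.
  move=> h1 h2; apply: (mulfI (_ : 2 != 0)); first by rewrite pnatr_eq0.
  rewrite [LHS](_ : _ = (2 * s a x) * P 0); last by rewrite mulrA.
  by rewrite h2 mulrAC -h1 mulrA.
have P00 : P 0 != 0 by rewrite gt_eqF// (lt_le_trans _ P1).
exists (fun x => P x / P 0); split.
- by move=> x; apply: cvgMl; exact: cP.1.
- by rewrite divff.
- move=> x y; have := sP y x; rewrite /s => h.
  have -> : P (x + y) / P 0 + P (x - y) / P 0 = 2 * ((P (x + y) + P (x - y)) / 2 * P 0) / P 0 ^+ 2.
    by field.
  by rewrite h; field.
- move=> x; have P0E : P 0 = 'E (fun x => P x ^+ 2).
    by rewrite -{1}PP conv0; [apply: eq_expect => y; rewrite expr2|exact: cP.2].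
  rewrite expr_div_n ler_pdivrMr ?mul1r; last by rewrite exprn_gt0// (lt_le_trans _ P1).
  by rewrite -{1}PP [in leRHS]expr2 {1 2}P0E; exact: conv_le.
- apply/funext => x; rewrite convC//; last by under eq_fun do rewrite mulrC; exact: bmeasZ.
  have -> : (fun x => P x / P 0) = (fun x => (P 0)^-1 * P x) by apply/funext => y; rewrite mulrC.
  by rewrite convZl// PP mulrC.
Qed.

Theorem character_detects k : ceven k -> k 0 != 0 ->
  exists chi : dual R A, 'E (fun x => k x * complex.Re (chi x)) != 0.
Proof.
move=> ck k0; have bk := ceven_bmeas ck.
have [l [P [l0 cP PP P1 [kP _]]]] := top_projection ck (sqnorm_gt0 ck.1 k0).
have bP := ceven_bmeas cP.
have [c [cc c0 cD c1 Pc]] : exists c : A -> R, [/\ continuous c, c 0 = 1,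
    forall x y, c (x + y) + c (x - y) = 2 * (c x * c y),
    forall x, c x ^+ 2 <= 1 & cv P c = c].
  apply: (@idempotent_dalembert (Num.truncn (P 0)).+1) => //.
  exact: truncnS_gt.
have bc := bmeas_continuous cc.
have [chi chiE] := dalembert_char cc c0 cD c1.
exists chi; apply/eqP; under eq_expect do rewrite chiE.
move=> kc0.
have kc x : cv k c x = 0.
  have e : cv k c x = 2^-1 * ('E (fun y => k y * c (x - y)) + 'E (fun y => k y * c (x + y))).
    rewrite convC// convE.
    have -> : 'E (fun y => k y * c (x + y)) = 'E (fun y => c (x - y) * k y).
      rewrite -(expect_opp mu_haar (f := fun y => c (x - y) * k y)).
        by apply: eq_expect => y; rewrite opprK ck.2 mulrC.
      exact: bmeas_conv_integrand.
    under [X in _ = _ * (X + _)]eq_expect do rewrite mulrC.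
    lra.
  have br : bm (fun y => k y * c (x - y)) by apply: bmeasM => //; exact: bmeas_reflect.
  have br' : bm (fun y => k y * c (x + y)).
    apply: bmeasM => //; under eq_fun do rewrite addrC; exact: bmeas_shift.
  rewrite e -expectD; [|exact: bmeas_rint|exact: bmeas_rint].
  have -> : 'E (fun y => k y * c (x - y) + k y * c (x + y)) =
      'E (fun y => (2 * c x) * (k y * c y)).
    by apply: eq_expect => y; rewrite -mulrDr [X in k y * X]addrC cD; ring.
  rewrite expectZ; last by apply: bmeas_rint; exact: bmeasM.
  by rewrite kc0; ring.
have : cv (cv k k) c 0 = l * c 0.
  rewrite -{1}Pc -convA//; last exact: bmeas_conv.
  by rewrite kP convZl// Pc.
rewrite convA// c0 mulr1; have -> : cv k c = fun=> 0 by apply/funext.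
move=> h; move: l0; rewrite -h.
rewrite (_ : cv k (fun=> 0) 0 = 0) ?ltxx//.
rewrite convE; under eq_expect do rewrite mulr0.
exact: expect_cst.
Qed.

End PeterWeyl.

Section TranslationContinuity.
Variables (R : realType) (A : compactAbelianGroupType).
Variables (mu : probability (borel A) R) (mu_haar : is_haar mu).

Local Notation "''E' f" := (expect mu f) (at level 10, f at level 8).
Local Notation bm f := (bmeas (f : borel A -> R)).
Local Notation ind E := (\1_(E : set (borel A)) : A -> R).

Lemma bm_ind (E : set (borel A)) : measurable E -> bm (ind E).
Proof. exact: bmeas_indic. Qed.

Lemma bm_osc (E : set (borel A)) a : measurable E ->
  bm (fun y => `|ind E (y + a) - ind E y|).
Proof.
move=> mE; apply: bmeas_norm; apply: bmeasB; last exact: bm_ind.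
by apply: (bmeas_shift a); exact: bm_ind.
Qed.

Definition osc (E : set (borel A)) (a : A) := 'E (fun y => `|ind E (y + a) - ind E y|).

Lemma nbhs_basis0 : exists W : nat -> set A, [/\ forall n, open (W n),
  forall n, W n 0, forall n m, (n <= m)%N -> W m `<=` W n &
  forall U, nbhs (0 : A) U -> exists n, W n `<=` U].
Proof.
have [V [oV bV]] := countable_basis A.
pose V' n := if `[< V n 0 >] then V n else setT.
have oV' n : open (V' n) by rewrite /V'; case: ifPn => // _; exact: openT.
have V'0 n : V' n 0 by rewrite /V'; case: asboolP.
exists (fun n => \bigcap_(i < n.+1) V' i); split.
- by move=> n; rewrite bigcap_mkord; elim/big_ind: _ => //; [exact: openT|exact: openI].
- by move=> n i _; exact: V'0.
- by move=> n m nm x Wx i /= lin; apply: Wx => /=; exact: leq_trans lin _.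
- move=> U /bV[n [Vn0 VU]]; exists n => x /(_ n); rewrite /V' asboolT// => h.
  by apply: VU; apply: h => /=.
Qed.

Lemma osc_open (U : set A) (e : R) : open U -> 0 < e ->
  \forall a \near (0 : A), osc U a <= e.
Proof.
move=> oU e0; have [W [oW W0 Wm Wb]] := nbhs_basis0.
pose bad n : set (borel A) := U `&` [set y | exists2 a : A, W n a & ~ U (y + a)].
have mU : measurable (U : set (borel A)) by exact: borel_open.
have mbad n : measurable (bad n).
  apply: measurableI => //; apply: borel_open.
  rewrite [X in open X](_ : _ = \bigcup_(z in ~` U) ((fun y : A => z - y) @^-1` W n)).
    apply: bigcup_open => z _.
    have : continuous (fun y : A => z - y).
      move=> y; apply: (@continuous_comp _ _ _ (fun y : A => (z, y)) (fun z : A * A => z.1 - z.2)).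
        by apply: cvg_pair; [exact: cvg_cst|exact: cvg_id].
      exact: sub_continuous.
    by move/continuousP; apply; exact: oW.
  apply/seteqP; split => [y [a Wa Uya]|y [z Uz Wzy]].
    by exists (y + a) => //=; rewrite addrC addKr.
  by exists (z - y) => //=; rewrite addrC subrK.
have bad0 : \bigcap_n bad n = set0.
  apply/seteqP; split => // y By; have [Uy _] := By 0%N Logic.I.
  have : nbhs (0 : A) [set a | U (y + a)].
    have : continuous (fun a : A => y + a).
      by under eq_fun do rewrite addrC; exact: continuous_shift.
    move=> /(_ 0); apply; rewrite addr0; exact: open_nbhs_nbhs.
  by move=> /Wb[n WU]; have [_ [a Wa]] := By n Logic.I; apply; exact: WU.
have cvg_bad : mu \o bad @ \oo --> mu (\bigcap_n bad n).
  apply: nonincreasing_cvg_mu => //.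
  - exact: le_lt_trans (probability_le1 mu (mbad 0%N)) (ltry 1).
  - by rewrite bad0.
  - move=> n m nm; apply/subsetPset => y [Uy [a Wa Uya]]; split => //.
    by exists a => //; exact: Wm Wa.
rewrite bad0 measure0 in cvg_bad.
have /fine_cvgP[_ /cvgrPdist_le/(_ _ (divr_gt0 e0 (ltr0Sn _ 1)))[n _ /(_ _ (leqnn n))]] :
  (mu \o bad) @ \oo --> (0%:E : \bar R) by [].
rewrite /= sub0r normrN ger0_norm ?fine_ge0// => badn.
have : nbhs (0 : A) (W n) by exact: open_nbhs_nbhs.
apply: filterS => a Wa; rewrite /osc.
have b1 := bm_ind mU; have b2 := bmeas_shift a b1; have b3 := bm_ind (mbad n).
apply: (@le_trans _ _ ('E (fun y => (ind U (y + a) - ind U y) + 2 * ind (bad n) y))).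
  apply: le_expect; first by apply: bmeas_rint; exact: bm_osc.
    by apply: bmeas_rint; apply: bmeasD; [exact: bmeasB|exact: bmeasZ].
  move=> y; rewrite !indicE.
  have [Uya|Uya] := pselect (U (y + a)); have [Uy|Uy] := pselect (U y).
  - by rewrite (mem_set Uya) (mem_set Uy) subrr normr0 add0r mulr_ge0.
  - by rewrite (mem_set Uya) (memNset Uy) subr0 normr1 lerDl mulr_ge0.
  - rewrite (memNset Uya) (mem_set Uy) (@mem_set _ (bad n)); last by split => //; exists a.
    by rewrite mulr0n mulr1n sub0r normrN normr1; lra.
  - by rewrite (memNset Uya) (memNset Uy) subrr normr0 add0r mulr_ge0.
rewrite expectD; [|by apply: bmeas_rint; exact: bmeasB|by apply: bmeas_rint; exact: bmeasZ].
rewrite expectB; [|exact: bmeas_rint|exact: bmeas_rint].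
rewrite (expect_shift mu_haar a b1) subrr add0r expectZ; last exact: bmeas_rint.
by rewrite expect_indic//; lra.
Qed.

Lemma osc_small (E : set (borel A)) (e : R) : measurable E -> 0 < e ->
  \forall a \near (0 : A), osc E a <= e.
Proof.
move=> mE.
pose G := [set E : set (borel A) | measurable E /\
  forall e : R, 0 < e -> \forall a \near (0 : A), osc E a <= e].
suff: (<<s @open A >> : set (set (borel A))) `<=` G by move=> /(_ _ mE)[_]; exact.
apply: smallest_sub; last first.
  by move=> U oU; split; [exact: borel_open|move=> d; exact: osc_open].
split.
- split => // d d0; apply: nearW => a; rewrite /osc.
  under eq_expect do rewrite !indic0 subrr normr0.
  by rewrite expect_cst ltW.
- move=> F [mF oF]; rewrite setTD; split; first exact: measurableC.
  move=> d /oF; apply: filterS => a; congr (_ <= _); apply: eq_expect => y.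
  rewrite !indicE !in_setC.
  by case: (_ + _ \in F); case: (_ \in F); rewrite /= ?subrr ?subr0 ?sub0r ?normrN.
have GU (E1 E2 : set (borel A)) : G E1 -> G E2 -> G (E1 `|` E2).
  move=> [m1 o1] [m2 o2]; split; first exact: measurableU.
  move=> d d0; have d2 : 0 < d / 2 by exact: divr_gt0.
  have := o2 _ d2; have := o1 _ d2; apply: filterS2 => a a1 a2.
  apply: (@le_trans _ _ (osc E1 a + osc E2 a)); last by rewrite [leRHS]splitr lerD.
  rewrite /osc -expectD; [|by apply: bmeas_rint; exact: bm_osc..].
  apply: le_expect.
  - by apply: bmeas_rint; apply: bm_osc; exact: measurableU.
  - by apply: bmeas_rint; apply: bmeasD; exact: bm_osc.
  - move=> y; rewrite !indicE !in_setU.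
    by case: (_ + _ \in E1); case: (_ + _ \in E2); case: (y \in E1); case: (y \in E2) => /=;
      rewrite ?subrr ?subr0 ?sub0r ?normrN ?normr0 ?normr1; lra.
suff: forall F : nat -> set (borel A), (forall n, G (F n)) -> G (\bigcup_n F n) by [].
move=> F FG; have mF n := (FG n).1.
have mU : measurable (\bigcup_n F n) by exact: bigcupT_measurable.
split=> // d d0.
pose H n := \big[setU/set0]_(i < n.+1) F i.
have GH n : G (H n).
  rewrite /H; elim/big_ind: _ => //; split => // r r0; apply: nearW => a; rewrite /osc.
  under eq_expect do rewrite !indic0 subrr normr0.
  by rewrite expect_cst ltW.
have HU n : H n `<=` \bigcup_n F n by exact: bigsetU_bigcup.
have : mu \o H @ \oo --> mu (\bigcup_n H n).
  apply: nondecreasing_cvg_mu.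
  - by move=> n; exact: (GH n).1.
  - by rewrite bigcup_bigsetU_bigcup.
  - by move=> n m nm; apply/subsetPset; exact: subset_bigsetU.
rewrite bigcup_bigsetU_bigcup -[mu (\bigcup_n F n)]fineK; last first.
  exact: fin_num_measure.
have d4 : 0 < d / 4 by exact: divr_gt0.
move=> /fine_cvgP[_ /cvgrPdist_le/(_ _ d4)[n _ /(_ _ (leqnn n))]] /= Hn.
have d2 : 0 < d / 2 by exact: divr_gt0.
have [mHn /(_ _ d2)] := GH n; apply: filterS => a Ha.
have bU := bm_ind mU; have bH := bm_ind mHn.
pose g := fun y => ind (\bigcup_n F n) y - ind (H n) y.
have bg : bm g by exact: bmeasB.
have g0 y : 0 <= g y.
  rewrite subr_ge0 !indicE ler_nat; have [Hy|Hy] := pselect (H n y).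
    by rewrite (mem_set Hy) (mem_set (HU n y Hy)).
  by rewrite (memNset Hy).
have Eg : 'E g <= d / 4.
  rewrite /g expectB; [|exact: bmeas_rint..].
  by rewrite !expect_indic//; apply: le_trans Hn; exact: ler_norm.
apply: (@le_trans _ _ ('E (fun y => g (y + a) + g y + `|ind (H n) (y + a) - ind (H n) y|))).
  apply: le_expect; first by apply: bmeas_rint; exact: bm_osc.
    apply: bmeas_rint; apply: bmeasD; last exact: bm_osc.
    by apply: bmeasD => //; exact: bmeas_shift.
  move=> y; rewrite /osc.
  have -> : ind (\bigcup_n F n) (y + a) - ind (\bigcup_n F n) y =
     (g (y + a) - g y) + (ind (H n) (y + a) - ind (H n) y) by rewrite /g; ring.
  apply: le_trans (ler_normD _ _) _; rewrite lerD2r.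
  apply: le_trans (ler_normB _ _) _.
  by rewrite !ger0_norm.
rewrite expectD; last 2 first.
- by apply: bmeas_rint; apply: bmeasD => //; exact: bmeas_shift.
- by apply: bmeas_rint; exact: bm_osc.
rewrite expectD; [|apply: bmeas_rint; exact: bmeas_shift|exact: bmeas_rint].
rewrite (expect_shift mu_haar a bg).
by have := Ha; rewrite /osc; lra.
Qed.

Definition autocorr (E : set (borel A)) (x : A) : R := 'E (fun y => ind E (y + x) * ind E y).

Lemma continuous_autocorr (E : set (borel A)) : measurable E -> continuous (autocorr E).
Proof.
move=> mE x; apply/cvgrPdist_le => e e0.
have bE := bm_ind mE.
have h : (fun x' : A => x' - x) @ x --> (0 : A).
  by rewrite -(subrr x); apply: continuous_shift.
have := h _ (osc_small mE e0); rewrite nbhs_simpl /=; apply: filterS => x' /= ox.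
have bs a : bm (fun y => ind E (y + a) * ind E y).
  by apply: bmeasM => //; exact: bmeas_shift.
rewrite /autocorr -expectB; [|exact: bmeas_rint..].
apply: le_trans (le_norm_expect _) _; first by apply: bmeas_rint; exact: bmeasB.
apply: le_trans ox; rewrite /osc.
have bo := bm_osc (x' - x) mE; rewrite -(expect_shift mu_haar x bo).
apply: le_expect.
- by apply: bmeas_rint; apply: bmeas_norm; exact: bmeasB.
- by apply: bmeas_rint; exact: (bmeas_shift x bo).
- move=> y; rewrite -mulrBl normrM addrA addrAC addrK [X in X <= _]mulrC distrC.
  by rewrite ler_piMl// indicE; case: (_ \in _); rewrite ?normr1 ?normr0.
Qed.

Lemma autocorr_even (E : set (borel A)) x : measurable E ->
  autocorr E (- x) = autocorr E x.
Proof.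
move=> mE; have bE := bm_ind mE.
rewrite /autocorr -[LHS](expect_shift mu_haar x); last first.
  by apply: bmeasM => //; exact: bmeas_shift.
by apply: eq_expect => y; rewrite addrK mulrC.
Qed.

End TranslationContinuity.

(** * Bessel's inequality and Parseval's identity *)

Section ComplexIntegral.
Context d (T : measurableType d) (R : realType) (P : probability T R).
Implicit Types f g : T -> cplx R.
Local Notation re f := (fun x => complex.Re (f x)).
Local Notation im f := (fun x => complex.Im (f x)).

Definition crint f := rint P (re f) /\ rint P (im f).
Definition csqint f := sqint P (re f) /\ sqint P (im f).
Definition cbmeas f := bmeas (re f) /\ bmeas (im f).

Lemma cintE f : cintegral P f = Complex (expect P (re f)) (expect P (im f)).
Proof. by []. Qed.

Lemma ReD (z w : cplx R) : complex.Re (z + w) = complex.Re z + complex.Re w.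
Proof. by case: z w => [? ?] [? ?]. Qed.
Lemma ImD (z w : cplx R) : complex.Im (z + w) = complex.Im z + complex.Im w.
Proof. by case: z w => [? ?] [? ?]. Qed.
Lemma ReN (z : cplx R) : complex.Re (- z) = - complex.Re z.
Proof. by case: z. Qed.
Lemma ImN (z : cplx R) : complex.Im (- z) = - complex.Im z.
Proof. by case: z. Qed.
Lemma ReM (z w : cplx R) : complex.Re (z * w) =
  complex.Re z * complex.Re w - complex.Im z * complex.Im w.
Proof. by case: z w => [? ?] [? ?]. Qed.
Lemma ImM (z w : cplx R) : complex.Im (z * w) =
  complex.Re z * complex.Im w + complex.Im z * complex.Re w.
Proof. by case: z w => [? ?] [? ?]. Qed.
Lemma ReJ (z : cplx R) : complex.Re z^* = complex.Re z.
Proof. by case: z. Qed.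
Lemma ImJ (z : cplx R) : complex.Im z^* = - complex.Im z.
Proof. by case: z. Qed.
Lemma cplx_eq (z w : cplx R) : complex.Re z = complex.Re w ->
  complex.Im z = complex.Im w -> z = w.
Proof. by case: z w => [? ?] [? ?] /= -> ->. Qed.

Definition Cparts := (ReD, ImD, ReN, ImN, ReM, ImM, ReJ, ImJ).

Lemma crintD f g : crint f -> crint g -> crint (fun x => f x + g x).
Proof.
move=> [rf jf] [rg jg]; split.
  by under eq_fun do rewrite ReD; exact: rintD.
by under eq_fun do rewrite ImD; exact: rintD.
Qed.

Lemma crintZ (z : cplx R) f : crint f -> crint (fun x => z * f x).
Proof.
move=> [rf jf]; split.
  by under eq_fun do rewrite ReM; apply: rintB; exact: rintZ.
by under eq_fun do rewrite ImM; apply: rintD; exact: rintZ.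
Qed.

Lemma cintD f g : crint f -> crint g ->
  cintegral P (fun x => f x + g x) = cintegral P f + cintegral P g.
Proof.
move=> [rf jf] [rg jg]; apply: cplx_eq; rewrite ?Cparts !cintE /= -expectD//.
  by apply: eq_expect => x; rewrite ReD.
by apply: eq_expect => x; rewrite ImD.
Qed.

Lemma cintZ (z : cplx R) f : crint f ->
  cintegral P (fun x => z * f x) = z * cintegral P f.
Proof.
move=> [rf jf]; apply: cplx_eq; rewrite ?Cparts !cintE /= -!expectZ//.
  rewrite -expectB; [|exact: rintZ..].
  by apply: eq_expect => x; rewrite ReM.
rewrite -expectD; [|exact: rintZ..].
by apply: eq_expect => x; rewrite ImM.
Qed.

Lemma eq_cint f g : f =1 g -> cintegral P f = cintegral P g.
Proof. by move=> /funext ->. Qed.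

Lemma cint_cst (z : cplx R) : cintegral P (fun=> z) = z.
Proof. by case: z => a b; rewrite cintE !expect_cst. Qed.

Lemma crint_cst (z : cplx R) : crint (fun=> z).
Proof. by split; apply: bmeas_rint; exact: bmeas_cst. Qed.

Lemma crint_sum (I : Type) (r : seq I) (F : I -> T -> cplx R) :
  (forall i, crint (F i)) -> crint (fun x => \sum_(i <- r) F i x).
Proof.
move=> rF; elim: r => [|i r ih].
  by under eq_fun do rewrite big_nil; exact: crint_cst.
by under eq_fun do rewrite big_cons; exact: crintD.
Qed.

Lemma cint_sum (I : Type) (r : seq I) (F : I -> T -> cplx R) :
  (forall i, crint (F i)) ->
  cintegral P (fun x => \sum_(i <- r) F i x) = \sum_(i <- r) cintegral P (F i).
Proof.
move=> rF; elim: r => [|i r ih].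
  by rewrite big_nil; under eq_cint do rewrite big_nil; exact: cint_cst.
rewrite big_cons; under eq_cint do rewrite big_cons.
by rewrite cintD// ?ih//; exact: crint_sum.
Qed.

Lemma cbmeas_csqint f : cbmeas f -> csqint f.
Proof. by case=> bf bf'; split; exact: bmeas_sqint. Qed.

Lemma csqintD f g : csqint f -> csqint g -> csqint (fun x => f x + g x).
Proof.
move=> [rf jf] [rg jg]; split.
  by under eq_fun do rewrite ReD; exact: sqintD.
by under eq_fun do rewrite ImD; exact: sqintD.
Qed.

Lemma csqintZ (z : cplx R) f : csqint f -> csqint (fun x => z * f x).
Proof.
move=> [rf jf]; split.
  by under eq_fun do rewrite ReM; apply: sqintB; exact: sqintZ.
by under eq_fun do rewrite ImM; apply: sqintD; exact: sqintZ.
Qed.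

Lemma csqintB f g : csqint f -> csqint g -> csqint (fun x => f x - g x).
Proof.
move=> sf sg; under eq_fun do rewrite -[- g _]mulN1r.
by apply: csqintD => //; exact: csqintZ.
Qed.

Lemma csqint_crintMJ f g : csqint f -> csqint g -> crint (fun x => f x * (g x)^*).
Proof.
move=> [rf jf] [rg jg]; split.
  under eq_fun do rewrite ReM ReJ ImJ mulrN opprK.
  by apply: rintD; exact: sqint_rintM.
under eq_fun do rewrite ImM ReJ ImJ mulrN addrC.
by apply: rintB; exact: sqint_rintM.
Qed.

Definition sqnorm f : R := expect P (fun x => cmod (f x) ^+ 2).

Lemma rint_sqnorm f : csqint f -> rint P (fun x => cmod (f x) ^+ 2).
Proof.
by move=> [[_ rf] [_ jf]]; under eq_fun do rewrite sqr_cmod; exact: rintD.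
Qed.

Lemma sqnorm_ge0 f : 0 <= sqnorm f.
Proof. by apply: expect_ge0 => x; exact: sqr_ge0. Qed.

Lemma sqnormD_le f g : csqint f -> csqint g ->
  sqnorm (fun x => f x + g x) <= 2 * sqnorm f + 2 * sqnorm g.
Proof.
move=> sf sg; rewrite /sqnorm -!expectZ; [|exact: rint_sqnorm..].
rewrite -expectD; [|apply: rintZ; exact: rint_sqnorm..].
apply: le_expect.
- by apply: rint_sqnorm; exact: csqintD.
- by apply: rintD; apply: rintZ; exact: rint_sqnorm.
- move=> x; rewrite !sqr_cmod ReD ImD.
  set a := complex.Re _; set b := complex.Re _; set c := complex.Im _; set e := complex.Im _.
  have := sqr_ge0 (a - b); have := sqr_ge0 (c - e); rewrite !sqrrB !sqrrD; lra.
Qed.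

Lemma sqnormZ (z : cplx R) f : csqint f ->
  sqnorm (fun x => z * f x) = cmod z ^+ 2 * sqnorm f.
Proof.
move=> sf; rewrite /sqnorm -expectZ; last exact: rint_sqnorm.
by apply: eq_expect => x; rewrite !sqr_cmod ReM ImM; ring.
Qed.

Lemma sqnorm_subZ (z : cplx R) f (u : T -> cplx R) : csqint f -> csqint u ->
  (forall x, `|u x| = 1) ->
  sqnorm (fun x => f x - z * u x) = sqnorm f
    - cmod (cintegral P (fun x => f x * (u x)^*)) ^+ 2
    + cmod (z - cintegral P (fun x => f x * (u x)^*)) ^+ 2.
Proof.
move=> sf su u1; set w := cintegral _ _.
have u2 x : complex.Re (u x) ^+ 2 + complex.Im (u x) ^+ 2 = 1.
  rewrite -sqr_cmod; have := u1 x; rewrite normcE => -[->].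
  by rewrite expr1n.
have [r1 r2] := csqint_crintMJ sf su.
have rn := rint_sqnorm sf.
transitivity (sqnorm f - 2 * (complex.Re z * complex.Re w + complex.Im z * complex.Im w)
   + cmod z ^+ 2); last first.
  by rewrite !sqr_cmod !Cparts; ring.
rewrite /w cintE /= mulrDr !mulrA -!expectZ//.
rewrite -expectD; [|exact: rintZ..].
rewrite /sqnorm -expectB//; last by apply: rintD; exact: rintZ.
rewrite -[cmod z ^+ 2](expect_cst P) -expectD; last 2 first.
- by apply: rintB => //; apply: rintD; exact: rintZ.
- by apply: bmeas_rint; exact: bmeas_cst.
apply: eq_expect => x; rewrite !sqr_cmod !Cparts.
have e := u2 x.
have -> : complex.Re z ^+ 2 + complex.Im z ^+ 2 =
    (complex.Re z ^+ 2 + complex.Im z ^+ 2) * (complex.Re (u x) ^+ 2 + complex.Im (u x) ^+ 2).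
  by rewrite e mulr1.
ring.
Qed.

End ComplexIntegral.

Section Characters.
Variables (R : realType) (A : compactAbelianGroupType).
Variables (mu : probability (borel A) R) (mu_haar : is_haar mu).
Implicit Types chi psi : dual R A.
Local Notation dual := (dual R A).
Local Notation cbm f := (cbmeas (f : borel A -> cplx R)).

Lemma cbmeas_dual chi : cbm chi.
Proof.
split; apply: bmeas_continuous.
  by move=> x; apply: (@continuous_comp _ _ _ chi (fun z : cplx R => complex.Re z));
    [exact: char_continuous|exact: continuous_Re].
by move=> x; apply: (@continuous_comp _ _ _ chi (fun z : cplx R => complex.Im z));
    [exact: char_continuous|exact: continuous_Im].
Qed.

Lemma cbmeas_crint (f : A -> cplx R) : cbm f -> crint mu f.
Proof. by move=> [? ?]; split; exact: bmeas_rint. Qed.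

Lemma csqint_dual chi : csqint mu chi.
Proof. exact/cbmeas_csqint/cbmeas_dual. Qed.

Lemma dual_invE chi x : dual_inv chi x = (chi x)^*.
Proof.
have : chi x * chi (- x) = 1 by rewrite -char_add subrr char0.
have : chi x * (chi x)^* = 1 by rewrite -normCK char_mod expr1n.
move=> <- h; apply: mulfI h.
by rewrite -normr_eq0 char_mod oner_neq0.
Qed.

Lemma cint_dual chi : cintegral mu chi = (chi == dual_one R A)%:R.
Proof.
have [->|chi1] := eqVneq chi (dual_one R A); first exact: cint_cst.
have [a ca] : exists a, chi a != 1.
  apply: contrapT => /forallNP h; move/eqP : chi1; apply; apply: dualP => x /=.
  by apply/eqP/negPn/negP/h.
have [bR bI] := cbmeas_dual chi.
have e : cintegral mu (fun x => chi a * chi x) = cintegral mu chi.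
  rewrite !cintE -(expect_shift mu_haar a bR) -(expect_shift mu_haar a bI).
  by congr Complex; apply: eq_expect => x /=; rewrite char_add mulrC.
rewrite cintZ in e; last exact/cbmeas_crint/cbmeas_dual.
apply/eqP; move/eqP : e; rewrite -subr_eq0 -[X in _ - X]mul1r -mulrBl mulf_eq0.
by rewrite subr_eq0 (negPf ca).
Qed.

Lemma cint_dualMJ psi chi :
  cintegral mu (fun x => psi x * (chi x)^*) = (psi == chi)%:R.
Proof.
transitivity (cintegral mu (dual_mul psi (dual_inv chi))).
  by apply: eq_cint => x; rewrite -dual_invE.
rewrite cint_dual; congr ((nat_of_bool _)%:R); apply/eqP/eqP => [h|->].
  apply: dualP => x; have := congr1 (fun u : dual => u x) h => /=.
  rewrite -[chi (- x)]/(dual_inv chi x) dual_invE => e.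
  have c1 : chi x * (chi x)^* = 1 by rewrite -normCK char_mod expr1n.
  apply: (mulIf (_ : (chi x)^* != 0)); last by rewrite e c1.
  by rewrite conjC_eq0 -normr_eq0 char_mod oner_neq0.
by apply: dualP => x /=; rewrite -char_add subrr char0.
Qed.

Definition ft (f : A -> cplx R) chi : cplx R := cintegral mu (fun x => f x * (chi x)^*).

Lemma csqint_sum (F : seq dual) (z : dual -> cplx R) :
  csqint mu (fun x => \sum_(chi <- F) z chi * chi x).
Proof.
elim: F => [|chi F ih].
  under eq_fun do rewrite big_nil; apply: cbmeas_csqint; split; exact: bmeas_cst.
under eq_fun do rewrite big_cons; apply: csqintD => //.
by apply: csqintZ; exact: csqint_dual.
Qed.

Lemma pythagoras (f : A -> cplx R) (F : seq dual) (z : dual -> cplx R) :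
  csqint mu f -> uniq F ->
  sqnorm mu (fun x => f x - \sum_(chi <- F) z chi * chi x) =
  sqnorm mu f - \sum_(chi <- F) cmod (ft f chi) ^+ 2
     + \sum_(chi <- F) cmod (z chi - ft f chi) ^+ 2.
Proof.
move=> sf; elim: F => [|chi F ih] /=.
  move=> _; rewrite !big_nil subr0 addr0; congr expect.
  by apply/funext => x; rewrite big_nil subr0.
move=> /andP[chiF uF]; rewrite !big_cons.
have sS := csqint_sum F z.
have -> : (fun x => f x - \sum_(psi <- chi :: F) z psi * psi x) =
  (fun x => (f x - \sum_(psi <- F) z psi * psi x) - z chi * chi x).
  by apply/funext => x; rewrite big_cons opprD addrA addrAC.
rewrite sqnorm_subZ; [|exact: csqintB|exact: csqint_dual|exact: char_mod].
rewrite (ih uF).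
have -> : cintegral mu (fun x => (f x - \sum_(psi <- F) z psi * psi x) * (chi x)^*) = ft f chi.
  transitivity (cintegral mu (fun x => f x * (chi x)^* +
     (-1) * \sum_(psi <- F) z psi * (psi x * (chi x)^*))).
    apply: eq_cint => x; rewrite mulrBl mulN1r mulr_suml; congr (_ - _).
    by apply: eq_bigr => psi _; rewrite mulrA.
  have r1 psi : crint mu (fun x => psi x * (chi x)^*).
    by apply: csqint_crintMJ; exact: csqint_dual.
  have r2 : crint mu (fun x => \sum_(psi <- F) z psi * (psi x * (chi x)^*)).
    by apply: crint_sum => psi; exact: crintZ.
  rewrite cintD; last exact: crintZ; last by apply: csqint_crintMJ => //; exact: csqint_dual.
  rewrite cintZ// cint_sum; last by move=> psi; exact: crintZ.
  rewrite big_seq big1 ?mulr0 ?addr0// => psi psiF.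
  rewrite cintZ// cint_dualMJ; have [e|_] := eqVneq psi chi; last by rewrite mulr0.
  by rewrite -e psiF in chiF.
lra.
Qed.

Lemma bessel (f : A -> cplx R) (F : seq dual) : csqint mu f -> uniq F ->
  \sum_(chi <- F) cmod (ft f chi) ^+ 2 <= sqnorm mu f.
Proof.
move=> sf uF; have := pythagoras (ft f) sf uF.
rewrite [X in _ + X]big1 ?addr0; last first.
  by move=> chi _; rewrite subrr /cmod normr0 expr0n.
by move=> h; rewrite -subr_ge0 -h sqnorm_ge0.
Qed.

End Characters.

Lemma big_uniq_subset (V : nmodType) (I : eqType) (F G : seq I) (v : I -> V) :
  uniq F -> uniq G -> {subset F <= G} ->
  \sum_(i <- G) v i = \sum_(i <- F) v i + \sum_(i <- G | i \notin F) v i.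
Proof.
move=> uF uG FG; rewrite (bigID (mem F))/=; congr (_ + _).
rewrite -big_filter; apply: perm_big; apply: uniq_perm => //.
  exact: filter_uniq.
by move=> i; rewrite mem_filter andb_idr// => /FG.
Qed.

Section Parseval.
Variables (R : realType) (A : compactAbelianGroupType).
Variables (mu : probability (borel A) R) (mu_haar : is_haar mu).
Local Notation dual := (dual R A).
Local Notation "''E' f" := (expect mu f) (at level 10, f at level 8).
Local Notation bm f := (bmeas (f : borel A -> R)).
Local Notation ind E := (\1_(E : set (borel A)) : A -> R).
Local Notation re chi := (fun x => complex.Re (chi x)).
Local Notation im chi := (fun x => complex.Im (chi x)).

Definition indC (E : set (borel A)) (x : A) : cplx R := Complex (ind E x) 0.

Lemma csqint_indC (E : set (borel A)) : measurable E -> csqint mu (indC E).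
Proof.
by move=> mE; apply: cbmeas_csqint; split; [exact: bm_ind|exact: bmeas_cst].
Qed.

Lemma sqnorm_indC (E : set (borel A)) : sqnorm mu (indC E) = autocorr mu E 0.
Proof.
apply: eq_expect => x; rewrite sqr_cmod /= expr0n addr0 addr0 expr2.
by rewrite indicE.
Qed.

Lemma sqr_ft_indC (E : set (borel A)) (chi : dual) : measurable E ->
  cmod (ft mu (indC E) chi) ^+ 2 = 'E (fun x => autocorr mu E x * complex.Re (chi x)).
Proof.
move=> mE; have bE := bm_ind R mE; have [bR bI] := cbmeas_dual chi.
set a := 'E (fun x => ind E x * complex.Re (chi x)).
set b := 'E (fun x => ind E x * complex.Im (chi x)).
have -> : cmod (ft mu (indC E) chi) ^+ 2 = a ^+ 2 + b ^+ 2.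
  rewrite sqr_cmod /ft cintE /=; congr (_ ^+ 2 + _).
    by apply: eq_expect => x; rewrite ReM /= mul0r subr0 ReJ.
  rewrite -[b ^+ 2]sqrrN -mulN1r -expectZ; last by apply: bmeas_rint; exact: bmeasM.
  congr (_ ^+ 2); apply: eq_expect => x.
  by rewrite ImM /= mul0r addr0 ImJ mulrN mulN1r.
transitivity ('E (fun x => 'E (fun y => ind E (y + x) * ind E y * complex.Re (chi x)))); last first.
  apply: eq_expect => x; rewrite /autocorr mulrC -expectZ.
    by apply: eq_expect => y; rewrite mulrC.
  by apply: bmeas_rint; apply: bmeasM => //; exact: bmeas_shift.
rewrite (@expect_fubini _ _ _ _ _ mu mu
  (fun x y : borel A => ind E ((y : A) + (x : A)) * ind E y * complex.Re (chi x))); last 2 first.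
- apply: measurable_funM; last exact: (measurableT_comp bR.1 measurable_fst).
  apply: measurable_funM; last exact: (measurableT_comp bE.1 measurable_snd).
  under eq_fun do rewrite addrC.
  exact: (measurableT_comp bE.1 (@measurable_add A)).
- have [M hM] := bE.2; have [N hN] := bR.2.
  by exists (M * M * N) => x y; rewrite !normrM !ler_pM// mulr_ge0.
have inner y : 'E (fun x => ind E (y + x) * ind E y * complex.Re (chi x)) =
    a * (ind E y * complex.Re (chi y)) + b * (ind E y * complex.Im (chi y)).
  pose G x := ind E y * complex.Re (chi y) * (ind E x * complex.Re (chi x)) +
              ind E y * complex.Im (chi y) * (ind E x * complex.Im (chi x)).
  have bG : bm G by apply: bmeasD; apply: bmeasZ; exact: bmeasM.
  transitivity ('E G).
    rewrite -(expect_shift mu_haar y bG); apply: eq_expect => x.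
    have -> : complex.Re (chi x) = complex.Re (chi (x + y) * (chi y)^*).
      by rewrite char_add -mulrA -normCK char_mod expr1n mulr1.
    rewrite /G ReM ReJ ImJ [x + y]addrC; ring.
  rewrite expectD; [|by apply: bmeas_rint; apply: bmeasZ; exact: bmeasM..].
  rewrite !expectZ; [|by apply: bmeas_rint; exact: bmeasM..].
  by rewrite -/a -/b; ring.
under eq_expect do rewrite inner.
rewrite expectD; [|by apply: bmeas_rint; apply: bmeasZ; exact: bmeasM..].
rewrite !expectZ; [|by apply: bmeas_rint; exact: bmeasM..].
by rewrite -/a -/b !expr2.
Qed.

Lemma expect_ReMRe (psi chi : dual) :
  'E (fun x => complex.Re (psi x) * complex.Re (chi x)) =
  ((psi == chi)%:R + (psi == dual_inv chi)%:R) / 2.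
Proof.
have e1 := congr1 (@complex.Re R) (cint_dualMJ mu_haar psi chi).
have e2 := congr1 (@complex.Re R) (cint_dualMJ mu_haar psi (dual_inv chi)).
have rn (b : bool) : complex.Re (b%:R : cplx R) = b%:R by case: b.
rewrite rn cintE /= in e1; rewrite rn cintE /= in e2.
have [pR pI] := cbmeas_dual psi; have [cR cI] := cbmeas_dual chi.
have r1 := (csqint_crintMJ (csqint_dual mu psi) (csqint_dual mu chi)).1.
have r2 := (csqint_crintMJ (csqint_dual mu psi) (csqint_dual mu (dual_inv chi))).1.
rewrite -e1 -e2 -expectD// mulrC -expectZ; last exact: rintD.
apply: eq_expect => x.
by rewrite -[chi (- x)]/(dual_inv chi x) dual_invE !Cparts; field.
Qed.

Theorem parseval_indC (E : set (borel A)) (e : R) : measurable E -> 0 < e ->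
  exists2 F : seq dual, uniq F &
    sqnorm mu (indC E) - e < \sum_(chi <- F) cmod (ft mu (indC E) chi) ^+ 2.
Proof.
move=> mE e0; have sE := csqint_indC mE.
pose w (chi : dual) := cmod (ft mu (indC E) chi) ^+ 2.
have w0 chi : 0 <= w chi by exact: sqr_ge0.
pose Z := [set s | exists2 F : seq dual, uniq F & s = \sum_(chi <- F) w chi].
have Zub : ubound Z (sqnorm mu (indC E)) by move=> _ [F uF ->]; exact: bessel.
have Z0 : Z 0 by exists [::]; rewrite ?big_nil.
have supZ : has_sup Z by split; [exists 0|exists (sqnorm mu (indC E))].
pose S := sup Z.
have SF F : uniq F -> \sum_(chi <- F) w chi <= S.
  by move=> uF; apply: ub_le_sup; [exact: supZ.2|exists F].
suff SE : sqnorm mu (indC E) = S.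
  by have [_ [F uF ->] hF] := sup_adherent e0 supZ; exists F; rewrite // SE.
have /choice[F_ FP] (n : nat) : exists F : seq dual, uniq F /\ S - n.+1%:R^-1 < \sum_(chi <- F) w chi.
  have n0 : 0 < n.+1%:R^-1 :> R by rewrite invr_gt0.
  have [_ [F uF ->] hF] := sup_adherent n0 supZ.
  by exists F.
pose G := fix G n := if n is m.+1 then undup (G m ++ F_ m.+1) else F_ 0%N.
have uG n : uniq (G n) by case: n => [|n] /=; [exact: (FP 0%N).1|exact: undup_uniq].
have FG n : {subset F_ n <= G n}.
  by case: n => [//|n] chi /=; rewrite mem_undup mem_cat => ->; rewrite orbT.
have GG n m : (n <= m)%N -> {subset G n <= G m}.
  move=> /subnKC <-; elim: (m - n)%N => [|j ih]; first by rewrite addn0.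
  by rewrite addnS => chi /ih /= h; rewrite mem_undup mem_cat h.
have Glow n : S - n.+1%:R^-1 < \sum_(chi <- G n) w chi.
  rewrite (big_uniq_subset w (FP n).1 (uG n) (FG n)).
  by apply: lt_le_trans (FP n).2 _; rewrite lerDl sumr_ge0.
pose k n x := autocorr mu E x - \sum_(chi <- G n) w chi * complex.Re (chi x).
have bR (chi : dual) : bm (re chi) := (cbmeas_dual chi).1.
have cR (chi : dual) : continuous (re chi).
  by move=> x; apply: (@continuous_comp _ _ _ chi (fun z : cplx R => complex.Re z));
    [exact: char_continuous|exact: continuous_Re].
have eR (chi : dual) x : complex.Re (chi (- x)) = complex.Re (chi x).
  by rewrite -[chi (- x)]/(dual_inv chi x) dual_invE ReJ.
have R1 (chi : dual) x : `|complex.Re (chi x)| <= 1.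
  by apply: le_trans (le_Re_cmod _) _; have := char_mod chi x; rewrite normcE => -[->].
have ca : ceven (autocorr mu E).
  by split; [exact: continuous_autocorr|move=> x; exact: autocorr_even].
have cS (F : seq dual) : ceven (fun x => \sum_(chi <- F) w chi * complex.Re (chi x)).
  elim: F => [|chi F ih].
    split; last by move=> x; rewrite !big_nil.
    by under eq_fun do rewrite big_nil; move=> x; exact: cvg_cst.
  have := ceven_lin (w chi) 1 (conj (cR chi) (eR chi)) ih.
  by congr ceven; apply/funext => x; rewrite big_cons mul1r.
have ck n : ceven (k n).
  have := ceven_lin 1 (-1) ca (cS (G n)).
  by congr ceven; apply/funext => x; rewrite mul1r mulN1r.
have kd n m x : (n <= m)%N -> `|k n x - k m x| <= n.+1%:R^-1.
  move=> nm; rewrite /k (big_uniq_subset _ (uG n) (uG m) (GG _ _ nm)).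
  rewrite [X in `|X|](_ : _ = \sum_(i <- G m | i \notin G n) w i * complex.Re (i x)); last by ring.
  apply: le_trans (ler_norm_sum _ _ _) _.
  apply: (@le_trans _ _ (\sum_(chi <- G m | chi \notin G n) w chi)).
    by apply: ler_sum => chi _; rewrite normrM ger0_norm// ler_piMr.
  have := SF _ (uG m); rewrite (big_uniq_subset w (uG n) (uG m) (GG _ _ nm)).
  rewrite -lerBrDl => h; apply: le_trans h _.
  by rewrite lerBlDl -lerBlDr; exact: ltW (Glow n).
have [K kK] : exists K, ucvg k K.
  apply: ucvg_cauchy => d d0.
  have [N _ NP] : \forall n \near \oo, n.+1%:R^-1 <= d :> R.
    have /cvgrPdist_le/(_ _ d0) := @cvg_harmonic R.
    by apply: filterS => n; rewrite sub0r normrN ger0_norm// invr_ge0.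
  exists N => n m x Nn Nm; have [nm|/ltnW mn] := leqP n m.
    by apply: le_trans (kd _ _ _ nm) _; exact: NP.
  by rewrite distrC; apply: le_trans (kd _ _ _ mn) _; exact: NP.
have cK : ceven K.
  split; first by apply: (ucvg_continuous kK) => n; exact: (ck n).1.
  move=> x; have := ucvg_cvg (x := - x) kK.
  under eq_fun do rewrite (ck _).2.
  by move=> /(cvg_unique (@Rhausdorff R))/(_ (ucvg_cvg kK)).
have bk n : bm (k n) by exact: ceven_bmeas.
have bK : bm K by exact: ceven_bmeas.
have ba : bm (autocorr mu E) by exact: ceven_bmeas.
have winv (chi : dual) : w (dual_inv chi) = w chi.
  rewrite /w !sqr_ft_indC//; apply: eq_expect => x; congr (_ * _).
  by rewrite dual_invE ReJ.
have wG (chi : dual) n : \sum_(psi <- G n) w psi * (psi == chi)%:R = w chi * (chi \in G n)%:R.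
  have [cG|cG] := boolP (chi \in G n).
    rewrite (big_rem chi cG)/= eqxx big_seq big1 ?addr0// => psi.
    by rewrite mem_rem_uniq// inE => /andP[/negPf -> _]; rewrite mulr0.
  rewrite big_seq big1 ?mulr0// => psi psiG; case: eqVneq => [pc|_]; last by rewrite mulr0.
  by rewrite -pc psiG in cG.
have Ek n (chi : dual) : 'E (fun x => k n x * complex.Re (chi x)) =
    w chi - (w chi * (chi \in G n)%:R + w chi * (dual_inv chi \in G n)%:R) / 2.
  transitivity ('E (fun x => autocorr mu E x * complex.Re (chi x) -
     \sum_(psi <- G n) w psi * (complex.Re (psi x) * complex.Re (chi x)))).
    apply: eq_expect => x; rewrite mulrBl mulr_suml; congr (_ - _).
    by apply: eq_bigr => psi _; rewrite mulrA.
  have rp (psi : dual) : rint mu (fun x => w psi * (complex.Re (psi x) * complex.Re (chi x))).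
    by apply: rintZ; apply: bmeas_rint; exact: bmeasM.
  rewrite expectB; [|by apply: bmeas_rint; exact: bmeasM|by apply: rint_sum => psi _].
  rewrite -sqr_ft_indC// -/(w chi) expect_sum; last by move=> psi _.
  have := wG (dual_inv chi) n; rewrite winv => <-.
  rewrite -wG -big_split /= mulr_suml.
  congr (_ - _); apply: eq_bigr => psi _.
  rewrite expectZ; last by apply: bmeas_rint; exact: bmeasM.
  by rewrite expect_ReMRe mulrA mulrDr.
have EK (chi : dual) : 'E (fun x => K x * complex.Re (chi x)) = 0.
  have h : 'E (fun x => k n x * complex.Re (chi x)) @[n --> \oo] -->
           'E (fun x => K x * complex.Re (chi x)).
    have := @conv_cvg _ _ mu (re chi) k K 0 (bR chi) bK bk kK.
    rewrite conv0//; under eq_fun do rewrite conv0//.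
    under [X in _ --> X -> _]eq_expect do rewrite mulrC.
    under eq_fun do under eq_expect do rewrite mulrC.
    exact.
  have [wc|wc] := eqVneq (w chi) 0.
    apply: (cvg_unique (@Rhausdorff R) h).
    apply: cvg_near_cst; apply: nearW => n /=.
    by rewrite Ek wc !(mul0r, addr0) subr0.
  have wgt : 0 < w chi by rewrite lt_neqAle eq_sym wc w0.
  have [N _ NP] : \forall n \near \oo, n.+1%:R^-1 <= w chi :> R.
    have /cvgrPdist_le/(_ _ wgt) := @cvg_harmonic R.
    by apply: filterS => n; rewrite sub0r normrN ger0_norm// invr_ge0.
  have inG (psi : dual) n : (N <= n)%N -> w psi = w chi -> psi \in G n.
    move=> Nn pc; apply: contrapT => /negP pG.
    have := SF (psi :: G n); rewrite /= pG (uG n) big_cons pc => /(_ isT).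
    move: (Glow n) (NP n Nn) => /=; move: (\sum_(j <- G n) w j) (n.+1%:R^-1) => s r; lra.
  apply: (cvg_unique (@Rhausdorff R) h).
  apply: cvg_near_cst; exists N => // n /= Nn.
  by rewrite Ek !inG// !mulr1; lra.
have K00 : K 0 = 0.
  apply/eqP; apply: contrapT => /negP K0.
  by have [chi] := character_detects mu_haar cK K0; rewrite EK eqxx.
have h0 : k n 0 @[n --> \oo] --> (0 : R) by rewrite -K00; exact: ucvg_cvg.
have h1 : k n 0 @[n --> \oo] --> sqnorm mu (indC E) - S.
  rewrite /k; apply: cvgB; first by rewrite sqnorm_indC; exact: cvg_cst.
  apply/cvgrPdist_le => d d0.
  have /cvgrPdist_le/(_ _ d0) := @cvg_harmonic R.
  apply: filterS => n; rewrite sub0r normrN ger0_norm ?invr_ge0// => nd.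
  under eq_bigr do rewrite char0 mulr1.
  rewrite ger0_norm ?subr_ge0 ?SF//.
  by apply: le_trans nd; rewrite lerBlDl -lerBlDr; exact: ltW (Glow n).
apply/eqP; rewrite -subr_eq0; apply/eqP.
by apply: (cvg_unique (@Rhausdorff R) h1); exact: h0.
Qed.

End Parseval.

Transparent expect.

Section SimpleDensity.
Context d (T : measurableType d) (R : realType) (P : probability T R).
Import HBNNSimple.

Lemma nnsfun_sqint_dense (g : T -> R) (e : R) : sqint P g -> (forall x, 0 <= g x) -> 0 < e ->
  exists s : {nnsfun T >-> R}, sqint P s /\ expect P (fun x => (g x - s x) ^+ 2) < e.
Proof.
move=> sg g0 e0.
have mg : measurable_fun setT (EFin \o g) by apply/measurable_EFinP; exact: sg.1.
pose s n := nnsfun_approx measurableT mg n.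
have s0 n x : 0 <= s n x by [].
have sle n x : s n x <= g x.
  by rewrite -lee_fin /s nnsfun_approxE; apply: le_approx => //= y _; rewrite lee_fin.
have scvg x : s n x @[n --> \oo] --> g x.
  have := @cvg_nnsfun_approx _ _ _ setT measurableT _ mg (fun x _ => g0 x) x Logic.I.
  by move=> /fine_cvgP[].
have ms n : measurable_fun setT (s n) by exact: measurable_funP.
have ss n : sqint P (s n).
  split=> //; apply: (le_rint _ _ sg.2).
    by under eq_fun do rewrite expr2; exact: measurable_funM.
  by move=> x; rewrite ger0_norm ?sqr_ge0// ler_pXn2r// nnegrE.
have : expect P (fun x => (g x - s n x) ^+ 2) @[n --> \oo] --> (0 : R).
  have mf n : measurable_fun setT (EFin \o (fun x => (g x - s n x) ^+ 2)).
    apply/measurable_EFinP; under eq_fun do rewrite expr2.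
    by apply: measurable_funM; apply: measurable_funB => //; exact: sg.1.
  have mz : measurable_fun setT (cst 0%E : T -> \bar R) by [].
  have := @dominated_convergence _ _ _ P setT measurableT _ (cst 0%E)
     (EFin \o (fun x => g x ^+ 2)) mf mz.
  case.
  - apply: aeW => x _ /=; apply: cvg_EFin; first exact: nearW.
    rewrite -[0](expr0n _ 2) -(subrr (g x)).
    apply: (@cvg_comp _ _ _ (fun n => g x - s n x) (fun y => y ^+ 2)).
      by apply: cvgB => //; exact: cvg_cst.
    exact: exprn_continuous.
  - exact: sg.2.
  - apply: aeW => x n _ /=; rewrite lee_fin ger0_norm ?sqr_ge0//.
    by rewrite ler_pXn2r// ?nnegrE ?subr_ge0// lerBlDl lerDr.
  - move=> _ _; rewrite integral0 => /fine_cvgP[_] /=.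
    exact.
move=> /cvgrPdist_lt/(_ _ e0)[n _ /(_ _ (leqnn n))] /=.
rewrite sub0r normrN ger0_norm => [sn|]; last by apply: expect_ge0 => x; exact: sqr_ge0.
by exists (s n).
Qed.

End SimpleDensity.

Opaque expect.

Section Completeness.
Variables (R : realType) (A : compactAbelianGroupType).
Variables (mu : probability (borel A) R) (mu_haar : is_haar mu).
Local Notation dual := (dual R A).
Local Notation "''E' f" := (expect mu f) (at level 10, f at level 8).
Implicit Types f g : A -> cplx R.

Definition approximable f := forall e : R, 0 < e ->
  exists2 F : seq dual, uniq F &
    exists z : dual -> cplx R, sqnorm mu (fun x => f x - \sum_(chi <- F) z chi * chi x) < e.

Lemma trig_extend (F G : seq dual) (z : dual -> cplx R) (x : A) :
  uniq F -> uniq G -> {subset F <= G} ->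
  \sum_(chi <- F) z chi * chi x = \sum_(chi <- G) (if chi \in F then z chi else 0) * chi x.
Proof.
move=> uF uG FG; rewrite (big_uniq_subset _ uF uG FG) [X in _ + X]big1 ?addr0.
  by rewrite !big_seq; apply: eq_bigr => chi ->.
by move=> chi /negPf ->; rewrite mul0r.
Qed.

Lemma approximableZ (c : cplx R) f : csqint mu f -> approximable f ->
  approximable (fun x => c * f x).
Proof.
move=> sf af e e0.
have c0 : 0 < cmod c ^+ 2 + 1 by rewrite ltr_wpDl// sqr_ge0.
have [F uF [z fz]] := af _ (divr_gt0 e0 c0).
exists F => //; exists (fun chi => c * z chi).
have -> : (fun x => c * f x - \sum_(chi <- F) c * z chi * chi x) =
    (fun x => c * (f x - \sum_(chi <- F) z chi * chi x)).
  apply/funext => x; rewrite mulrBr mulr_sumr; congr (_ - _).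
  by apply: eq_bigr => chi _; rewrite mulrA.
rewrite sqnormZ; last by apply: csqintB => //; exact: csqint_sum.
apply: le_lt_trans (_ : (cmod c ^+ 2 + 1) * (sqnorm mu (fun x => f x - \sum_(chi <- F) z chi * chi x)) < e).
  by rewrite ler_wpM2r ?sqnorm_ge0// lerDl.
by rewrite mulrC -ltr_pdivlMr.
Qed.

Lemma approximableD f g : csqint mu f -> csqint mu g ->
  approximable f -> approximable g -> approximable (fun x => f x + g x).
Proof.
move=> sf sg af ag e e0; have e4 : 0 < e / 4 by exact: divr_gt0.
have [F uF [z fz]] := af _ e4; have [G uG [w gw]] := ag _ e4.
pose H := undup (F ++ G); have uH : uniq H by exact: undup_uniq.
have FH : {subset F <= H} by move=> chi; rewrite mem_undup mem_cat => ->.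
have GH : {subset G <= H} by move=> chi; rewrite mem_undup mem_cat orbC => ->.
exists H => //.
exists (fun chi => (if chi \in F then z chi else 0) + (if chi \in G then w chi else 0)).
have -> : (fun x => f x + g x - \sum_(chi <- H)
    ((if chi \in F then z chi else 0) + (if chi \in G then w chi else 0)) * chi x) =
    (fun x => (f x - \sum_(chi <- F) z chi * chi x) + (g x - \sum_(chi <- G) w chi * chi x)).
  apply/funext => x; rewrite (trig_extend z x uF uH FH) (trig_extend w x uG uH GH).
  rewrite addrACA -opprD -big_split; congr (_ - _).
  by apply: eq_bigr => chi _; rewrite mulrDl.
apply: le_lt_trans (sqnormD_le _ _) _; [by apply: csqintB => //; exact: csqint_sum..|].
lra.
Qed.

Lemma approximable_lim f : csqint mu f ->
  (forall e : R, 0 < e -> exists g, [/\ csqint mu g, approximable g &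
     sqnorm mu (fun x => f x - g x) < e]) -> approximable f.
Proof.
move=> sf fg e e0; have e4 : 0 < e / 4 by exact: divr_gt0.
have [g [sg ag h]] := fg _ e4; have [F uF [z gz]] := ag _ e4.
exists F => //; exists z.
have -> : (fun x => f x - \sum_(chi <- F) z chi * chi x) =
  (fun x => (f x - g x) + (g x - \sum_(chi <- F) z chi * chi x)).
  by apply/funext => x; rewrite addrA subrK.
apply: le_lt_trans (sqnormD_le _ _) _; first exact: csqintB.
  by apply: csqintB => //; exact: csqint_sum.
lra.
Qed.

Lemma approximable_sum (I : Type) (r : seq I) (c : I -> cplx R) (f : I -> A -> cplx R) :
  (forall i, csqint mu (f i) /\ approximable (f i)) ->
  csqint mu (fun x => \sum_(i <- r) c i * f i x) /\
  approximable (fun x => \sum_(i <- r) c i * f i x).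
Proof.
move=> af; elim: r => [|i r [ih1 ih2]].
  under eq_fun do rewrite big_nil; split.
    by apply: cbmeas_csqint; split; exact: bmeas_cst.
  move=> e e0; exists [::] => //; exists (fun=> 0).
  rewrite /sqnorm; under eq_expect do rewrite big_nil subrr /cmod normr0 expr0n.
  by rewrite expect_cst.
under eq_fun do rewrite big_cons; have [si ai] := af i.
split; first by apply: csqintD => //; exact: csqintZ.
apply: approximableD => //; first exact: csqintZ.
exact: approximableZ.
Qed.

Lemma approximable_indC (E : set (borel A)) : measurable E -> approximable (indC R E).
Proof.
move=> mE e e0; have [F uF FE] := parseval_indC mu_haar mE e0.
exists F => //; exists (ft mu (indC R E)).
rewrite pythagoras//; last exact: csqint_indC.
rewrite [X in _ + X]big1 ?addr0; first by lra.
by move=> chi _; rewrite subrr /cmod normr0 expr0n.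
Qed.

Import HBNNSimple.

Lemma approximable_ge0 (g : A -> R) : sqint mu (g : borel A -> R) -> (forall x, 0 <= g x) ->
  csqint mu (fun x => Complex (g x) 0) /\ approximable (fun x => Complex (g x) 0).
Proof.
move=> sg g0.
have sC (h : A -> R) : sqint mu (h : borel A -> R) -> csqint mu (fun x => Complex (h x) 0).
  by move=> sh; split => //; apply: bmeas_sqint; exact: bmeas_cst.
split; first exact: sC.
apply: approximable_lim; first exact: sC.
move=> e e0; have [s [ss sn]] := nnsfun_sqint_dense sg g0 e0.
exists (fun x => Complex (s x) 0); split; first exact: sC.
  have := @approximable_sum _ (finmap.enum_fset (fset_set (range s))) (fun y => Complex y 0)
    (fun y => indC R (s @^-1` [set y])).
  have -> : (fun x => Complex (s x) 0) = (fun x : A =>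
     \sum_(y <- finmap.enum_fset (fset_set (range s))) Complex y 0 * indC R (s @^-1` [set y]) x).
    apply/funext => x; rewrite fimfunE fsbig_finite//=.
    elim/big_rec2: _ => // y u v _ <-.
    by apply: cplx_eq; rewrite ?Cparts /= ?Cparts /=; ring.
  apply: (fun h => (h _).2) => y; split; first exact: csqint_indC.
  exact: approximable_indC.
rewrite /sqnorm; under eq_expect do rewrite sqr_cmod ReD ReN ImD ImN /= subrr expr0n addr0.
exact: sn.
Qed.

Theorem approximable_csqint f : csqint mu f -> approximable f.
Proof.
move=> sf.
pose p (h : A -> R) x := Num.max (h x) 0.
have sp (h : A -> R) : sqint mu (h : borel A -> R) -> sqint mu (p h : borel A -> R).
  move=> [mh h2]; have mp : measurable_fun setT (p h : borel A -> R).
    by apply: measurable_maxr.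
  split=> //; apply: (le_rint _ _ h2).
    by under eq_fun do rewrite expr2; exact: measurable_funM.
  move=> x; rewrite ger0_norm ?sqr_ge0// /p.
  by case: (leP (h x) 0) => _ //; rewrite expr0n sqr_ge0.
have ap (h : A -> R) : sqint mu (h : borel A -> R) ->
    csqint mu (fun x => Complex (p h x) 0) /\ approximable (fun x => Complex (p h x) 0).
  by move=> sh; apply: approximable_ge0; [exact: sp|move=> x; rewrite /p le_max lexx orbT].
have sN (h : A -> R) : sqint mu (h : borel A -> R) -> sqint mu ((fun x => - h x) : borel A -> R).
  by move=> sh; under eq_fun do rewrite -mulN1r; exact: sqintZ.
pose g (i : 'I_4) : A -> cplx R := fun x => Complex (
  nth (fun=> 0) [:: p (fun x => complex.Re (f x)); p (fun x => - complex.Re (f x));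
    p (fun x => complex.Im (f x)); p (fun x => - complex.Im (f x))] i x) 0.
pose c (i : 'I_4) : cplx R := nth 0 [:: Complex 1 0; Complex (-1) 0; Complex 0 1; Complex 0 (-1)] i.
have -> : f = fun x => \sum_(i <- index_enum 'I_4) c i * g i x.
  have pE (t : R) : t = Num.max t 0 - Num.max (- t) 0.
    by case: (leP t 0); case: (leP (- t) 0); lra.
  apply/funext => x; rewrite !big_ord_recl big_ord0 /c /g /p /=.
  apply: cplx_eq; rewrite !Cparts /=.
    by rewrite {1}(pE (complex.Re (f x))); ring.
  by rewrite {1}(pE (complex.Im (f x))); ring.
apply: (fun h => (@approximable_sum _ (index_enum 'I_4) c g h).2).
case=> -[|[|[|[|//]]]] i; rewrite /g /=; apply: ap.
- exact: sf.1.
- exact: sN sf.1.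
- exact: sf.2.
- exact: sN sf.2.
Qed.

Theorem parseval f (e : R) : csqint mu f -> 0 < e -> exists2 F : seq dual, uniq F &
  (forall chi, chi \in F -> ft mu f chi != 0) /\
  sqnorm mu f - e < \sum_(chi <- F) cmod (ft mu f chi) ^+ 2.
Proof.
move=> sf e0; have [F uF [z]] := approximable_csqint sf e0.
rewrite pythagoras// => h.
exists [seq chi <- F | ft mu f chi != 0]; first exact: filter_uniq.
split; first by move=> chi; rewrite mem_filter => /andP[].
rewrite big_filter.
have -> : \sum_(chi <- F | ft mu f chi != 0) cmod (ft mu f chi) ^+ 2 =
    \sum_(chi <- F) cmod (ft mu f chi) ^+ 2.
  rewrite [RHS](bigID (fun chi => ft mu f chi != 0))/= [X in _ + X]big1 ?addr0// => chi.
  by rewrite negbK => /eqP ->; rewrite /cmod normr0 expr0n.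
have : 0 <= \sum_(chi <- F) cmod (z chi - ft mu f chi) ^+ 2.
  by apply: sumr_ge0 => chi _; exact: sqr_ge0.
lra.
Qed.

End Completeness.

Transparent expect.

Section MeasurableParts.
Context d (T : measurableType d) (R : realType) (P : probability T R).
Variable f : {mfun T >-> borel (cplx R)}.

Lemma measurable_Re : measurable_fun setT (fun x => complex.Re (f x)).
Proof.
have m := continuous_borel_real (T := cplx R) (@continuous_Re R).
have mf : measurable_fun setT (f : T -> borel (cplx R)) by exact: measurable_funP.
exact: (measurableT_comp m mf).
Qed.

Lemma measurable_Im : measurable_fun setT (fun x => complex.Im (f x)).
Proof.
have m := continuous_borel_real (T := cplx R) (@continuous_Im R).
have mf : measurable_fun setT (f : T -> borel (cplx R)) by exact: measurable_funP.
exact: (measurableT_comp m mf).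
Qed.

Lemma measurable_sqr_cmod : measurable_fun setT (fun x => cmod (f x) ^+ 2).
Proof.
under eq_fun do rewrite sqr_cmod !expr2.
by apply: measurable_funD; apply: measurable_funM;
  (exact: measurable_Re || exact: measurable_Im).
Qed.

Lemma rint_csqint : rint P (fun x => cmod (f x) ^+ 2) -> csqint P f.
Proof.
move=> rf; split; split; [exact: measurable_Re| |exact: measurable_Im|];
  apply: (le_rint _ _ rf) => [|x].
- by under eq_fun do rewrite expr2; apply: measurable_funM; exact: measurable_Re.
- by rewrite ger0_norm ?sqr_ge0// sqr_cmod lerDl sqr_ge0.
- by under eq_fun do rewrite expr2; apply: measurable_funM; exact: measurable_Im.
- by rewrite ger0_norm ?sqr_ge0// sqr_cmod lerDr sqr_ge0.
Qed.

Lemma sqr_Lnorm2 : (Lnorm P 2%:E (fun x => (cmod (f x))%:E) `^ 2 =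
  \int[P]_x (cmod (f x) ^+ 2)%:E)%E.
Proof.
rewrite poweR_Lnorm ?pnatr_eq0//; apply: eq_integral => x _ /=.
by rewrite ger0_norm ?cmod_ge0// powR_mulrn// cmod_ge0.
Qed.

Lemma csqint_Lnorm2 : (Lnorm P 2%:E (fun x => (cmod (f x))%:E) < +oo)%E -> csqint P f.
Proof.
move=> N; apply: rint_csqint; apply/integrableP; split.
  by apply/measurable_EFinP; exact: measurable_sqr_cmod.
under eq_integral do rewrite /= ger0_norm ?sqr_ge0//.
by rewrite -sqr_Lnorm2; apply: poweR_lty.
Qed.

Lemma Lnorm2_sqnorm : csqint P f ->
  fine (Lnorm P 2%:E (fun x => (cmod (f x))%:E)) = Num.sqrt (sqnorm P f).
Proof.
move=> sf; have := sqr_Lnorm2.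
have N0 := Lnorm_ge0 P 2%:E (fun x => (cmod (f x))%:E).
have fin := integrable_fin_num measurableT (rint_sqnorm sf).
move: N0 fin => /=; rewrite /sqnorm.
case: (Lnorm _ _ _) => [r| |]//= r0 fin e.
  rewrite /expect /Rintegral -e /= powR_mulrn// sqrtr_sqr ger0_norm//.
by move: fin; rewrite -e gt_eqF.
Qed.

Lemma csqint_Lnormy (M : R) :
  (Lnorm P +oo (fun x => (cmod (f x))%:E) <= M%:E)%E -> csqint P f.
Proof.
rewrite unlock /Lnorm ifT; last first.
  exact: (eq_rect_r (fun y => (0 < y)%E) lte01 (probability_setT P)).
move=> /ess_sup_inf.ess_supP fM; apply: rint_csqint; apply/integrableP; split.
  by apply/measurable_EFinP; exact: measurable_sqr_cmod.
apply: (@le_lt_trans _ _ (\int[P]_x ((M ^+ 2)%:E))%E); last first.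
  rewrite integral_cst//; apply: lte_mul_pinfty; rewrite ?lee_fin ?sqr_ge0//.
  exact: le_lt_trans (probability_le1 P measurableT) (ltry 1).
apply: ae_ge0_le_integral => //.
- by apply/measurable_EFinP; apply: measurableT_comp => //; exact: measurable_sqr_cmod.
- by move=> x _; rewrite lee_fin sqr_ge0.
- apply: filterS fM => x /= fM _; rewrite lee_fin ger0_norm ?sqr_ge0//.
  rewrite lee_fin ger0_norm ?cmod_ge0// in fM.
  by rewrite ler_pXn2r// nnegrE ?cmod_ge0// (le_trans (cmod_ge0 (f x))).
Qed.

End MeasurableParts.

Opaque expect.

Section EpsIso.
Variable R : realType.

Lemma eps_iso_empty (G1 G2 : groupType) (e : R) (f1 : G1 -> cplx R) (f2 : G2 -> cplx R) :
  (forall g, cmod (f1 g) <= e) -> (forall g, cmod (f2 g) <= e) -> eps_iso e f1 f2.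
Proof.
move=> h1 h2; exists set0, set0, (fun=> 1%g); split => //.
- split; first by split => // x y; rewrite in_set0.
  move=> g a; case: (`|_|)%N g a => [|n] g a; first by rewrite !big_ord0.
  by move=> /(_ ord0).
- by move=> g; rewrite /supp_eps /= ltNge h1.
- by move=> g; rewrite /supp_eps /= ltNge h2.
Qed.

Lemma eps_iso_lt (G1 G2 : groupType) (c r : R) (f1 : G1 -> cplx R) (f2 : G2 -> cplx R) :
  (forall g, cmod (f1 g) <= c) -> (forall g, cmod (f2 g) <= c) ->
  0 < r -> 0 <= hat_dist f1 f2 /\
  exists e : R, [/\ 0 < e, e < hat_dist f1 f2 + r & eps_iso e f1 f2].
Proof.
move=> h1 h2 r0; set Z := [set e : R | 0 < e /\ eps_iso e f1 f2].
have c1 : 0 < `|c| + 1 by rewrite ltr_wpDl.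
have Zn : Z !=set0.
  exists (`|c| + 1); split => //; apply: eps_iso_empty => g.
    by rewrite (le_trans (h1 g))// (le_trans (ler_norm c))// lerDl.
  by rewrite (le_trans (h2 g))// (le_trans (ler_norm c))// lerDl.
have Zl : lbound Z 0 by move=> e [/ltW].
split; first exact: lb_le_inf.
have [|e [e0 ei] er] := @inf_adherent _ Z r r0; first by split => //; exists 0.
by exists e.
Qed.

Lemma zpowg_sign (G : groupType) (g : G) (b : bool) :
  zpowg g (if b then 1 else -1) = if b then g else (g^-1)%g.
Proof. by case: b; rewrite /zpowg /= ?expg1. Qed.

(* Relations of any length below [1 / e] are preserved: pad them with zero exponents. *)
Lemma partial_iso_word (G1 G2 : groupType) (I : finType) (e : R) (S1 : set G1) (S2 : set G2)
    (phi : G1 -> G2) (psi : I -> G1) (s : seq (I * bool)) :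
  partial_iso `|Num.ceil (1 / e)|%N S1 S2 phi -> 0 < e -> (size s)%:R * e <= 1 ->
  (forall i, S1 (psi i)) ->
  (\prod_(l <- s) (if l.2 then psi l.1 else (psi l.1)^-1) = 1)%g <->
  (\prod_(l <- s) (if l.2 then phi (psi l.1) else (phi (psi l.1))^-1) = 1)%g.
Proof.
case: s => [|l0 s0]; first by rewrite !big_nil.
set s := l0 :: s0; move=> [_ rel] e0 se Spsi.
set w := `|Num.ceil (1 / e)|%N in rel.
have sw : (size s <= w)%N.
  rewrite -(ler_nat R) /w natr_absz ger0_norm; last first.
    by rewrite ceil_ge0// (lt_le_trans (ltrN10 R))// divr_ge0// ltW.
  by apply: le_trans (ceil_ge _); rewrite ler_pdivlMr.
pose g (k : 'I_w) := psi (nth l0 s k).1.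
pose a (k : 'I_w) : int := if (k < size s)%N then (if (nth l0 s k).2 then 1 else -1) else 0.
have pad (G : groupType) (q : I -> G) :
    (\prod_(k < w) zpowg (q (nth l0 s k).1) (a k) =
     \prod_(l <- s) (if l.2 then q l.1 else (q l.1)^-1))%g.
  rewrite (big_nth l0) -(big_mkord xpredT (fun k => zpowg (q (nth l0 s k).1)
    (if (k < size s)%N then (if (nth l0 s k).2 then 1 else -1) else 0))).
  rewrite (@big_cat_nat _ _ _ (size s))//=.
  rewrite [X in (_ * X)%g]big_nat_cond [X in (_ * X)%g]big1 ?mulg1; last first.
    by move=> k; rewrite andbT => /andP[sk _]; rewrite ltnNge sk.
  rewrite big_nat_cond [RHS]big_nat_cond; apply: eq_bigr => k.
  by rewrite andbT /= => ->; rewrite zpowg_sign.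
have := rel g a; rewrite (pad _ psi) (pad _ (fun i => phi (psi i))); apply.
- by move=> k; exact: Spsi.
- by move=> k; rewrite /a; case: ifP => _ //; case: (nth _ _ _).2.
Qed.

End EpsIso.

Section Modulus.
Variable R : realType.

Lemma cmodD (z w : cplx R) : cmod (z + w) <= cmod z + cmod w.
Proof. by have := ler_normD z w; rewrite !normcE -rmorphD lecR. Qed.

Lemma cvg_conj (u : nat -> cplx R) (l : cplx R) :
  u i @[i --> \oo] --> l -> (u i)^* @[i --> \oo] --> l^*.
Proof.
move=> ul.
have -> : (fun i => (u i)^*) = (fun i => Complex (complex.Re (u i)) (- complex.Im (u i)) : cplx R).
  by apply/funext => i; case: (u i).
have -> : l^* = Complex (complex.Re l) (- complex.Im l) by case: (l).
apply: cvg_Complex.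
  by apply: (cvg_comp _ _ ul); exact: continuous_Re.
by apply: cvgN; apply: (cvg_comp _ _ ul); exact: continuous_Im.
Qed.

Lemma quadratic_modulus (h : cplx R -> R) (H d K : R) : continuous h ->
  (forall z, `|h z| <= H) -> 0 < d ->
  exists2 C : R, 0 <= C & forall z w, cmod z <= K -> `|h z - h w| <= d + C * cmod (z - w) ^+ 2.
Proof.
move=> ch hH d0.
have H0 : 0 <= H by apply: le_trans (hH 0).
pose sq : set (R * R) := `[- K, K]%classic `*` `[- K, K]%classic.
pose j (p : R * R) : cplx R := Complex p.1 p.2.
have cj : continuous j.
  by apply: continuous_Complex => p; [exact: cvg_fst|exact: cvg_snd].
have kj : compact (j @` sq).
  apply: continuous_compact; first exact: continuous_subspaceT.
  by apply: compact_setX; exact: segment_compact.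
have [eta eta0 etaP] : exists2 eta : R, 0 < eta & forall z w, cmod z <= K ->
    cmod (z - w) < eta -> `|h z - h w| <= d.
  have near0 : \forall eta \near 0^'+, (j @` sq) `<=`
      (fun z => forall w, cmod (z - w) < eta -> `|h z - h w| <= d).
    apply: (iffLR (compact_near_coveringP _) kj).
    move=> z _; have d2 : 0 < d / 2 by exact: divr_gt0.
    have := iffLR (@cvgrPdist_lt R R _ (nbhs z) (nbhs_filter z) _ _) (ch z) _ d2.
    move=> /(iffLR (@nbhs_ballP _ (cplx R) _ _))[[r r'] /=].
    rewrite ltcE /= => /andP[/eqP -> r0] rP.
    have r2 : 0 < r / 2 by exact: divr_gt0.
    exists (ball z (r / 2)%:C%C, [set eta | eta < r / 2]).
      split => /=; first by apply: nbhsx_ballx; rewrite ltcR.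
      exact: nbhs_right_lt.
    move=> [z' eta] /= [zz' er] w zw.
    have b1 : ball z (Complex r 0) z'.
      apply: lt_trans zz' _; rewrite ltcR; lra.
    have b2 : ball z (Complex r 0) w.
      rewrite /ball /= normcE ltcR.
      rewrite -[z - w](subrKA z'); apply: le_lt_trans (cmodD _ _) _.
      have := lt_trans zw er.
      by move: zz'; rewrite /ball /= normcE ltcR; lra.
    have := rP _ b1; have := rP _ b2; rewrite !ltr_norml ler_norml => /andP[? ?] /andP[? ?].
    apply/andP; split; lra.
  have [eta [etaP eta0]] := filter_ex (filterI near0 (nbhs_right_gt 0)).
  exists eta => // z w zK; apply: etaP.
  exists (complex.Re z, complex.Im z); last by case: (z).
  by split; rewrite /= in_itv /= -ler_norml;
    [exact: le_trans (le_Re_cmod z) zK|exact: le_trans (le_Im_cmod z) zK].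
have C0 : 0 <= 2 * H / eta ^+ 2 by apply: divr_ge0; [exact: mulr_ge0|exact: sqr_ge0].
exists (2 * H / eta ^+ 2) => //.
move=> z w zK; have [zw|zw] := ltP (cmod (z - w)) eta.
  by apply: le_trans (etaP z w zK zw) _; rewrite lerDl mulr_ge0 ?sqr_ge0.
apply: (@le_trans _ _ (2 * H)).
  apply: le_trans (ler_normB _ _) _; have := hH z; have := hH w; lra.
apply: (@le_trans _ _ (2 * H / eta ^+ 2 * cmod (z - w) ^+ 2)); last by rewrite lerDr ltW.
rewrite mulrAC ler_pdivlMr ?exprn_gt0// ler_wpM2l ?mulr_ge0//.
by rewrite ler_pXn2r// nnegrE ?cmod_ge0// ltW.
Qed.

End Modulus.

(** * Weak convergence of trigonometric polynomials *)

Section Walk.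
Variable R : realType.

(* [walk x y n g s t] is the expectation of [g (s + X) (t + Y)] for independent
   binomial variables [X], [Y] of parameters [(n, x)], [(n, y)]; it is a
   polynomial in [x] and [y]. *)
Fixpoint walk (x y : R) (n : nat) (g : nat -> nat -> R) (s t : nat) : R :=
  if n is m.+1 then
    x * (y * walk x y m g s.+1 t.+1 + (1 - y) * walk x y m g s.+1 t) +
    (1 - x) * (y * walk x y m g s t.+1 + (1 - y) * walk x y m g s t)
  else g s t.

Lemma walk_dist (x y c d K m p : R) n (g : nat -> nat -> R) s t :
  0 <= x <= 1 -> 0 <= y <= 1 ->
  (forall s t, `|c - g s t| <= d + K * ((s%:R - m) ^+ 2 + (t%:R - p) ^+ 2)) ->
  `|c - walk x y n g s t| <= d + K * ((s%:R + n%:R * x - m) ^+ 2 +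
    (t%:R + n%:R * y - p) ^+ 2 + n%:R * (x * (1 - x) + y * (1 - y))).
Proof.
move=> /andP[x0 x1] /andP[y0 y1] hg.
elim: n s t => [|n ih] s t; first by rewrite /= !mul0r !addr0; exact: hg.
have x1' : 0 <= 1 - x by rewrite subr_ge0.
have y1' : 0 <= 1 - y by rewrite subr_ge0.
rewrite /=; set a11 := walk _ _ _ _ _ _; set a10 := walk _ _ _ _ _ _.
set a01 := walk _ _ _ _ _ _; set a00 := walk _ _ _ _ _ _.
have h11 := ih s.+1 t.+1; have h10 := ih s.+1 t; have h01 := ih s t.+1; have h00 := ih s t.
rewrite -/a11 in h11; rewrite -/a10 in h10; rewrite -/a01 in h01; rewrite -/a00 in h00.
have -> : c - (x * (y * a11 + (1 - y) * a10) + (1 - x) * (y * a01 + (1 - y) * a00)) =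
  x * y * (c - a11) + x * (1 - y) * (c - a10) +
  (1 - x) * y * (c - a01) + (1 - x) * (1 - y) * (c - a00) by ring.
apply: le_trans (_ : x * y * `|c - a11| + x * (1 - y) * `|c - a10| +
  (1 - x) * y * `|c - a01| + (1 - x) * (1 - y) * `|c - a00| <= _).
  apply: le_trans (ler_normD _ _) _; apply: lerD; last by rewrite normrM ger0_norm// mulr_ge0.
  apply: le_trans (ler_normD _ _) _; apply: lerD; last by rewrite normrM ger0_norm// mulr_ge0.
  apply: le_trans (ler_normD _ _) _; apply: lerD; by rewrite normrM ger0_norm// mulr_ge0.
apply: le_trans (lerD (lerD (lerD (ler_wpM2l _ h11) (ler_wpM2l _ h10))
  (ler_wpM2l _ h01)) (ler_wpM2l _ h00)) _; rewrite ?mulr_ge0//.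
rewrite le_eqVlt; apply/orP; left; apply/eqP.
rewrite -[in s.+1%:R]addn1 -[in t.+1%:R]addn1 -[in n.+1%:R]addn1 !natrD; ring.
Qed.

End Walk.

Section TestFamilies.
Variable R : realType.
Variables (A_ : nat -> compactAbelianGroupType) (A : compactAbelianGroupType).
Variables (mu_ : forall i, probability (borel (A_ i)) R) (mu : probability (borel A) R).
Hypotheses (haar_ : forall i, is_haar (mu_ i)) (haar : is_haar mu).
Variables (I : finType) (psi : forall i, I -> dual R (A_ i)) (chi : I -> dual R A).
Hypothesis relations : forall s : seq (I * bool), \forall i \near \oo,
  (\prod_(l <- s) (if l.2 then psi i l.1 else (psi i l.1)^-1) = 1)%g <->
  (\prod_(l <- s) (if l.2 then chi l.1 else (chi l.1)^-1) = 1)%g.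

Definition letter (B : compactAbelianGroupType) (eta : I -> dual R B) (l : I * bool) : dual R B :=
  (if l.2 then eta l.1 else (eta l.1)^-1)%g.

Definition word (B : compactAbelianGroupType) (eta : I -> dual R B) (s : seq (I * bool)) (x : B) : cplx R :=
  \prod_(l <- s) letter eta l x.

Lemma wordE (B : compactAbelianGroupType) (eta : I -> dual R B) s x :
  word eta s x = (\prod_(l <- s) letter eta l)%g x.
Proof. by rewrite /word; elim/big_rec2: _ => // l y z _ ->. Qed.

Lemma cbmeasM (B : compactAbelianGroupType) (u v : B -> cplx R) :
  cbmeas (u : borel B -> cplx R) -> cbmeas (v : borel B -> cplx R) ->
  cbmeas ((fun x => u x * v x) : borel B -> cplx R).
Proof.
move=> [u1 u2] [v1 v2]; split.
  by under eq_fun do rewrite ReM; apply: bmeasB; exact: bmeasM.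
by under eq_fun do rewrite ImM; apply: bmeasD; exact: bmeasM.
Qed.

Lemma cbmeas_wordM (B : compactAbelianGroupType) (eta : I -> dual R B) s (u : B -> cplx R) :
  cbmeas (u : borel B -> cplx R) ->
  cbmeas ((fun x => word eta s x * u x) : borel B -> cplx R).
Proof.
move=> bu; apply: cbmeasM => //.
have -> : word eta s = (\prod_(l <- s) letter eta l)%g :> (B -> cplx R).
  by apply/funext => x; exact: wordE.
exact: cbmeas_dual.
Qed.

(* Quantifying over all words makes these families stable under multiplication
   by the characters [psi i] and their inverses. *)
Definition test_family (Q_ : forall i, A_ i -> cplx R) (Q : A -> cplx R) : Prop :=
  [/\ forall i, cbmeas (Q_ i : borel (A_ i) -> cplx R), cbmeas (Q : borel A -> cplx R) &
   forall s, cintegral (mu_ i) (fun x => word (@psi i) s x * Q_ i x) @[i --> \oo] -->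
     cintegral mu (fun x => word chi s x * Q x)].

Lemma test_family1 : test_family (fun i => fun=> 1) (fun=> 1).
Proof.
split; [by move=> i; split; exact: bmeas_cst|by split; exact: bmeas_cst|move=> s].
apply: cvg_near_cst.
apply: filterS (relations s) => i rel.
have cw (B : compactAbelianGroupType) (nu : probability (borel B) R) (eta : I -> dual R B) : is_haar nu ->
    cintegral nu (fun x => word eta s x * 1) =
    ((\prod_(l <- s) letter eta l)%g == dual_one R B)%:R.
  move=> hnu; rewrite -(cint_dual hnu); apply: eq_cint => x.
  by rewrite mulr1 wordE.
rewrite !cw//; congr ((nat_of_bool _)%:R).
by apply/eqP/eqP => /rel.
Qed.

Lemma test_familyD Q_ Q S_ S : test_family Q_ Q -> test_family S_ S ->
  test_family (fun i x => Q_ i x + S_ i x) (fun x => Q x + S x).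
Proof.
move=> [bQ_ bQ cQ] [bS_ bS cS].
have bD (B : compactAbelianGroupType) (u v : B -> cplx R) : cbmeas (u : borel B -> cplx R) ->
    cbmeas (v : borel B -> cplx R) -> cbmeas ((fun x => u x + v x) : borel B -> cplx R).
  move=> [u1 u2] [v1 v2]; split.
    by under eq_fun do rewrite ReD; exact: bmeasD.
  by under eq_fun do rewrite ImD; exact: bmeasD.
split; [by move=> i; exact: bD|exact: bD|move=> s].
have e (B : compactAbelianGroupType) (nu : probability (borel B) R) (eta : I -> dual R B)
    (u v : B -> cplx R) : cbmeas (u : borel B -> cplx R) -> cbmeas (v : borel B -> cplx R) ->
    cintegral nu (fun x => word eta s x * (u x + v x)) =
    cintegral nu (fun x => word eta s x * u x) + cintegral nu (fun x => word eta s x * v x).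
  move=> bu bv; rewrite -cintD; first by apply: eq_cint => x; rewrite mulrDr.
    by apply: cbmeas_crint; exact: cbmeas_wordM.
  by apply: cbmeas_crint; exact: cbmeas_wordM.
rewrite e//; under eq_fun do rewrite e//.
by apply: cvgD; [exact: cQ|exact: cS].
Qed.

Lemma test_family_ext Q_ Q (S_ : forall i, A_ i -> cplx R) (S : A -> cplx R) :
  (forall i x, S_ i x = Q_ i x) -> (forall x, S x = Q x) ->
  test_family Q_ Q -> test_family S_ S.
Proof.
move=> eQ_ eQ [bQ_ bQ cQ].
have {}eQ_ i : S_ i = Q_ i by apply/funext.
have -> : S = Q by apply/funext.
split; [by move=> i; rewrite eQ_|exact: bQ|move=> s].
have -> : (fun i => cintegral (mu_ i) (fun x => word (@psi i) s x * S_ i x)) =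
          (fun i => cintegral (mu_ i) (fun x => word (@psi i) s x * Q_ i x)).
  by apply/funext => i; rewrite eQ_.
exact: cQ.
Qed.

Lemma test_familyZ (z_ : nat -> cplx R) (z : cplx R) Q_ Q : z_ i @[i --> \oo] --> z ->
  test_family Q_ Q -> test_family (fun i x => z_ i * Q_ i x) (fun x => z * Q x).
Proof.
move=> zz [bQ_ bQ cQ].
have bZ (B : compactAbelianGroupType) c (u : B -> cplx R) : cbmeas (u : borel B -> cplx R) ->
    cbmeas ((fun x => c * u x) : borel B -> cplx R).
  by apply: cbmeasM; split; exact: bmeas_cst.
split; [by move=> i; exact: bZ|exact: bZ|move=> s].
have e (B : compactAbelianGroupType) (nu : probability (borel B) R) (eta : I -> dual R B)
    c (u : B -> cplx R) : cbmeas (u : borel B -> cplx R) ->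
    cintegral nu (fun x => word eta s x * (c * u x)) =
    c * cintegral nu (fun x => word eta s x * u x).
  move=> bu; rewrite -cintZ; first by apply: eq_cint => x; rewrite mulrCA.
  by apply: cbmeas_crint; exact: cbmeas_wordM.
rewrite (e _ mu chi z Q bQ).
have -> : (fun i => cintegral (mu_ i) (fun x => word (@psi i) s x * (z_ i * Q_ i x))) =
    (fun i => z_ i * cintegral (mu_ i) (fun x => word (@psi i) s x * Q_ i x)).
  by apply/funext => i; exact: e (bQ_ i).
exact: cvgM zz (cQ s).
Qed.

Lemma test_family_letter l Q_ Q : test_family Q_ Q ->
  test_family (fun i x => letter (@psi i) l x * Q_ i x) (fun x => letter chi l x * Q x).
Proof.
move=> [bQ_ bQ cQ]; split.
- by move=> i; apply: cbmeasM => //; exact: cbmeas_dual.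
- by apply: cbmeasM => //; exact: cbmeas_dual.
move=> s; have := cQ (l :: s).
have e (B : compactAbelianGroupType) (eta : I -> dual R B) (u : B -> cplx R) :
    (fun x => word eta (l :: s) x * u x) = (fun x => word eta s x * (letter eta l x * u x)).
  by apply/funext => x; rewrite /word big_cons mulrA [_ * \prod_(_ <- _) _]mulrC.
by rewrite e; under eq_fun do rewrite e.
Qed.

Lemma test_familyN Q_ Q : test_family Q_ Q ->
  test_family (fun i x => - Q_ i x) (fun x => - Q x).
Proof.
move=> tQ; apply: test_family_ext (test_familyZ (cvg_cst (-1 : cplx R)) tQ).
  by move=> i x; rewrite mulN1r.
by move=> x; rewrite mulN1r.
Qed.

Lemma test_family_sum (T : Type) (r : seq T) (Q_ : T -> forall i, A_ i -> cplx R)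
    (Q : T -> A -> cplx R) : (forall t, test_family (Q_ t) (Q t)) ->
  test_family (fun i x => \sum_(t <- r) Q_ t i x) (fun x => \sum_(t <- r) Q t x).
Proof.
move=> tQ; elim: r => [|t r ih].
  apply: test_family_ext (test_familyZ (cvg_cst (0 : cplx R)) test_family1).
    by move=> i x; rewrite big_nil mul0r.
  by move=> x; rewrite big_nil mul0r.
apply: test_family_ext (test_familyD (tQ t) ih).
  by move=> i x; rewrite big_cons.
by move=> x; rewrite big_cons.
Qed.

Definition trig (B : compactAbelianGroupType) (eta : I -> dual R B) (z : I -> cplx R) (x : B) : cplx R :=
  \sum_j z j * eta j x.

Lemma Re_trig (B : compactAbelianGroupType) (eta : I -> dual R B) (z : I -> cplx R) (x : B) (q : cplx R) :
  Complex (complex.Re (trig eta z x)) 0 * q =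
  \sum_j (Complex 2^-1 0 * z j * (letter eta (j, true) x * q) +
          Complex 2^-1 0 * (z j)^* * (letter eta (j, false) x * q)).
Proof.
transitivity (Complex 2^-1 0 * (trig eta z x + (trig eta z x)^*) * q).
  by congr (_ * q); apply: cplx_eq; rewrite !Cparts /=; field.
rewrite /trig rmorph_sum -big_split /= mulr_sumr mulr_suml; apply: eq_bigr => j _.
rewrite /letter /= -[eta j (- x)]/(dual_inv (eta j) x) dual_invE rmorphM /=; ring.
Qed.

Lemma test_family_Re (z_ : nat -> I -> cplx R) (z : I -> cplx R) Q_ Q :
  (forall j, z_ i j @[i --> \oo] --> z j) -> test_family Q_ Q ->
  test_family (fun i x => Complex (complex.Re (trig (@psi i) (z_ i) x)) 0 * Q_ i x)
    (fun x => Complex (complex.Re (trig chi z x)) 0 * Q x).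
Proof.
move=> zz tQ; apply: test_family_ext.
- by move=> i x; rewrite Re_trig.
- by move=> x; rewrite Re_trig.
apply: test_family_sum => j; apply: test_familyD; apply: test_familyZ;
  try exact: test_family_letter.
- by apply: cvgM; [exact: cvg_cst|exact: zz].
- by apply: cvgM; [exact: cvg_cst|apply: cvg_conj; exact: zz].
Qed.

Lemma test_family_walk (X_ Y_ : forall i, A_ i -> R) (X Y : A -> R) n g s t :
  (forall Q_ Q, test_family Q_ Q ->
    test_family (fun i x => Complex (X_ i x) 0 * Q_ i x) (fun x => Complex (X x) 0 * Q x)) ->
  (forall Q_ Q, test_family Q_ Q ->
    test_family (fun i x => Complex (Y_ i x) 0 * Q_ i x) (fun x => Complex (Y x) 0 * Q x)) ->
  test_family (fun i x => Complex (walk (X_ i x) (Y_ i x) n g s t) 0)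
    (fun x => Complex (walk (X x) (Y x) n g s t) 0).
Proof.
move=> tX tY; elim: n s t => [|n ih] s t.
  apply: test_family_ext (test_familyZ (cvg_cst (Complex (g s t) 0 : cplx R)) test_family1).
    by move=> i x /=; rewrite mulr1.
  by move=> x /=; rewrite mulr1.
have mix Q_ Q S_ S : test_family Q_ Q -> test_family S_ S ->
    test_family (fun i x => Complex (Y_ i x) 0 * Q_ i x + (S_ i x - Complex (Y_ i x) 0 * S_ i x))
      (fun x => Complex (Y x) 0 * Q x + (S x - Complex (Y x) 0 * S x)).
  move=> tQ tS.
  exact (test_familyD (tY _ _ tQ) (test_familyD tS (test_familyN (tY _ _ tS)))).
have t1 := mix _ _ _ _ (ih s.+1 t.+1) (ih s.+1 t).
have t0 := mix _ _ _ _ (ih s t.+1) (ih s t).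
apply: test_family_ext (test_familyD (tX _ _ t1) (test_familyD t0 (test_familyN (tX _ _ t0)))).
  by move=> i x; apply: cplx_eq; rewrite !Cparts /=; ring.
by move=> x; apply: cplx_eq; rewrite !Cparts /=; ring.
Qed.

Lemma Re_trigi (B : compactAbelianGroupType) (eta : I -> dual R B) (z : I -> cplx R) (x : B) :
  complex.Re (trig eta (fun j => Complex 0 (-1) * z j) x) = complex.Im (trig eta z x).
Proof.
have -> : trig eta (fun j => Complex 0 (-1) * z j) x = Complex 0 (-1) * trig eta z x.
  by rewrite /trig mulr_sumr; apply: eq_bigr => j _; rewrite mulrA.
by rewrite ReM /=; ring.
Qed.

Lemma continuous_trig (B : compactAbelianGroupType) (eta : I -> dual R B) (z : I -> cplx R) :
  continuous (trig eta z).
Proof.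
rewrite /trig; elim: (index_enum I) => [|j r ih].
  by under eq_fun do rewrite big_nil; move=> x; exact: cvg_cst.
under eq_fun do rewrite big_cons.
move=> x; apply: cvgD; last exact: ih.
by apply: cvgM; [exact: cvg_cst|exact: char_continuous].
Qed.

Lemma cmod_trig (B : compactAbelianGroupType) (eta : I -> dual R B) (z : I -> cplx R) (x : B) :
  cmod (trig eta z x) <= \sum_j cmod (z j).
Proof.
rewrite /trig; elim/big_rec2: _ => [|j a b _ ab]; first by rewrite /cmod normr0.
apply: le_trans (cmodD _ _) _; apply: lerD => //.
by rewrite {1}/cmod normrM char_mod mulr1.
Qed.

Theorem trig_weak_cvg (z_ : nat -> I -> cplx R) (z : I -> cplx R) (h : cplx R -> R) (H : R) :
  (forall j, z_ i j @[i --> \oo] --> z j) -> continuous h -> (forall w, `|h w| <= H) ->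
  expect (mu_ i) (fun x => h (trig (@psi i) (z_ i) x)) @[i --> \oo] -->
  expect mu (fun x => h (trig chi z x)).
Proof.
move=> zz ch hH; apply/cvgrPdist_le => e e0.
pose B := \sum_j (cmod (z j) + 1) + 1.
have B0 : 0 < B by rewrite ltr_wpDl// sumr_ge0// => j _; rewrite addr_ge0 ?cmod_ge0.
have zB : \sum_j cmod (z j) <= B.
  by rewrite /B big_split /= -addrA lerDl addr_ge0// sumr_ge0.
have z_B : \forall i \near \oo, \sum_j cmod (z_ i j) <= B.
  have : \forall i \near \oo, forall j, cmod (z_ i j) <= cmod (z j) + 1.
    apply: filter_forall => j.
    have /cvgrPdist_le/(_ 1 ltr01) : z_ i j @[i --> \oo] --> z j by [].
    apply: filterS => i; rewrite normcE -[1]/((1 : R)%:C%C) lecR => zi.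
    rewrite -[z_ i j](subrK (z j)); apply: le_trans (cmodD _ _) _.
    by rewrite addrC lerD2l -(opprB (z j)) /cmod normrN.
  apply: filterS => i zi; rewrite /B; apply: le_trans (_ : _ <= \sum_j (cmod (z j) + 1)) _.
    by apply: ler_sum => j _.
  by rewrite lerDl.
have e8 : 0 < e / 8 by exact: divr_gt0.
have [C C0 hC] := quadratic_modulus (2 * B) ch hH e8.
pose D := 2 * C * B ^+ 2 / (e / 8).
have CB (r : R) : 0 <= r -> 0 <= r * C * B ^+ 2.
  by move=> r0; apply: mulr_ge0; [exact: mulr_ge0|exact: sqr_ge0].
have D0 : 0 <= D by apply: divr_ge0; [exact: CB|exact: ltW].
pose N := (Num.truncn D).+1.
have ND : D <= N%:R by apply: ltW; exact: truncnS_gt.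
have NR : 0 < N%:R :> R by rewrite ltr0n.
pose g (s t : nat) := h (Complex (B * (2 * s%:R / N%:R - 1)) (B * (2 * t%:R / N%:R - 1))).
pose cX (p : cplx R) := (complex.Re p / B + 1) / 2.
pose cY (p : cplx R) := (complex.Im p / B + 1) / 2.
have hw p : cmod p <= B -> `|h p - walk (cX p) (cY p) N g 0 0| <= e / 4.
  move=> pB.
  have coord (q : R) : `|q| <= B -> 0 <= (q / B + 1) / 2 <= 1.
    rewrite ler_norml => /andP[q1 q2].
    have l1 : -1 <= q / B by rewrite ler_pdivlMr// mulN1r.
    have l2 : q / B <= 1 by rewrite ler_pdivrMr// mul1r.
    by apply/andP; split; lra.
  have X01 := coord _ (le_trans (le_Re_cmod p) pB).
  have Y01 := coord _ (le_trans (le_Im_cmod p) pB).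
  have hg s t : `|h p - g s t| <= e / 8 + 4 * C * B ^+ 2 / N%:R ^+ 2 *
      ((s%:R - N%:R * cX p) ^+ 2 + (t%:R - N%:R * cY p) ^+ 2).
    apply: le_trans (hC _ _ _) _; first by apply: le_trans pB _; lra.
    rewrite lerD2l sqr_cmod !Cparts /= le_eqVlt; apply/orP; left; apply/eqP.
    by rewrite /cX /cY; field; rewrite !gt_eqF.
  have := walk_dist N 0 0 X01 Y01 hg; rewrite !add0r !subrr expr0n !add0r => hw.
  apply: le_trans hw _.
  have xx (q : R) : q * (1 - q) <= 1 / 4.
    by have := sqr_ge0 (q - 1 / 2); rewrite expr2; lra.
  have E8 : 2 * C * B ^+ 2 = D * (e / 8) by rewrite /D divfK// gt_eqF.
  have K0 : 0 <= 4 * C * B ^+ 2 / N%:R ^+ 2 by apply: divr_ge0; [exact: CB|exact: sqr_ge0].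
  apply: (@le_trans _ _ (e / 8 + 4 * C * B ^+ 2 / N%:R ^+ 2 * (N%:R * (1 / 2)))).
    rewrite lerD2l ler_wpM2l// ler_wpM2l ?ler0n//.
    by apply: le_trans (lerD (xx _) (xx _)) _; lra.
  have -> : 4 * C * B ^+ 2 / N%:R ^+ 2 * (N%:R * (1 / 2)) = (2 * C * B ^+ 2) / N%:R.
    by field; rewrite gt_eqF.
  rewrite E8 mulrAC; have : D / N%:R <= 1 by rewrite ler_pdivrMr// mul1r.
  move: (D / N%:R) => r; nra.
have tX (Q_ : forall i, A_ i -> cplx R) (Q : A -> cplx R) : test_family Q_ Q ->
  test_family (fun i x => Complex (cX (trig (@psi i) (z_ i) x)) 0 * Q_ i x)
    (fun x => Complex (cX (trig chi z x)) 0 * Q x).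
  move=> tQ; apply: test_family_ext (test_familyD
    (test_familyZ (cvg_cst (Complex ((2 * B)^-1) 0 : cplx R)) (test_family_Re zz tQ))
    (test_familyZ (cvg_cst (Complex 2^-1 0 : cplx R)) tQ)).
    by move=> i x; apply: cplx_eq; rewrite !Cparts /= /cX; field; rewrite gt_eqF.
  by move=> x; apply: cplx_eq; rewrite !Cparts /= /cX; field; rewrite gt_eqF.
have zz' j : Complex 0 (-1) * z_ i j @[i --> \oo] --> (Complex 0 (-1) * z j : cplx R).
  by apply: cvgM; [exact: cvg_cst|exact: zz].
have tY (Q_ : forall i, A_ i -> cplx R) (Q : A -> cplx R) : test_family Q_ Q ->
  test_family (fun i x => Complex (cY (trig (@psi i) (z_ i) x)) 0 * Q_ i x)
    (fun x => Complex (cY (trig chi z x)) 0 * Q x).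
  move=> tQ; apply: test_family_ext (test_familyD
    (test_familyZ (cvg_cst (Complex ((2 * B)^-1) 0 : cplx R)) (test_family_Re zz' tQ))
    (test_familyZ (cvg_cst (Complex 2^-1 0 : cplx R)) tQ)).
    by move=> i x; rewrite Re_trigi; apply: cplx_eq; rewrite !Cparts /= /cY; field; rewrite gt_eqF.
  by move=> x; rewrite Re_trigi; apply: cplx_eq; rewrite !Cparts /= /cY; field; rewrite gt_eqF.
have [bw_ bw cw] := test_family_walk N g 0 0 tX tY.
have {cw} : expect (mu_ i) (fun x => walk (cX (trig (@psi i) (z_ i) x)) (cY (trig (@psi i) (z_ i) x)) N g 0 0)
    @[i --> \oo] --> expect mu (fun x => walk (cX (trig chi z x)) (cY (trig chi z x)) N g 0 0).
  have E (D' : compactAbelianGroupType) (nu : probability (borel D') R) (eta : I -> dual R D') (q : D' -> R) :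
      complex.Re (cintegral nu (fun x => word eta [::] x * Complex (q x) 0)) = expect nu q.
    by rewrite cintE /=; apply: eq_expect => x; rewrite /word big_nil mul1r.
  rewrite -(E _ mu chi).
  have -> : (fun i => expect (mu_ i) (fun x =>
      walk (cX (trig (@psi i) (z_ i) x)) (cY (trig (@psi i) (z_ i) x)) N g 0 0)) =
    (fun w : cplx R => complex.Re w) \o (fun i => cintegral (mu_ i) (fun x => word (@psi i) [::] x *
      Complex (walk (cX (trig (@psi i) (z_ i) x)) (cY (trig (@psi i) (z_ i) x)) N g 0 0) 0)).
    by apply/funext => i; rewrite /= -[LHS](E _ _ (@psi i)).
  by apply: (cvg_comp _ _ (cw [::])); exact: continuous_Re.
have e4 : 0 < e / 4 by exact: divr_gt0.
move=> /cvgrPdist_le/(_ _ e4) cw.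
have step (D' : compactAbelianGroupType) (nu : probability (borel D') R) (eta : I -> dual R D') c :
    \sum_j cmod (c j) <= B ->
    bmeas ((fun x => walk (cX (trig eta c x)) (cY (trig eta c x)) N g 0 0) : borel D' -> R) ->
    `|expect nu (fun x => h (trig eta c x)) -
      expect nu (fun x => walk (cX (trig eta c x)) (cY (trig eta c x)) N g 0 0)| <= e / 4.
  move=> cB bwalk.
  have bh : bmeas ((fun x => h (trig eta c x)) : borel D' -> R).
    apply: bmeas_continuous => x; apply: continuous_comp; last exact: ch.
    exact: continuous_trig.
  rewrite -expectB; [|exact: bmeas_rint..].
  apply: le_trans (le_norm_expect _) _; first by apply: bmeas_rint; exact: bmeasB.
  rewrite -[leRHS](expect_cst nu); apply: le_expect.
  - by apply: bmeas_rint; apply: bmeas_norm; exact: bmeasB.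
  - by apply: bmeas_rint; exact: bmeas_cst.
  - by move=> x; apply: hw; apply: le_trans (cmod_trig _ _ _) cB.
have s0 := step _ mu chi z zB bw.1.
move: cw z_B; apply: filterS2 => i cwi ziB.
have si := step _ (mu_ i) (@psi i) (z_ i) ziB (bw_ i).1.
move: s0 si cwi; rewrite !ler_norml => /andP[? ?] /andP[? ?] /andP[? ?].
apply/andP; split; lra.
Qed.

End TestFamilies.

(** * Comparison with truncated Fourier series *)

Transparent expect.
Opaque cintegral.

Section Comparison.
Variables (R : realType) (h : cplx R -> R) (H : R).
Hypotheses (ch : continuous h) (hH : forall z, `|h z| <= H).

Lemma bmeas_comp d (T : measurableType d) (f : {mfun T >-> borel (cplx R)}) :
  bmeas (fun x => h (f x)).
Proof.
split; last by exists H.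
have m := continuous_borel_real (T := cplx R) ch.
have mf : measurable_fun setT (f : T -> borel (cplx R)) by exact: measurable_funP.
exact: (measurableT_comp m mf).
Qed.

Lemma Rintegral_distribution d (T : measurableType d) (P : probability T R)
    (f : {mfun T >-> borel (cplx R)}) :
  \int[distribution P f]_z h z = expect P (fun x => h (f x)).
Proof.
rewrite /expect /Rintegral; congr fine.
rewrite integral_pushforward//.
  by apply/measurable_EFinP; exact: (continuous_borel_real (T := cplx R) ch).
by have := bmeas_rint P (bmeas_comp f).
Qed.

Opaque expect.

Lemma modulus_tail (d K : R) : 0 < d -> 0 < K ->
  exists2 C : R, 0 <= C & forall z w,
    `|h z - h w| <= d + C * cmod (z - w) ^+ 2 + 2 * H / K ^+ 2 * cmod z ^+ 2.
Proof.
move=> d0 K0; have H0 : 0 <= H by apply: le_trans (hH 0).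
have k0 : 0 <= 2 * H / K ^+ 2 by apply: divr_ge0; [exact: mulr_ge0|exact: sqr_ge0].
have [C C0 hC] := quadratic_modulus K ch hH d0.
exists C => // z w; have [zK|Kz] := leP (cmod z) K.
  by apply: le_trans (hC z w zK) _; rewrite lerDl; apply: mulr_ge0 => //; exact: sqr_ge0.
apply: (@le_trans _ _ (2 * H)).
  by apply: le_trans (ler_normB _ _) _; have := hH z; have := hH w; lra.
apply: (@le_trans _ _ (2 * H / K ^+ 2 * cmod z ^+ 2)).
  rewrite mulrAC ler_pdivlMr ?exprn_gt0// ler_wpM2l ?mulr_ge0//.
  by rewrite ler_pXn2r// ?nnegrE ?cmod_ge0// ltW.
by rewrite lerDr addr_ge0 ?(ltW d0)//; apply: mulr_ge0 => //; exact: sqr_ge0.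
Qed.

Lemma expect_comparison d (T : measurableType d) (P : probability T R) (f g : T -> cplx R)
    (a C k : R) : csqint P f -> csqint P g ->
  bmeas (fun x => h (f x)) -> bmeas (fun x => h (g x)) ->
  (forall z w, `|h z - h w| <= a + C * cmod (z - w) ^+ 2 + k * cmod z ^+ 2) ->
  `|expect P (fun x => h (f x)) - expect P (fun x => h (g x))| <=
   a + C * sqnorm P (fun x => f x - g x) + k * sqnorm P f.
Proof.
move=> sf sg bf bg le_h.
have r1 := rint_sqnorm (csqintB sf sg); have r2 := rint_sqnorm sf.
rewrite -expectB; [|exact: bmeas_rint..].
apply: le_trans (le_norm_expect _) _; first by apply: bmeas_rint; exact: bmeasB.
rewrite /sqnorm -!expectZ// -[X in _ <= X + _ + _](expect_cst P) -!expectD; last 4 first.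
- by apply: rintD; [apply: bmeas_rint; exact: bmeas_cst|exact: rintZ].
- exact: rintZ.
- by apply: bmeas_rint; exact: bmeas_cst.
- exact: rintZ.
apply: le_expect => //.
- by apply: bmeas_rint; apply: bmeas_norm; exact: bmeasB.
- by apply: rintD; [apply: rintD; [apply: bmeas_rint; exact: bmeas_cst|exact: rintZ]|exact: rintZ].
Qed.

End Comparison.

Lemma eps_iso_lift (R : realType) (G1 G2 : groupType) (e : R) (f1 : G1 -> cplx R)
    (f2 : G2 -> cplx R) (I : finType) (chi : I -> G2) :
  0 < e -> eps_iso e f1 f2 -> (forall j, e < cmod (f2 (chi j))) ->
  exists psi : I -> G1, (forall j, cmod (f1 (psi j) - f2 (chi j)) <= e) /\
    forall s : seq (I * bool), (size s)%:R * e <= 1 ->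
    (\prod_(l <- s) (if l.2 then psi l.1 else (psi l.1)^-1) = 1)%g <->
    (\prod_(l <- s) (if l.2 then chi l.1 else (chi l.1)^-1) = 1)%g.
Proof.
move=> e0 [S1 [S2 [phi [piso _ sub2 close]]]] big.
have /choice[psi psiP] j : exists g, S1 g /\ phi g = chi j.
  by have [[_ _ /(_ (chi j) (sub2 _ (big j)))[g S1g <-]] _] := piso; exists g.
exists psi; split; first by move=> j; rewrite -(psiP j).2; apply: close; exact: (psiP j).1.
move=> s se; have := partial_iso_word (psi := psi) piso e0 se (fun j => (psiP j).1).
have e' : (\prod_(l <- s) (if l.2 then phi (psi l.1) else (phi (psi l.1))^-1) =
   \prod_(l <- s) (if l.2 then chi l.1 else (chi l.1)^-1))%g.
  by apply: eq_bigr => l _; rewrite (psiP l.1).2.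
by rewrite e'.
Qed.

Lemma sqnorm_sub_trig (R : realType) (A : compactAbelianGroupType)
    (mu : probability (borel A) R) (I : finType) (psi : I -> dual R A) (f : A -> cplx R) :
  is_haar mu -> csqint mu f -> injective psi ->
  sqnorm mu (fun x => f x - trig psi (fun j => ft mu f (psi j)) x) =
  sqnorm mu f - \sum_j cmod (ft mu f (psi j)) ^+ 2.
Proof.
move=> haar sf ipsi; have := @pythagoras _ _ _ haar f (map psi (enum I)) (ft mu f) sf.
rewrite map_inj_uniq// enum_uniq => /(_ isT).
have -> : \sum_(chi <- map psi (enum I)) cmod (ft mu f chi - ft mu f chi) ^+ 2 = 0.
  by apply: big1 => chi _; rewrite subrr /cmod normr0 expr0n.
rewrite addr0 [X in _ - X]big_map big_enum /= => <-; congr expect; apply/funext => x.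
by rewrite big_map big_enum.
Qed.

Lemma cmod_ft_le (R : realType) (A : compactAbelianGroupType)
    (mu : probability (borel A) R) (f : A -> cplx R) (chi : dual R A) :
  is_haar mu -> csqint mu f -> cmod (ft mu f chi) <= sqnorm mu f + 1.
Proof.
move=> haar sf; have := @bessel _ _ _ haar f [:: chi] sf isT.
rewrite big_seq1; have := sqr_ge0 (cmod (ft mu f chi) - 1 / 2).
move: (cmod _) (sqnorm _ _) => u v; rewrite !expr2; lra.
Qed.

Theorem theorem3p4 (R : realType)
    (A_ : nat -> compactAbelianGroupType) (A : compactAbelianGroupType)
    (mu_ : forall i, probability (borel (A_ i)) R)
    (mu : probability (borel A) R)
    (f_ : forall i, cmfun (A_ i) R) (f : cmfun A R) :
  (forall i, is_haar (mu_ i)) -> is_haar mu ->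
  (exists M : R, forall i, (cLnorm (mu_ i) +oo (f_ i) <= M%:E)%E) ->
  (cLnorm mu 2%:E f < +oo)%E ->
  dist_d' (mu_ i) mu (f_ i) f @[i --> \oo] --> (0 : R) ->
  weak_cvg (fun i => distribution (mu_ i) (f_ i)) (distribution mu f).
Proof.
move=> haar_ haar [M fM] f2 df h ch [H hH].
have sf : csqint mu f by exact: csqint_Lnorm2.
have sf_ i : csqint (mu_ i) (f_ i) by exact: csqint_Lnormy (fM i).
set s := sqnorm mu f; pose s_ i := sqnorm (mu_ i) (f_ i).
have dist_ge0_eps i : 0 <= dist_d (mu_ i) mu (f_ i) f /\ exists e : R,
    [/\ 0 < e, e < dist_d (mu_ i) mu (f_ i) f + i.+1%:R^-1 &
      eps_iso e (fourier (mu_ i) (f_ i)) (fourier mu f)].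
  apply: (@eps_iso_lt _ _ _ (Num.max (s_ i + 1) (s + 1))) => [chi|chi|].
  - by rewrite le_max (cmod_ft_le _ (haar_ i) (sf_ i)).
  - by rewrite le_max (cmod_ft_le _ haar sf) orbT.
  - by rewrite invr_gt0.
have dist0 i := (dist_ge0_eps i).1.
have /choice[eps epsP] i := (dist_ge0_eps i).2.
have d0 : dist_d (mu_ i) mu (f_ i) f @[i --> \oo] --> (0 : R).
  apply: (squeeze_cvgr _ (cvg_cst 0) df); apply: nearW => i.
  by rewrite dist0 /= lerDl.
have eps0 : eps i @[i --> \oo] --> (0 : R).
  have dh : dist_d (mu_ i) mu (f_ i) f + i.+1%:R^-1 @[i --> \oo] --> (0 : R).
    by rewrite -[0]addr0; apply: cvgD => //; exact: cvg_harmonic.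
  apply: (squeeze_cvgr _ (cvg_cst 0) dh); apply: nearW => i.
  by have [/ltW -> /ltW -> _] := epsP i.
have ss : s_ i @[i --> \oo] --> s.
  have n0 : Num.sqrt (s_ i) - Num.sqrt s @[i --> \oo] --> (0 : R).
    apply/cvgr0Pnorm_le => e e0; have /cvgr0Pnorm_le/(_ _ e0) := df.
    apply: filterS => i; apply: le_trans.
    rewrite /dist_d' /cLnorm !Lnorm2_sqnorm// [leRHS]ger0_norm ?lerDr//.
    by rewrite addr_ge0.
  have n1 : Num.sqrt (s_ i) @[i --> \oo] --> Num.sqrt s.
    have -> : (fun i => Num.sqrt (s_ i)) =
        (fun i => Num.sqrt (s_ i) - Num.sqrt s + Num.sqrt s).
      by apply/funext => i; rewrite subrK.
    by rewrite -[X in _ --> X]add0r; apply: cvgD => //; exact: cvg_cst.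
  have -> : s_ = (fun i => Num.sqrt (s_ i) * Num.sqrt (s_ i)).
    by apply/funext => i; rewrite -expr2 sqr_sqrtr ?sqnorm_ge0.
  by rewrite -[s](sqr_sqrtr (sqnorm_ge0 mu f)) expr2; exact: cvgM.
have -> : (fun i => \int[distribution (mu_ i) (f_ i)]_z h z) =
    (fun i => expect (mu_ i) (fun x => h (f_ i x))).
  by apply/funext => i; rewrite (Rintegral_distribution ch hH).
rewrite (Rintegral_distribution ch hH).
apply/cvgrPdist_le => e e0.
have e16 : 0 < e / 16 by exact: divr_gt0.
have H0 : 0 <= H by apply: le_trans (hH 0).
have s0 : 0 <= s by exact: sqnorm_ge0.
pose K := 1 + 32 * H * (s + 1) / e.
have K1 : 1 <= K by rewrite lerDl divr_ge0 ?(ltW e0)// !mulr_ge0// addr_ge0.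
have K0 : 0 < K by exact: lt_le_trans K1.
pose k := 2 * H / K ^+ 2.
have k0 : 0 <= k by apply: divr_ge0; [exact: mulr_ge0|exact: sqr_ge0].
have ks : k * (s + 1) <= e / 16.
  rewrite /k mulrAC ler_pdivrMr ?exprn_gt0//.
  have eK : e * K = e + 32 * H * (s + 1) by rewrite /K; field; rewrite gt_eqF.
  have : e * K <= e * K ^+ 2 by rewrite ler_wpM2l ?(ltW e0)// expr2 ler_peMl// ltW.
  by rewrite eK; move: (K ^+ 2) => K2; nra.
have [C C0 hC] := modulus_tail ch hH e16 K0.
have C1 : 0 < 16 * (C + 1) by rewrite mulr_gt0// ltr_wpDl.
have eC : 0 < e / (16 * (C + 1)) by exact: divr_gt0.
have [F uF [Fn Fs]] := parseval haar sf eC.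
pose I := 'I_(size F).
pose chi (j : I) := tnth (in_tuple F) j.
have chi_inj : injective chi by apply/tuple_uniqP.
have chi0 j : 0 < cmod (ft mu f (chi j)).
  rewrite lt_neqAle cmod_ge0 andbT eq_sym; apply/eqP => c0.
  have /negP := Fn (chi j) (mem_tnth j (in_tuple F)); apply.
  by rewrite -normr_eq0 normcE c0.
have lift i : exists psi : I -> dual R (A_ i),
    (forall j, eps i < cmod (ft mu f (chi j))) ->
    (forall j, cmod (ft (mu_ i) (f_ i) (psi j) - ft mu f (chi j)) <= eps i) /\
    forall r : seq (I * bool), (size r)%:R * eps i <= 1 ->
    (\prod_(l <- r) (if l.2 then psi l.1 else (psi l.1)^-1) = 1)%g <->
    (\prod_(l <- r) (if l.2 then chi l.1 else (chi l.1)^-1) = 1)%g.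
  have [big|nbig] := pselect (forall j, eps i < cmod (ft mu f (chi j))); last first.
    by exists (fun=> dual_one R (A_ i)).
  have [ei _ iso] := epsP i; have [psi psiP] := eps_iso_lift ei iso big.
  by exists psi.
pose psi i := sval (cid (lift i)).
have psiP i := svalP (cid (lift i)); rewrite -/(psi _) in psiP.
have eps_small r : 0 < r -> \forall i \near \oo, eps i < r.
  move=> r0; have /cvgr0Pnorm_lt/(_ _ r0) := eps0.
  by apply: filterS => i; apply: le_lt_trans; exact: ler_norm.
have near_psi : \forall i \near \oo, forall j, eps i < cmod (ft mu f (chi j)).
  by apply: filter_forall => j; exact: eps_small.
have rel (r : seq (I * bool)) : \forall i \near \oo,
    (\prod_(l <- r) (if l.2 then psi i l.1 else (psi i l.1)^-1) = 1)%g <->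
    (\prod_(l <- r) (if l.2 then chi l.1 else (chi l.1)^-1) = 1)%g.
  have r1 : 0 < ((size r).+1%:R : R)^-1 by rewrite invr_gt0.
  have := eps_small _ r1; move: near_psi; apply: filterS2 => i /psiP[_ relP] er.
  apply: relP; apply: (@le_trans _ _ ((size r)%:R * (size r).+1%:R^-1)).
    by rewrite ler_wpM2l// ltW.
  by rewrite ler_pdivrMr// mul1r ler_nat.
pose z_ i j := ft (mu_ i) (f_ i) (psi i j); pose z j := ft mu f (chi j).
have zz j : z_ i j @[i --> \oo] --> z j.
  apply/cvgrPdist_lt => -[r r']; rewrite ltcE /= => /andP[/eqP -> r0].
  have := eps_small _ r0; move: near_psi; apply: filterS2 => i /psiP[close _] er.
  rewrite distrC normcE ltcR; apply: le_lt_trans er; exact: close.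
have Ptrig := trig_weak_cvg haar_ haar rel zz ch hH.
have psi_inj : \forall i \near \oo, injective (psi i).
  have : \forall i \near \oo, forall jk : I * I, psi i jk.1 = psi i jk.2 -> jk.1 = jk.2.
    apply: filter_forall => -[j l] /=.
    apply: filterS (rel [:: (j, true); (l, false)]) => i.
    rewrite !big_cons !big_nil /= !mulg1 => [[jl _]] pjl.
    move: jl; rewrite pjl mulgV => /(_ erefl)/divg1_eq.
    exact: chi_inj.
  by apply: filterS => i inj j l; exact: (inj (j, l)).
have sumz : \sum_j cmod (z_ i j) ^+ 2 @[i --> \oo] --> \sum_j cmod (z j) ^+ 2.
  elim: (index_enum I) => [|j r ih].
    by rewrite big_nil; under eq_fun do rewrite big_nil; exact: cvg_cst.
  rewrite big_cons; under eq_fun do rewrite big_cons; apply: cvgD => //.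
  rewrite sqr_cmod; under eq_fun do rewrite sqr_cmod.
  have cr : complex.Re (z_ i j) @[i --> \oo] --> complex.Re (z j).
    by apply: (cvg_comp _ _ (zz j)); exact: continuous_Re.
  have ci : complex.Im (z_ i j) @[i --> \oo] --> complex.Im (z j).
    by apply: (cvg_comp _ _ (zz j)); exact: continuous_Im.
  by apply: cvgD; [exact: (cvgM cr cr)|exact: (cvgM ci ci)].
have sz : s - \sum_j cmod (z j) ^+ 2 < e / (16 * (C + 1)).
  have -> : \sum_j cmod (z j) ^+ 2 = \sum_(eta <- F) cmod (ft mu f eta) ^+ 2.
    by rewrite [RHS]big_tnth.
  by rewrite ltrBlDr addrC -ltrBlDr.
have Pf : sqnorm mu (fun x => f x - trig chi z x) < e / (16 * (C + 1)).
  by rewrite /z sqnorm_sub_trig.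
have Pfi : \forall i \near \oo,
    sqnorm (mu_ i) (fun x => f_ i x - trig (psi i) (z_ i) x) < e / (16 * (C + 1)).
  have near_lt : \forall i \near \oo,
      s_ i - \sum_j cmod (z_ i j) ^+ 2 < e / (16 * (C + 1)).
    exact: (cvgr_lt _ (cvgB ss sumz)).
  move: psi_inj near_lt; apply: filterS2 => i inj.
  by rewrite /z_ sqnorm_sub_trig.
have si1 : \forall i \near \oo, s_ i <= s + 1.
  by apply: cvgr_le ss _ _; rewrite ltrDl.
have CC t : t < e / (16 * (C + 1)) -> C * t <= e / 16.
  move=> te; apply: (@le_trans _ _ ((C + 1) * (e / (16 * (C + 1))))).
    apply: (@le_trans _ _ (C * (e / (16 * (C + 1))))); first by rewrite ler_wpM2l// ltW.
    by rewrite ler_wpM2r ?(ltW eC)// lerDl.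
  rewrite le_eqVlt; apply/orP; left; apply/eqP; field.
  by rewrite gt_eqF// ltr_wpDl.
have btrig (B : compactAbelianGroupType) (eta : I -> dual R B) c :
    bmeas ((fun x => h (trig eta c x)) : borel B -> R).
  apply: bmeas_continuous => x; apply: continuous_comp; last exact: ch.
  exact: continuous_trig.
have strig (B : compactAbelianGroupType) (nu : probability (borel B) R) (eta : I -> dual R B) c :
    csqint nu (trig eta c).
  apply: cbmeas_csqint; split; apply: bmeas_continuous => x; apply: continuous_comp.
  - exact: continuous_trig.
  - exact: continuous_Re.
  - exact: continuous_trig.
  - exact: continuous_Im.
have step (B : compactAbelianGroupType) (nu : probability (borel B) R) (eta : I -> dual R B) c
    (g : cmfun B R) : csqint nu g -> sqnorm nu g <= s + 1 ->
    sqnorm nu (fun x => g x - trig eta c x) < e / (16 * (C + 1)) ->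
    `|expect nu (fun x => h (g x)) - expect nu (fun x => h (trig eta c x))| <= 3 * (e / 16).
  move=> sg gs gt.
  apply: le_trans (expect_comparison sg (strig _ nu eta c) (bmeas_comp ch hH g)
    (btrig _ eta c) hC) _.
  have := CC _ gt; have : k * sqnorm nu g <= k * (s + 1) by rewrite ler_wpM2l.
  rewrite -/k; move: (C * _) (k * sqnorm nu g) => u v; lra.
have step0 := step _ mu chi z f sf _ Pf.
have {}step0 : `|expect mu (fun x => h (f x)) - expect mu (fun x => h (trig chi z x))| <= 3 * (e / 16).
  by apply: step0; rewrite lerDl.
have /cvgrPdist_le/(_ _ e16) Pcvg := Ptrig.
have near2 : \forall i \near \oo, s_ i <= s + 1 /\
    sqnorm (mu_ i) (fun x => f_ i x - trig (psi i) (z_ i) x) < e / (16 * (C + 1)).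
  by apply: filterS2 si1 Pfi.
move: Pcvg near2; apply: filterS2 => i Pi [si Pfi'].
have := step _ (mu_ i) (psi i) (z_ i) (f_ i) (sf_ i) si Pfi'.
move: step0 Pi; rewrite !ler_norml => /andP[? ?] /andP[? ?] /andP[? ?].
apply/andP; split; lra.
Qed.
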